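(* Let $(M,\omega_\alpha,\mathcal F)$, $\alpha\in\{1,\dots,k\}$, be a $k$-symplectic manifold of dimension $n(k+1)$, let $L=T\mathcal F=L_1\oplus\cdots\oplus L_k$, and let $Q$ be an $n$-dimensional integrable distribution on $M$ with $TM=L\oplus Q$ such that (i) $\omega_\alpha(Y,Y')=0$ for all $Y,Y'\in\Gamma(Q)$ and all $\alpha$; (ii) $[X,Y]\in\Gamma(L_\alpha\oplus Q)$ for all $X\in\Gamma(L_\alpha)$, $Y\in\Gamma(Q)$ and all $\alpha$; (iii) $(i_1^\ast)^{-1}(\psi_1^{YY'})=\cdots=(i_k^\ast)^{-1}(\psi_k^{YY'})$ for all $Y,Y'\in\Gamma(Q)$. Then $\mathrm{Pont}^j(TM)=0$ for all $j>2n$.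
   Context: All objects are smooth; $\Gamma(E)$ denotes the sections of a bundle $E$. For a $2$-form $\omega$ put $C_x(\omega)=\{v\in T_xM:\omega_x(v,w)=0 \text{ for all } w\in T_xM\}$. A $k$-symplectic manifold $(M,\omega_\alpha,\mathcal F)$ is a manifold $M$ of dimension $n(k+1)$ with $k$ closed $2$-forms $\omega_1,\dots,\omega_k$ and an $nk$-dimensional foliation $\mathcal F$ such that $C_x(\omega_1)\cap\cdots\cap C_x(\omega_k)=\{0\}$ for all $x$, and $\omega_\alpha(X,X')=0$ for all $X,X'\in\Gamma(T\mathcal F)$ and all $\alpha$. Put $L=T\mathcal F$ and $L_{\alpha,x}=\bigcap_{\beta\neq\alpha}C_x(\omega_\beta)$ (with $L_1=L$ if $k=1$). Known facts: each $L_\alpha$ is an integrable distribution, $L=L_1\oplus\cdots\oplus L_k$, and $X\mapsto \omega_\alpha(X,\cdot)$ is an isomorphism $L_\alpha\to(TM/L)^\ast$. Using $TM=L_1\oplus\cdots\oplus L_k\oplus Q$, one identifies $L_\alpha^\ast=\mathrm{ann}\big(\bigoplus_{\beta\ne\alpha}L_\beta\oplus Q\big)$. The map $i_\alpha^\ast:Q\to L_\alpha^\ast$, $i_\alpha^\ast(Y)(X)=\omega_\alpha(Y,X)$ for $X\in L_\alpha$, is an isomorphism. For $Y,Y'\in\Gamma(Q)$, $\psi_\alpha^{YY'}$ is the $1$-form $V\mapsto Y(\omega_\alpha(Y',V))-\omega_\alpha(Y',[Y,V])$, which, under (i), (ii) and integrability of $Q$, is a section of $L_\alpha^\ast$. $\mathrm{Pont}(TM)\subset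 H^\ast(M;\mathbb R)$ denotes the Pontryagin algebra of $TM$, i.e. the subalgebra generated by the real Pontryagin classes of $TM$, and $\mathrm{Pont}^j(TM)$ is its part of cohomological degree $j$. *)

(* Defs.v *)
(* T_y M is modelled by 'rV[R]_m, through the coordinates of the chart of the
   atlas attached to the point y.  All vectors are rows, so the differential of
   f at u is the right product by the Jacobian matrix 'J f u. *)
From HB Require Import structures.
From mathcomp Require Import all_boot all_order all_fingroup all_algebra.
From mathcomp Require Import all_classical all_reals all_analysis.
Set Implicit Arguments.
Unset Strict Implicit.
Unset Printing Implicit Defensive.
Import Order.TTheory GRing.Theory Num.Theory.
Import numFieldNormedType.Exports.
Local Open Scope classical_set_scope.
Local Open Scope ring_scope.

Section Smooth.
Context {R : realType} {V W : normedModType R}.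

Fixpoint iter_derive (f : V -> W) (s : seq V) : V -> W :=
  if s is v :: s' then iter_derive (fun u => 'D_v f u) s' else f.

(* C^oo on A, intended for A open: all the iterated directional derivatives
   exist and are differentiable at every point of A. *)
Definition smooth_on (A : set V) (f : V -> W) :=
  forall (s : seq V) (u : V), A u -> differentiable (iter_derive f s) u.
End Smooth.

Section Charts.
Context {R : realType} (m : nat) (M : topologicalType).

(* Only the values of cmap on cdom, and of cinv on the image of cdom, matter. *)
Record chart := Chart {
  cdom : set M;
  cmap :> M -> 'rV[R]_m;
  cinv : 'rV[R]_m -> M }.

Definition cimg (c : chart) : set 'rV[R]_m := c @` cdom c.

(* c is a homeomorphism between open sets of M and of R^m *)
Definition is_chart (c : chart) : Prop :=
  [/\ open (cdom c), open (cimg c),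
      forall x, cdom c x -> cinv c (c x) = x,
      forall x, cdom c x -> {for x, continuous c} &
      forall u, cimg c u -> {for u, continuous (cinv c)}].

Definition compatible (c c' : chart) : Prop :=
  smooth_on (c @` (cdom c `&` cdom c')) (c' \o cinv c) /\
  smooth_on (c' @` (cdom c `&` cdom c')) (c \o cinv c').
End Charts.

(* The atlas is presented as a family (chart_at y) of charts, with y in the
   domain of chart_at y; an arbitrary atlas gives one by choosing for every
   point a chart around it, and generates the same smooth structure. *)
Record manifold (R : realType) (m : nat) := Manifold {
  carrier :> topologicalType;
  chart_at : carrier -> @chart R m carrier;
  chart_atP : forall y, is_chart (chart_at y);
  mem_chart_at : forall y, cdom (chart_at y) y;
  chart_at_compatible : forall y z, compatible (chart_at y) (chart_at z);
  carrier_hausdorff : hausdorff_space carrier;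
  carrier_second_countable : @second_countable carrier }.

Section Manifold.
Context {R : realType} {m : nat} (M : manifold R m).

Definition smooth_chart (c : @chart R m M) : Prop :=
  is_chart c /\ forall y, compatible (chart_at y) c.

(* Matrix of the differential at y of the chart c : T_y M -> R^m, and of its
   inverse R^m -> T_y M. *)
Definition dchart (c : @chart R m M) (y : M) : 'M[R]_m :=
  'J (c \o cinv (chart_at y)) (chart_at y y).
Definition dchart_inv (c : @chart R m M) (y : M) : 'M[R]_m :=
  'J (chart_at y \o cinv c) (c y).

Definition fun_rep (x : M) (f : M -> R) : 'rV[R]_m -> R^o :=
  f \o cinv (chart_at x).

Definition smooth_fun (f : M -> R) : Prop :=
  forall x, smooth_on (cimg (chart_at x)) (fun_rep x f).

Definition vfield : Type := M -> 'rV[R]_m.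

Definition field_rep (x : M) (X : vfield) (u : 'rV[R]_m) : 'rV[R]_m :=
  let y := cinv (chart_at x) u in X y *m dchart (chart_at x) y.

Definition smooth_field (X : vfield) : Prop :=
  forall x, smooth_on (cimg (chart_at x)) (field_rep x X).

(* The derivative X(f) *)
Definition vact (X : vfield) (f : M -> R) (x : M) : R :=
  'D_(X x) (fun_rep x f) (chart_at x x).

(* [X, Y], by its coordinate expression; vact (bracket X Y) f is
   X(Y(f)) - Y(X(f)) *)
Definition bracket (X Y : vfield) : vfield := fun x =>
  'D_(X x) (field_rep x Y) (chart_at x x) -
  'D_(Y x) (field_rep x X) (chart_at x x).

Definition section_of (S : M -> set 'rV[R]_m) (X : vfield) : Prop :=
  smooth_field X /\ forall x, S x (X x).

(* The p arguments of a p-form are the rows of a p x m matrix. *)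
Definition dform (p : nat) : Type := M -> 'M[R]_(p, m) -> R.

Definition rows2 (v w : 'rV[R]_m) : 'M[R]_(2, m) := col_mx v w.

Definition multilinear p (f : 'M[R]_(p, m) -> R) : Prop :=
  forall (i : 'I_p) (A B C : 'M[R]_(p, m)) (b c : R),
    row i A = b *: row i B + c *: row i C ->
    row' i B = row' i A -> row' i C = row' i A ->
    f A = b * f B + c * f C.

Definition alternating_form p (f : 'M[R]_(p, m) -> R) : Prop :=
  forall (i j : 'I_p) (A : 'M[R]_(p, m)), i != j -> row i A = row j A -> f A = 0.

Definition form_rep p (x : M) (w : dform p) (v : 'M[R]_(p, m))
    (u : 'rV[R]_m) : R^o :=
  let y := cinv (chart_at x) u in w y (v *m dchart_inv (chart_at x) y).

Definition smooth_form p (w : dform p) : Prop :=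
  [/\ forall x, multilinear (w x), forall x, alternating_form (w x) &
      forall x v, smooth_on (cimg (chart_at x)) (form_rep x w v)].

Definition ext_d p (w : dform p) : dform p.+1 := fun x v =>
  \sum_(i < p.+1)
    (-1) ^+ i * 'D_(row i v) (form_rep x w (row' i v)) (chart_at x x).

Definition wedge p q (a : dform p) (b : dform q) : dform (p + q) := fun x v =>
  (p`!%:R * q`!%:R)^-1 *
  \sum_(s : 'S_(p + q)) (-1) ^+ s *
    (a x (usubmx (row_perm s v)) * b x (dsubmx (row_perm s v))).

Definition form0 p : dform p := fun _ _ => 0.
Arguments form0 p : clear implicits.
Definition form1 : dform 0 := fun _ _ => 1.
Definition form_add p (a b : dform p) : dform p := fun x v => a x v + b x v.
Definition form_scale p (c : R) (a : dform p) : dform p := fun x v => c * a x v.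

Definition closed_form p (w : dform p) : Prop := ext_d w = form0 p.+1.

Definition exact_form p : dform p -> Prop :=
  if p is q.+1 then
    fun w => exists2 h : dform q, smooth_form h & w = ext_d h
  else fun w => w = form0 0.

(* The de Rham class of a closed form w, an element of H^p(M; R) *)
Definition cohomology_class p (w : dform p) : set (dform p) :=
  [set w' | [/\ smooth_form w', closed_form w' &
                exact_form (form_add w' (form_scale (-1) w))]].

(* nabla X Y stands for nabla_X Y *)
Record is_connection (nabla : vfield -> vfield -> vfield) : Prop := {
  nabla_smooth : forall X Y, smooth_field X -> smooth_field Y ->
    smooth_field (nabla X Y);
  nabla_linear : forall f X X' Y, smooth_fun f ->
    smooth_field X -> smooth_field X' -> smooth_field Y ->
    forall x, nabla (fun y => f y *: X y + X' y) Y x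
              = f x *: nabla X Y x + nabla X' Y x;
  nabla_add : forall X Y Y',
    smooth_field X -> smooth_field Y -> smooth_field Y' ->
    forall x, nabla X (fun y => Y y + Y' y) x = nabla X Y x + nabla X Y' x;
  nabla_leibniz : forall f X Y, smooth_fun f ->
    smooth_field X -> smooth_field Y ->
    forall x, nabla X (fun y => f y *: Y y) x
              = vact X f x *: Y x + f x *: nabla X Y x }.

(* Omega, a 2-form with values in the endomorphisms of TM, is the curvature
   of nabla. *)
Definition is_curvature (nabla : vfield -> vfield -> vfield)
    (Omega : M -> 'M[R]_(2, m) -> 'M[R]_m) : Prop :=
  forall X Y Z, smooth_field X -> smooth_field Y -> smooth_field Z ->
  forall x, nabla X (nabla Y Z) x - nabla Y (nabla X Z) x
              - nabla (bracket X Y) Z x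
            = Z x *m Omega x (rows2 (X x) (Y x)).

Fixpoint wedge_prod s : ('I_s -> dform 2) -> dform (s * 2) :=
  if s is s'.+1 then
    fun F => wedge (F ord0) (wedge_prod (fun i : 'I_s' => F (lift ord0 i)))
  else fun _ => form1.

(* The coefficient of t^s in det(1 + t Omega), i.e. the sum of the principal
   s x s minors of the matrix of 2-forms Omega.  In the sum over all
   I : 'I_s -> 'I_m, the noninjective I contribute 0 and every minor occurs s!
   times. *)
Definition det_coef (Omega : M -> 'M[R]_(2, m) -> 'M[R]_m) s : dform (s * 2) :=
  fun x v => (s`!%:R)^-1 *
    \sum_(I : {ffun 'I_s -> 'I_m}) \sum_(t : 'S_s) (-1) ^+ t *
      wedge_prod (fun l y z => Omega y z (I l) (I (t l))) x v.
Arguments det_coef Omega s : clear implicits.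

(* Chern-Weil representative of the Pontryagin class p_r(TM), of degree 4r:
   the component of degree 4r of det(1 + Omega / 2 pi). *)
Definition pontryagin_form (Omega : M -> 'M[R]_(2, m) -> 'M[R]_m) r :
    dform (2 * r * 2) :=
  form_scale ((2 * pi) ^- (2 * r)) (det_coef Omega (2 * r)).
Arguments pontryagin_form Omega r : clear implicits.

Inductive pont_form : forall p, dform p -> Prop :=
| pont_gen nabla Omega r : is_connection nabla -> is_curvature nabla Omega ->
    pont_form (pontryagin_form Omega r)
| pont_zero p : pont_form (form0 p)
| pont_one : pont_form form1
| pont_add p (a b : dform p) : pont_form a -> pont_form b ->
    pont_form (form_add a b)
| pont_scale p (c : R) (a : dform p) : pont_form a ->
    pont_form (form_scale c a)
| pont_mul p q (a : dform p) (b : dform q) : pont_form a -> pont_form b ->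
    pont_form (wedge a b).

(* The part of degree j of the subalgebra of H^*(M; R) generated by the real
   Pontryagin classes of TM *)
Definition Pont (j : nat) : set (set (dform j)) :=
  [set c | exists2 w : dform j, pont_form w & c = cohomology_class w].
Arguments Pont j : clear implicits.

(* A family of subspaces of the T_x M, given as row spaces of matrices. *)
Definition tdistribution : Type := M -> 'M[R]_m.

Definition fiber (D : tdistribution) (x : M) : set 'rV[R]_m :=
  [set v | (v <= D x)%MS].

(* Around every point there is a smooth chart (x_1, .., x_m) in which D is
   spanned by d/dx_1, .., d/dx_r: D is the tangent distribution of an
   r-dimensional foliation, whose plaques are the slices x_j = const, j > r. *)
Definition integrable_distr (r : nat) (D : tdistribution) : Prop :=
  forall x, exists c : @chart R m M, [/\ smooth_chart c, cdom c x &
    forall y, cdom c y -> (D y *m dchart c y == (pid_mx r : 'M[R]_m))%MS].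

Definition C_ (w : dform 2) (x : M) : set 'rV[R]_m :=
  [set v | forall v', w x (rows2 v v') = 0].

(* The foliation is given by its tangent distribution L. *)
Record k_symplectic (n k : nat) (omega : 'I_k -> dform 2) (L : tdistribution) :
    Prop := {
  ksym_smooth : forall a, smooth_form (omega a);
  ksym_closed : forall a, closed_form (omega a);
  ksym_foliation : integrable_distr (n * k) L;
  ksym_nondeg : forall x, \bigcap_(a in [set: 'I_k]) C_ (omega a) x = [set 0];
  ksym_isotropic : forall a X X',
    section_of (fiber L) X -> section_of (fiber L) X' ->
    forall x, omega a x (rows2 (X x) (X' x)) = 0 }.

Definition L_ (k : nat) (omega : 'I_k -> dform 2) (L : tdistribution)
    (a : 'I_k) (x : M) : set 'rV[R]_m :=
  if k == 1%N then fiber L x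
  else \bigcap_(b in [set b | b != a]) C_ (omega b) x.

Definition fiber_add (A B : M -> set 'rV[R]_m) (x : M) : set 'rV[R]_m :=
  [set v | exists2 a, A x a & exists2 b, B x b & v = a + b].

(* V |-> Y (w(Y', V)) - w(Y', [Y, V]) *)
Definition psi (w : dform 2) (Y Y' V : vfield) (x : M) : R :=
  vact Y (fun y => w y (rows2 (Y' y) (V y))) x
  - w x (rows2 (Y' x) (bracket Y V x)).

(* (i_a^* )^-1 (theta) for w = omega_a and La = L_a: the section Z of Q such
   that w(Z, V) = theta(V) for every section V of La. *)
Definition istar_inv (w : dform 2) (La : M -> set 'rV[R]_m) (Q : tdistribution)
    (theta : vfield -> M -> R) : vfield :=
  xget (fun _ : M => 0) [set Z : M -> 'rV[R]_m | section_of (fiber Q) Z /\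
    forall V, section_of La V ->
      forall x, w x (rows2 (Z x) (V x)) = theta V x].

End Manifold.
Arguments form0 {R m} M p.
Arguments Pont {R m} M j.

(* Main.v *)
Require Import Defs.
From HB Require Import structures.
From mathcomp Require Import all_boot all_order all_fingroup all_algebra.
From mathcomp Require Import all_classical all_reals all_analysis.
From mathcomp Require Import ring lra zify.
Set Implicit Arguments.
Unset Strict Implicit.
Unset Printing Implicit Defensive.
Import Order.TTheory GRing.Theory Num.Theory.
Import numFieldNormedType.Exports.
Local Open Scope classical_set_scope.
Local Open Scope ring_scope.

(* For v tangent to M write v = v_L + v_Q.  The components omega_a(v_L, q_j)
   along a transverse frame q_1, .., q_n of Q, together with the transverse
   coordinates of v in a foliated chart, form a coframe of TM; two such coframes
   differ by a matrix that is constant along the leaves.  Hence any connection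
   nabla can be changed, in the directions of L only, into a connection nabla'
   for which these coframes are parallel along the leaves, and the curvature of
   nabla' vanishes on L x L.  By Chern-Weil, tr Omega^s = tr Omega'^s + dT, and
   tr Omega'^s vanishes on 2s vectors fewer than s of which are transverse to L.
   The class of closed forms of degree p that are, modulo exact forms, closed
   forms vanishing on vectors fewer than p/2 of which are transverse to L is a
   subalgebra; by the Newton recursion it contains the Pontryagin forms.  In
   degree p > 2n such a form, being alternating, vanishes because rank Q = n. *)

(** TM is flat along the leaves for two reasons that match: TM/L is flat because transverse
    coordinates are constant on plaques, and [omega_a] makes each L_a dual to TM/L. So a transverse
    Jacobian, or the transpose of its inverse, governs each block of the change of coframe. The
    obstacle is the amount of de Rham theory behind Chern-Weil. It is kept algebraic: a form is a
    function on lists of vectors, degree and parity are conditions on it rather than part of its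
    type, and product and differential are defined by the rules for the interior product, so that
    identities follow by induction on the list. The transgression is algebraic too: the curvature of
    theta + t A is a polynomial in t, the t-derivative of the trace of its powers is exact
    coefficient by coefficient, and dividing the coefficient of t^j by j + 1 replaces the integral
    over [0, 1]. A connection acts on global fields only, and a curvature is a pointwise datum;
    cutoff functions bring both to matrices over the ring of smooth functions on an open set of R^m,
    and evaluation at points, a ring morphism, brings the identities back to M. *)

(** * Exterior forms on lists of vectors *)

(* An exterior form at a point is a function on the lists of vectors, all degrees
   together; the product is the signed sum over shuffles of the arguments. *)
Definition shuffle (V : Type) (K : comNzRingType) := seq V -> K.

HB.instance Definition _ (V : Type) (K : comNzRingType) :=
  GRing.Zmodule.copy (shuffle V K) (seq V -> K).

Section Shuffle.
Context {V : Type} {K : comNzRingType}.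
Implicit Types (a b c : shuffle V K) (v : V) (s : seq V).

Definition contract v a : shuffle V K := fun s => a (v :: s).
(** The grading involution, (-1)^p in degree p. Parity is expressed by [sbar a = a] or
    [sbar a = - a], with no degree attached to [a]. *)
Definition sbar a : shuffle V K := fun s => (-1) ^+ size s * a s.

(** The antiderivation rule for the interior product, i_v(ab) = i_v(a) b + sbar(a) i_v(b), is taken
    as the definition, so that the ring axioms follow by induction on the list with no sum over
    permutations. *)
Fixpoint smul_rec s a b : K :=
  if s is v :: s' then
    smul_rec s' (contract v a) b + smul_rec s' (sbar a) (contract v b)
  else a [::] * b [::].
Definition smul a b : shuffle V K := fun s => smul_rec s a b.
Definition sone : shuffle V K := fun s => if s is [::] then 1 else 0.

Lemma shufP a b : (forall s, a s = b s) -> a = b.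
Proof. by move=> H; apply/funext. Qed.

Lemma shuffleE : (forall a b s, (a + b) s = a s + b s) *
  (forall a s, (- a) s = - a s) * (forall s, (0 : shuffle V K) s = 0).
Proof. by []. Qed.

Lemma contractD v a b : contract v (a + b) = contract v a + contract v b.
Proof. by []. Qed.
Lemma contractN v a : contract v (- a) = - contract v a.
Proof. by []. Qed.
Lemma sbarD a b : sbar (a + b) = sbar a + sbar b.
Proof. by apply/shufP => s; rewrite /sbar !shuffleE mulrDr. Qed.
Lemma sbarN a : sbar (- a) = - sbar a.
Proof. by apply/shufP => s; rewrite /sbar !shuffleE mulrN. Qed.
Lemma sbarK a : sbar (sbar a) = a.
Proof. by apply/shufP => s; rewrite /sbar mulrA -expr2 sqrr_sign mul1r. Qed.
Lemma contract_sbar v a : contract v (sbar a) = - sbar (contract v a).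
Proof.
by apply/shufP => s; rewrite /sbar /contract shuffleE /= exprS mulN1r mulNr.
Qed.

Lemma smulDl a a' b : smul (a + a') b = smul a b + smul a' b.
Proof.
apply/shufP => s; rewrite shuffleE /smul.
elim: s a a' b => [|v s IH] a a' b /=; first by rewrite mulrDl.
by rewrite contractD sbarD !IH addrACA.
Qed.

Lemma smulDr a b b' : smul a (b + b') = smul a b + smul a b'.
Proof.
apply/shufP => s; rewrite shuffleE /smul.
elim: s a b b' => [|v s IH] a b b' /=; first by rewrite mulrDr.
by rewrite contractD !IH addrACA.
Qed.

Lemma smul0a b : smul 0 b = 0.
Proof. by apply: (addrI (smul 0 b)); rewrite -smulDl !addr0. Qed.
Lemma smula0 a : smul a 0 = 0.
Proof. by apply: (addrI (smul a 0)); rewrite -smulDr !addr0. Qed.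
Lemma smulNl a b : smul (- a) b = - smul a b.
Proof. by apply: (addrI (smul a b)); rewrite -smulDl !subrr smul0a. Qed.
Lemma smulNr a b : smul a (- b) = - smul a b.
Proof. by apply: (addrI (smul a b)); rewrite -smulDr !subrr smula0. Qed.

Lemma contract_smul v a b :
  contract v (smul a b) = smul (contract v a) b + smul (sbar a) (contract v b).
Proof. by []. Qed.

Lemma sbar_smul a b : sbar (smul a b) = smul (sbar a) (sbar b).
Proof.
apply/shufP => s; rewrite /sbar {1}/smul.
elim: s a b => [|v s IH] a b /=; first by rewrite /smul /sbar /= !mul1r.
rewrite exprS mulN1r mulNr mulrDr !IH opprD -/(sbar _) -/(sbar _) /smul /=.
rewrite -/(sbar b) -/(sbar a) !contract_sbar -!/(smul _ _ _).
by rewrite smulNl smulNr.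
Qed.

Lemma smul1a a : smul sone a = a.
Proof.
apply/shufP => s; rewrite /smul.
elim: s a => [|v s IH] a /=; first by rewrite mul1r.
have -> : contract v sone = 0 by [].
have -> : sbar sone = sone.
  by apply/shufP => -[|w t]; rewrite /sbar /= ?mul1r ?mulr0.
by rewrite IH -/(smul _ _ _) smul0a add0r.
Qed.

Lemma smula1 a : smul a sone = a.
Proof.
apply/shufP => s; rewrite /smul.
elim: s a => [|v s IH] a /=; first by rewrite mulr1.
have -> : contract v sone = 0 by [].
by rewrite IH -/(smul _ _ _) smula0 addr0.
Qed.

Lemma smulA a b c : smul a (smul b c) = smul (smul a b) c.
Proof.
apply/shufP => s.
elim: s a b c => [|v s IH] a b c; first by rewrite /smul /= mulrA.
rewrite -!/(contract v _ _) !contract_smul smulDr smulDl sbar_smul.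
by rewrite !shuffleE !IH addrA.
Qed.

Lemma sone_neq0 : sone != 0.
Proof.
by apply/eqP => /(congr1 (fun f => f [::]))/eqP; rewrite /= oner_eq0.
Qed.

HB.instance Definition _ := GRing.Zmodule_isNzRing.Build (shuffle V K)
  smulA smul1a smula1 smulDl smulDr sone_neq0.

Lemma shuffle_nil a b : (a * b) [::] = a [::] * b [::].
Proof. by []. Qed.
Lemma contractM v a b :
  contract v (a * b) = contract v a * b + sbar a * contract v b.
Proof. by []. Qed.
Lemma shuffle_cons v s a b :
  (a * b) (v :: s) = (contract v a * b) s + (sbar a * contract v b) s.
Proof. by []. Qed.
Lemma sbarM a b : sbar (a * b) = sbar a * sbar b.
Proof. exact: sbar_smul. Qed.

(** The two parities are proved together because contraction by the head of the list exchanges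
    them. *)
Lemma supercomm a b s :
  (sbar a = a -> (a * b) s = (b * a) s) /\
  (sbar a = - a -> (a * b) s = (sbar b * a) s).
Proof.
elim: s a b => [|v s IH] a b; split=> pa; rewrite ?shuffle_nil ?shuffle_cons.
- exact: mulrC.
- by rewrite mulrC /sbar mul1r.
- rewrite (IH (contract v a) b).2; last by rewrite -{2}pa contract_sbar opprK.
  by rewrite pa (IH a _).1 // addrC.
- rewrite (IH (contract v a) b).1; last first.
    by apply: oppr_inj; rewrite -contract_sbar pa contractN.
  rewrite pa mulNr shuffleE (IH a _).2 // sbarK contract_sbar mulNr shuffleE.
  by rewrite addrC.
Qed.

Lemma even_comm a b : sbar a = a -> a * b = b * a.
Proof. by move=> pa; apply/shufP => s; exact: (supercomm a b s).1. Qed.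

Lemma odd_anticomm a b : sbar a = - a -> sbar b = - b -> a * b = - (b * a).
Proof.
by move=> pa pb; apply/shufP => s; rewrite (supercomm a b s).2 // pb mulNr.
Qed.

Section Differential.
Variable D : V -> K -> K.
Hypothesis DD : forall v x y, D v (x + y) = D v x + D v y.
Hypothesis DM : forall v x y, D v (x * y) = D v x * y + x * D v y.
Hypothesis DC : forall v w x, D v (D w x) = D w (D v x).

(** Cartan's formula i_v d + d i_v = D_v for constant, hence commuting, vector fields, read as a
    recursion on the list. *)
Fixpoint sdiff_rec s a : K :=
  if s is v :: s' then D v (a s') - sdiff_rec s' (contract v a) else 0.
Definition sdiff a : shuffle V K := fun s => sdiff_rec s a.

Definition sder v a : shuffle V K := fun s => D v (a s).

Lemma contract_sdiff v a : contract v (sdiff a) = sder v a - sdiff (contract v a).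
Proof. by []. Qed.

Lemma sdiffD a b : sdiff (a + b) = sdiff a + sdiff b.
Proof.
apply/shufP => s; rewrite shuffleE /sdiff.
elim: s a b => [|v s IH] a b /=; first by rewrite addr0.
by rewrite contractD IH shuffleE DD addrACA opprD.
Qed.

Lemma sdiff0 : sdiff 0 = 0.
Proof. by apply: (addrI (sdiff 0)); rewrite -sdiffD !addr0. Qed.
Lemma sdiffN a : sdiff (- a) = - sdiff a.
Proof. by apply: (addrI (sdiff a)); rewrite -sdiffD !subrr sdiff0. Qed.

Lemma derivation0 v : D v 0 = 0.
Proof. by apply: (addrI (D v 0)); rewrite -DD !addr0. Qed.
Lemma derivationN v x : D v (- x) = - D v x.
Proof. by apply: (addrI (D v x)); rewrite -DD !subrr derivation0. Qed.
Lemma derivation_sign v n x : D v ((-1) ^+ n * x) = (-1) ^+ n * D v x.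
Proof.
by rewrite -signr_odd; case: (odd n); rewrite ?mul1r // !mulN1r derivationN.
Qed.

Lemma sder_smul v a b : sder v (a * b) = sder v a * b + a * sder v b.
Proof.
apply/shufP => s; rewrite shuffleE.
elim: s a b => [|w s IH] a b; rewrite {1}/sder ?shuffle_nil ?DM //.
rewrite !shuffle_cons DD -!/(sder _ _ _) !IH.
have -> : sder v (sbar a) = sbar (sder v a).
  by apply/shufP => t; rewrite /sder /sbar derivation_sign.
exact: addrACA.
Qed.

Lemma sbar_sdiff a : sbar (sdiff a) = - sdiff (sbar a).
Proof.
apply/shufP => s; rewrite shuffleE.
elim: s a => [|v s IH] a; first by rewrite /sbar /= mulr0 oppr0.
rewrite -!/(contract v _ _) contract_sbar !contract_sdiff contract_sbar.
rewrite sbarD sbarN sdiffN !shuffleE IH.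
have -> : sder v (sbar a) = sbar (sder v a).
  by apply/shufP => t; rewrite /sder /sbar derivation_sign.
by rewrite !opprK.
Qed.

Lemma sdiffM a b : sdiff (a * b) = sdiff a * b + sbar a * sdiff b.
Proof.
apply/shufP => s.
elim: s a b => [|v s IH] a b.
  by rewrite shuffleE !shuffle_nil /sdiff /= mul0r mulr0 addr0.
rewrite shuffleE !shuffle_cons -!/(contract v _ _) !contract_sdiff contractM.
rewrite sdiffD sder_smul sbarK !shuffleE !IH contract_sbar.
rewrite sbarK sbar_sdiff !(mulrDl, mulrDr, mulNr, mulrN) !shuffleE.
ring.
Qed.

Lemma sder_sdiff v a : sder v (sdiff a) = sdiff (sder v a).
Proof.
apply/shufP => s; rewrite /sder /sdiff.
elim: s a => [|w s IH] a /=; first exact: derivation0.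
by rewrite DD derivationN IH DC.
Qed.

Lemma sdiffK a : sdiff (sdiff a) = 0.
Proof.
apply/shufP => s; rewrite shuffleE.
elim: s a => [|v s IH] a //.
rewrite -/(contract v _ _) contract_sdiff sder_sdiff contract_sdiff.
by rewrite sdiffD sdiffN !shuffleE opprD opprK addrA subrr add0r IH.
Qed.
End Differential.

(* Applied to the degree and to the number of entries transverse to a foliation. *)
Lemma shuffle_weight (f : V -> nat) a b s :
  (forall s1 s2, (sumn (map f s1) + sumn (map f s2) = sumn (map f s))%N ->
     (size s1 + size s2 = size s)%N -> a s1 = 0 \/ b s2 = 0) ->
  (a * b) s = 0.
Proof.
elim: s a b => [|v s IH] a b H.
  by rewrite shuffle_nil; have [->|->] := H [::] [::] erefl erefl; rewrite ?mul0r ?mulr0.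
rewrite shuffle_cons !IH ?addr0 // => s1 s2 w1 w2.
  have := H s1 (v :: s2); rewrite /= /sbar => -[||->|]; rewrite ?mulr0; first lia.
  - by lia.
  - by left.
  - by right.
by have := H (v :: s1) s2; rewrite /= => -[||?|?]; [lia|lia|left|right].
Qed.

Definition altern a := forall s1 v s2, a (s1 ++ v :: v :: s2) = 0.

Lemma altern_contract v a : altern a -> altern (contract v a).
Proof. by move=> Ha s1 w s2; exact: (Ha (v :: s1)). Qed.
Lemma altern_sbar a : altern a -> altern (sbar a).
Proof. by move=> Ha s1 w s2; rewrite /sbar Ha mulr0. Qed.

Lemma alternM a b : altern a -> altern b -> altern (a * b).
Proof.
move=> Ha Hb s1 v s2; elim: s1 a b Ha Hb => [|w s1 IH] a b Ha Hb /=; last first.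
  rewrite shuffle_cons !IH ?addr0 //.
  - exact: altern_sbar.
  - exact: altern_contract.
  - exact: altern_contract.
(* With v, v in front, both copies in the same factor give 0; the two terms with one copy in each
   factor cancel through the sign of [contract_sbar]. *)
have cc0 c : altern c -> contract v (contract v c) = 0.
  by move=> Hc; apply/shufP => s; exact: (Hc [::]).
rewrite !shuffle_cons !cc0 // mul0r mulr0 contract_sbar mulNr !shuffleE.
by rewrite add0r addr0 subrr.
Qed.
Lemma shuffle_scalel (k : K) a b s :
  (((fun s => k * a s) : shuffle V K) * b) s = k * (a * b) s.
Proof.
elim: s a b => [|v s IH] a b; first by rewrite !shuffle_nil mulrA.
rewrite !shuffle_cons mulrDr -!IH; congr (_ + _); congr ((_ * _ : shuffle V K) s).
by apply/shufP => t; rewrite /sbar mulrCA.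
Qed.

Lemma shuffle_scaler (k : K) a b s :
  (a * ((fun s => k * b s) : shuffle V K)) s = k * (a * b) s.
Proof.
elim: s a b => [|v s IH] a b; first by rewrite !shuffle_nil mulrCA.
by rewrite !shuffle_cons mulrDr -!IH.
Qed.

End Shuffle.

Section ShuffleLinear.
Context {K : comNzRingType} {V : lmodType K}.
Implicit Types (a b : shuffle V K).

Definition multilin a := forall s1 c v w s2,
  a (s1 ++ (c *: v + w) :: s2) = c * a (s1 ++ v :: s2) + a (s1 ++ w :: s2).

Lemma multilin_sbar a : multilin a -> multilin (sbar a).
Proof.
move=> Ha s1 c v w s2; rewrite /sbar Ha mulrDr !size_cat /=.
by rewrite mulrCA.
Qed.

Lemma multilin_contract v a : multilin a -> multilin (contract v a).
Proof. by move=> Ha s1 c u w s2; exact: (Ha (v :: s1)). Qed.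

Lemma multilinM a b : multilin a -> multilin b -> multilin (a * b).
Proof.
move=> Ha Hb s1 c v w s2; elim: s1 a b Ha Hb => [|u s1 IH] a b Ha Hb /=; last first.
  rewrite !shuffle_cons !IH ?mulrDr //; first by rewrite addrACA.
  - exact: multilin_sbar.
  - exact: multilin_contract.
  - exact: multilin_contract.
rewrite !shuffle_cons.
have ce d : multilin d -> contract (c *: v + w) d =
    ((fun s => c * contract v d s) : shuffle V K) + contract w d.
  by move=> Hd; apply/shufP => s; exact: (Hd [::]).
rewrite !ce // mulrDl mulrDr !shuffleE shuffle_scalel // shuffle_scaler mulrDr.
by rewrite addrACA.
Qed.

Lemma multilin_shufD a b : multilin a -> multilin b -> multilin (a + b).
Proof. by move=> Ha Hb s1 c v w s2; rewrite !shuffleE Ha Hb mulrDr addrACA. Qed.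
End ShuffleLinear.

Section ShuffleMap.
Context {V V' : Type} {K K' : comNzRingType} (f : {rmorphism K -> K'}) (g : V' -> V).

(** Serves twice: with [f] the evaluation of smooth functions at a point, and with [g] a linear
    change of coordinates on the arguments. *)
Definition smap (a : shuffle V K) : shuffle V' K' := fun s => f (a (map g s)).

Lemma smap_is_additive : zmod_morphism smap.
Proof. by move=> a b; apply/shufP => s; rewrite /smap !shuffleE rmorphB. Qed.

Lemma smap_is_multiplicative : monoid_morphism smap.
Proof.
split; first by apply/shufP => -[|v s]; rewrite /smap /= ?rmorph1 ?rmorph0.
move=> a b; apply/shufP => s; rewrite {1}/smap.
elim: s a b => [|v s IH] a b; first by rewrite !shuffle_nil rmorphM.
rewrite /= !shuffle_cons rmorphD !IH; congr (_ + _).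
congr ((_ * _ : shuffle V' K') s); apply/shufP => t.
by rewrite /smap /sbar rmorphM rmorphXn rmorphN1 size_map.
Qed.

HB.instance Definition _ := GRing.isZmodMorphism.Build _ _ smap smap_is_additive.
HB.instance Definition _ :=
  GRing.isMonoidMorphism.Build _ _ smap smap_is_multiplicative.
End ShuffleMap.

(** * Chern-Weil transgression *)

(** The axioms isolate what the transgression uses, since it runs over two algebras: matrices of
    forms, and polynomials in t over them. [bar] is the grading involution and [tau] a trace that is
    cyclic up to the sign of two odd factors. *)
Record trace_dga (B : nzRingType) (C : zmodType) (bar d : B -> B) (dC : C -> C)
    (tau : B -> C) : Prop := TraceDga {
  dga_barD : forall x y, bar (x + y) = bar x + bar y;
  dga_barM : forall x y, bar (x * y) = bar x * bar y;
  dga_dD : forall x y, d (x + y) = d x + d y;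
  dga_bar_d : forall x, bar (d x) = - d (bar x);
  dga_dM : forall x y, d (x * y) = d x * y + bar x * d y;
  dga_dd : forall x, d (d x) = 0;
  dga_tauD : forall x y, tau (x + y) = tau x + tau y;
  dga_tau_d : forall x, tau (d x) = dC (tau x);
  dga_tau_even : forall x y, bar x = x -> tau (x * y) = tau (y * x);
  dga_tau_odd : forall x y, bar x = - x -> bar y = - y ->
    tau (x * y) = - tau (y * x) }.

Lemma additive0 (A B : zmodType) (f : A -> B) :
  (forall x y, f (x + y) = f x + f y) -> f 0 = 0.
Proof. by move=> H; apply: (addrI (f 0)); rewrite -H !addr0. Qed.
Lemma additiveN (A B : zmodType) (f : A -> B) :
  (forall x y, f (x + y) = f x + f y) -> forall x, f (- x) = - f x.
Proof. by move=> H x; apply: (addrI (f x)); rewrite -H !subrr (additive0 H). Qed.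
Lemma additiveMn (A B : zmodType) (f : A -> B) :
  (forall x y, f (x + y) = f x + f y) -> forall x n, f (x *+ n) = f x *+ n.
Proof. by move=> H x; elim=> [|n IH]; rewrite ?(additive0 H) // !mulrS H IH. Qed.

Section ChernWeil.
Variables (B : nzRingType) (C : zmodType) (bar d : B -> B) (dC : C -> C).
Variables (tau : B -> C).
Hypothesis H : trace_dga bar d dC tau.
Implicit Types (theta alpha : B).

Definition curvature_of theta := d theta - theta * theta.

Lemma even_curvature theta : bar theta = - theta ->
  bar (curvature_of theta) = curvature_of theta.
Proof.
move=> ot; rewrite /curvature_of (dga_barD H) (additiveN (dga_barD H)).
rewrite (dga_bar_d H) (dga_barM H) ot mulrNN (additiveN (dga_dD H)).
by rewrite opprK.
Qed.

Lemma even_curvatureX theta s : bar theta = - theta ->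
  bar (curvature_of theta ^+ s.+1) = curvature_of theta ^+ s.+1.
Proof.
move=> ot; elim: s => [|s IH]; first by rewrite even_curvature.
by rewrite exprS (dga_barM H) IH even_curvature.
Qed.

Lemma bianchi theta s : bar theta = - theta ->
  d (curvature_of theta ^+ s.+1) =
  theta * curvature_of theta ^+ s.+1 - curvature_of theta ^+ s.+1 * theta.
Proof.
move=> ot.
have b0 : d (curvature_of theta) =
    theta * curvature_of theta - curvature_of theta * theta.
  rewrite /curvature_of (dga_dD H) (additiveN (dga_dD H)) (dga_dM H).
  rewrite (dga_dd H) ot add0r mulrBr mulrBl mulNr mulrA.
  by rewrite !opprB addrA subrK.
have := even_curvature ot; move: (curvature_of theta) b0 => Om b0 e0.
elim: s => [|s IH]; first exact: b0.
rewrite exprS (dga_dM H) IH e0 b0 mulrBl mulrBr !mulrA.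
by rewrite addrA subrK.
Qed.

Lemma trace_curvature_closed theta s : bar theta = - theta ->
  dC (tau (curvature_of theta ^+ s.+1)) = 0.
Proof.
move=> ot; rewrite -(dga_tau_d H) bianchi // (dga_tauD H).
rewrite (additiveN (dga_tauD H)) (dga_tau_even H (x := _ ^+ _)) ?subrr //.
exact: even_curvatureX.
Qed.

(** By Bianchi the differential of the power is its commutator with theta; cyclicity of the trace,
    with the sign for two odd factors, turns it into the terms that complete d alpha to the
    covariant differential of alpha. *)
Lemma trace_transgression theta alpha s :
  bar theta = - theta -> bar alpha = - alpha ->
  tau (curvature_of theta ^+ s * (d alpha - alpha * theta - theta * alpha))
  = dC (tau (curvature_of theta ^+ s * alpha)).
Proof.
move=> ot oa; rewrite -(dga_tau_d H) (dga_dM H).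
have -> : tau (d (curvature_of theta ^+ s) * alpha
        + bar (curvature_of theta ^+ s) * d alpha) =
    tau (theta * curvature_of theta ^+ s * alpha
        - curvature_of theta ^+ s * theta * alpha
        + curvature_of theta ^+ s * d alpha).
  case: s => [|s]; last by rewrite bianchi // even_curvatureX // mulrBl.
  rewrite !expr0 mulr1 !mul1r subrr add0r.
  have := dga_dM H 1 alpha; rewrite !mul1r => /(congr1 tau).
  by rewrite (dga_tauD H) => <-.
have e : bar (curvature_of theta ^+ s * alpha) =
    - (curvature_of theta ^+ s * alpha).
  case: s => [|s]; first by rewrite expr0 mul1r.
  by rewrite (dga_barM H) even_curvatureX // oa mulrN.
rewrite !mulrBr !(dga_tauD H) !(additiveN (dga_tauD H)).
rewrite -[theta * _ * _]mulrA (dga_tau_odd H ot e) !mulrA.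
by rewrite [RHS]addrC addrA.
Qed.

(** First variation of a characteristic form: cyclicity gathers the derivatives of the s factors
    into s tau(Omega^(s-1) D Omega), and D Omega is the covariant differential of the odd element D
    theta. It is applied to D = d/dt. *)
Lemma trace_derivation (D : B -> B) theta s :
  (forall x y, D (x + y) = D x + D y) ->
  (forall x y, D (x * y) = D x * y + x * D y) ->
  (forall x, D (d x) = d (D x)) -> (forall x, D (bar x) = bar (D x)) ->
  bar theta = - theta ->
  tau (D (curvature_of theta ^+ s)) =
  dC (tau (curvature_of theta ^+ s.-1 * D theta) *+ s).
Proof.
move=> DD DM Dd Db ot.
have D1 : D 1 = 0 by apply: (addrI (D 1)); rewrite addr0 -{3}(mulr1 1) DM mulr1 mul1r.
have Dcurv : D (curvature_of theta) =
    d (D theta) - D theta * theta - theta * D theta.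
  by rewrite /curvature_of DD (additiveN DD) DM Dd opprD addrA.
have oD : bar (D theta) = - D theta by rewrite -Db ot (additiveN DD).
have -> : tau (D (curvature_of theta ^+ s)) =
    tau (curvature_of theta ^+ s.-1 * D (curvature_of theta)) *+ s.
  (* The spare power y on the right lets the induction on r strip one factor at a time. *)
  have key r y : tau (D (curvature_of theta ^+ r) * curvature_of theta ^+ y) =
      tau (curvature_of theta ^+ (r + y).-1 * D (curvature_of theta)) *+ r.
    elim: r y => [|r IH] y.
      by rewrite expr0 D1 mul0r (additive0 (dga_tauD H)).
    rewrite exprSr DM mulrDl (dga_tauD H) -!mulrA -exprS IH addnS addSn /=.
    rewrite mulrSr; congr (_ + _).
    case: y => [|y]; first by rewrite expr0 mulr1 addn0.
    rewrite mulrA -(dga_tau_even H); last exact: even_curvatureX.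
    by rewrite mulrA -exprD addnC.
  by have := key s 0; rewrite expr0 mulr1 addn0.
rewrite Dcurv trace_transgression // -(additiveMn (dga_tauD H)).
by rewrite -!(dga_tau_d H) (additiveMn (dga_dD H)) (additiveMn (dga_tauD H)).
Qed.
End ChernWeil.

Lemma zmod_regroup (A : zmodType) (a b c e f g : A) :
  (a - b) + (c - e - f) - g = (a + c) - ((b + e) + (f + g)).
Proof. by rewrite !opprD !addrA [LHS](ACl (1*3*2*4*5*6)). Qed.

(** * Transgression along a polynomial path of connections *)

Section Polynomial.
Variables (B C : nzRingType) (bar d : B -> B) (dC : C -> C) (tau : B -> C).
Hypothesis H : trace_dga bar d dC tau.
Hypothesis dC0 : dC 0 = 0.

Let bar0 := additive0 (dga_barD H).
Let d0 := additive0 (dga_dD H).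
Let tau0 := additive0 (dga_tauD H).

Lemma additive_sum (A A' : zmodType) (f : A -> A') :
  (forall x y, f (x + y) = f x + f y) ->
  forall I r (P : pred I) F, f (\sum_(i <- r | P i) F i) = \sum_(i <- r | P i) f (F i).
Proof. by move=> fD I r P F; rewrite (big_morph f fD (additive0 fD)). Qed.

(** The parameter t is central, even and closed, so every axiom holds coefficient by coefficient. *)
Lemma poly_trace_dga :
  trace_dga (map_poly bar) (map_poly d) (map_poly dC) (map_poly tau).
Proof.
split=> [x y|x y|x y|x|x y|x|x y|x|x y ex|x y ex ey]; apply/polyP => i.
- by rewrite coefD !coef_map_id0 // coefD (dga_barD H).
- rewrite coef_map_id0 // !coefM (additive_sum (dga_barD H)).
  by apply: eq_bigr => j _; rewrite !coef_map_id0 // (dga_barM H).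
- by rewrite coefD !coef_map_id0 // coefD (dga_dD H).
- by rewrite coefN !coef_map_id0 // (dga_bar_d H).
- rewrite coefD coef_map_id0 // !coefM (additive_sum (dga_dD H)) -big_split.
  by apply: eq_bigr => j _; rewrite !coef_map_id0 // (dga_dM H).
- by rewrite coef0 !coef_map_id0 // (dga_dd H).
- by rewrite coefD !coef_map_id0 // coefD (dga_tauD H).
- by rewrite !coef_map_id0 // (dga_tau_d H).
- rewrite !coef_map_id0 // coefM coefMr !(additive_sum (dga_tauD H)).
  apply: eq_bigr => j _; rewrite (dga_tau_even H) //.
  by rewrite -[in RHS]ex coef_map_id0.
rewrite coefN !coef_map_id0 // coefM coefMr !(additive_sum (dga_tauD H)).
rewrite -sumrN; apply: eq_bigr => j _; apply: (dga_tau_odd H).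
  by rewrite -coefN -ex coef_map_id0.
by rewrite -coefN -ey coef_map_id0.
Qed.

(* Interpolates the curvatures W0 of theta and W1 of theta + A: it is the
   curvature of theta + t A. *)
Definition curvature_path (W0 W1 A : B) : {poly B} :=
  W0%:P + (W1 - W0 + A * A)%:P * 'X - (A * A)%:P * 'X^2.

(** The coefficient of t^j in s tr(Omega_t^(s-1) A), the integrand of the Chern-Simons form. *)
Definition transgression (W0 W1 A : B) s j : C :=
  tau (curvature_path W0 W1 A ^+ s.-1 * A%:P)`_j *+ s.

Lemma curvature_pathE theta A :
  curvature_path (curvature_of d theta) (curvature_of d (theta + A)) A =
  curvature_of (map_poly d) (theta%:P + A%:P * 'X).
Proof.
rewrite [RHS]/curvature_of /curvature_path.
have -> : map_poly d (theta%:P + A%:P * 'X) = (d theta)%:P + (d A)%:P * 'X.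
  apply/polyP => i; rewrite coef_map_id0 // !coefD !coefMX !coefC.
  by case: i => [|[|i]] /=; rewrite ?addr0 ?add0r ?d0.
have -> : curvature_of d (theta + A) - curvature_of d theta + A * A =
    d A - theta * A - A * theta.
  rewrite /curvature_of (dga_dD H) mulrDl !mulrDr -zmod_regroup.
  by rewrite addrAC subrK addrC addKr.
rewrite /curvature_of mulrDl !mulrDr.
have cX : 'X * theta%:P = theta%:P * 'X :> {poly B} by rewrite commr_polyX.
have cA : 'X * A%:P = A%:P * 'X :> {poly B} by rewrite commr_polyX.
rewrite -[A%:P * 'X * theta%:P]mulrA cX -[A%:P * 'X * (_ * 'X)]mulrA.
rewrite ['X * (_ * _)]mulrA cA !mulrA -zmod_regroup !polyCB !polyCM !mulrBl.
by [].
Qed.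

(** At t = 1 a polynomial is the sum of its coefficients, and the one of t^0 belongs to theta. The
    coefficient of t^(j+1), multiplied by j + 1, is a coefficient of the t-derivative, which
    [trace_derivation] makes exact. The division by j + 1 waits for real coefficients. *)
Lemma transgressionE theta A s : bar theta = - theta -> bar A = - A ->
  let W0 := curvature_of d theta in let W1 := curvature_of d (theta + A) in
  let Wt := map_poly tau (curvature_path W0 W1 A ^+ s) in
  tau (W1 ^+ s) = tau (W0 ^+ s) + \sum_(j < 2 * s) Wt`_j.+1 /\
  forall j, Wt`_j.+1 *+ j.+1 = dC (transgression W0 W1 A s j).
Proof.
move=> ot oA W0 W1 Wt; split.
  have horner1 (p : {poly B}) (q : {poly B}) : (p * q).[1] = p.[1] * q.[1].
    by rewrite hornerM_comm // /comm_poly mul1r mulr1.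
  have pow1 (p : {poly B}) n : (p ^+ n).[1] = p.[1] ^+ n.
    by elim: n => [|n IH]; rewrite ?hornerC // !exprS horner1 IH.
  have W1E : W1 = (curvature_path W0 W1 A).[1].
    rewrite /curvature_path !(hornerD, hornerN, horner1, hornerC, hornerX, hornerXn).
    by rewrite expr1n !mulr1 addrA addrK addrC subrK.
  (* The path has degree at most 2 in t, hence the bound 2 s on the number of correction terms. *)
  have sz : (size (curvature_path W0 W1 A ^+ s) <= (2 * s).+1)%N.
    apply: leq_trans (size_exp_leq _ _) _; rewrite ltnS.
    have : (size (curvature_path W0 W1 A) <= 3)%N.
      apply/leq_sizeP => -[|[|[|j]]] // _.
      by rewrite !coefD coefN coefMX coefMXn !coefC /= subr0 addr0.
    move: (size _) => k k3; rewrite mulnC [leqRHS]mulnC leq_mul2l.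
    by apply/orP; right; move: k3; case: (k).
  rewrite {1}W1E -pow1 (horner_coef_wide _ sz) big_ord_recl !expr0 mulr1.
  rewrite (dga_tauD H) (additive_sum (dga_tauD H)); congr (tau _ + _).
    have W0E : (curvature_path W0 W1 A)`_0 = W0.
      by rewrite /curvature_path !coefD coefN coefMX coefMXn /= !coefC subr0 addr0.
    elim: (s) => [|k IH]; first by rewrite !expr0 coef1.
    by rewrite !exprS coef0M IH W0E.
  by apply: eq_bigr => i _; rewrite expr1n mulr1 coef_map_id0.
move=> j.
pose th := theta%:P + A%:P * 'X.
have oth : map_poly bar th = - th.
  apply/polyP => i; rewrite coef_map_id0 // coefN /th !coefD !coefMX !coefC.
  by case: i => [|[|i]] /=; rewrite ?addr0 ?add0r ?bar0 ?oppr0.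
have Dth : th^`() = A%:P.
  by rewrite /th derivD derivC derivM derivC derivX mul0r mulr1 !add0r.
have e1 x : (map_poly d x)^`() = map_poly d x^`().
  apply/polyP => i; rewrite !(coef_deriv, coef_map_id0) //.
  by rewrite (additiveMn (dga_dD H)).
have e2 x : (map_poly bar x)^`() = map_poly bar x^`().
  apply/polyP => i; rewrite !(coef_deriv, coef_map_id0) //.
  by rewrite (additiveMn (dga_barD H)).
have := trace_derivation poly_trace_dga s (@derivD _) (@derivM _) e1 e2 oth.
rewrite -curvature_pathE -/W0 -/W1 Dth => /(congr1 (fun p : {poly C} => p`_j)).
rewrite !(coef_map_id0, coef_deriv, coefMn) // (additiveMn (dga_tauD H)) => ->.
by [].
Qed.
End Polynomial.

Section MatrixDGA.
Variables (V : Type) (K : comNzRingType) (m : nat) (D : V -> K -> K).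
Hypothesis DD : forall v x y, D v (x + y) = D v x + D v y.
Hypothesis DM : forall v x y, D v (x * y) = D v x * y + x * D v y.
Hypothesis DC : forall v w x, D v (D w x) = D w (D v x).

(** Cyclicity of the trace up to sign is graded commutativity of the entries. The size is a
    successor because matrices of size 0 form the zero ring. *)
Lemma matrix_trace_dga : trace_dga (map_mx (@sbar V K) : 'M[_]_m.+1 -> 'M[_]_m.+1)
  (map_mx (sdiff D)) (sdiff D) (@mxtrace _ m.+1).
Proof.
pose F := @additive_sum.
split=> [x y|x y|x y|x|x y|x|x y|x|x y ex|x y ex ey].
- by apply/matrixP => i j; rewrite !mxE sbarD.
- apply/matrixP => i j; rewrite !mxE (F _ _ _ (@sbarD V K)).
  by apply: eq_bigr => k _; rewrite !mxE sbarM.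
- by apply/matrixP => i j; rewrite !mxE (sdiffD DD).
- by apply/matrixP => i j; rewrite !mxE (sbar_sdiff DD).
- apply/matrixP => i j; rewrite !mxE (F _ _ _ (sdiffD DD)) -big_split.
  by apply: eq_bigr => k _; rewrite !mxE (sdiffM DD DM).
- by apply/matrixP => i j; rewrite !mxE (sdiffK DD DC).
- by rewrite mxtraceD.
- rewrite /mxtrace (F _ _ _ (sdiffD DD)).
  by apply: eq_bigr => k _; rewrite !mxE.
- rewrite /mxtrace; under eq_bigr do rewrite mxE.
  under [RHS]eq_bigr do rewrite mxE.
  rewrite exchange_big; apply: eq_bigr => i _; apply: eq_bigr => j _.
  by rewrite even_comm // -[in RHS]ex mxE.
rewrite /mxtrace; under eq_bigr do rewrite mxE.
under [in RHS]eq_bigr do rewrite mxE.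
rewrite exchange_big -sumrN; apply: eq_bigr => i _.
rewrite -sumrN; apply: eq_bigr => j _.
apply: odd_anticomm.
  by have /matrixP/(_ j i) := ex; rewrite !mxE.
by have /matrixP/(_ i j) := ey; rewrite !mxE.
Qed.
End MatrixDGA.

(** * Wedge products and minors *)

Section ListOfFunction.
Context {T : Type}.

Definition lst n (v : 'I_n -> T) : seq T := [seq v i | i <- enum 'I_n].

Lemma size_lst n (v : 'I_n -> T) : size (lst v) = n.
Proof. by rewrite size_map size_enum_ord. Qed.

Lemma lstS n (v : 'I_n.+1 -> T) : lst v = v ord0 :: lst (v \o lift ord0).
Proof. by rewrite /lst enum_ordSl /= -map_comp. Qed.

Lemma nth_lst x0 n (v : 'I_n -> T) (i : 'I_n) : nth x0 (lst v) i = v i.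
Proof. by rewrite (nth_map i) ?size_enum_ord // nth_ord_enum. Qed.

Lemma eq_lst n (v w : 'I_n -> T) : v =1 w -> lst v = lst w.
Proof. by move=> vw; apply: eq_map. Qed.

(** Isolates the position i at which the first vector lands, which is what the recursion of the
    shuffle product follows. *)
Lemma lst_lift_perm n (v : 'I_n.+1 -> T) (i : 'I_n.+1) (s : 'S_n) :
  let l := lst ((v \o lift ord0) \o s) in
  lst (v \o lift_perm i ord0 s) = take i l ++ v ord0 :: drop i l.
Proof.
move=> l; have sl : size l = n by rewrite size_lst.
apply: (@eq_from_nth _ (v ord0)).
  rewrite size_lst size_cat /= size_take size_drop sl.
  by case: ifP; have := ltn_ord i; lia.
suff key (j : 'I_n.+1) : nth (v ord0) (lst (v \o lift_perm i ord0 s)) j =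
    nth (v ord0) (take i l ++ v ord0 :: drop i l) j.
  by move=> j; rewrite size_lst => jn; exact: (key (Ordinal jn)).
rewrite nth_lst /=.
have st : size (take i l) = i.
  by rewrite size_take sl; case: ifP => //; have := ltn_ord i; lia.
rewrite nth_cat st.
case: (unliftP i j) => [k|] ->; last by rewrite lift_perm_id ltnn subnn.
rewrite lift_perm_lift /= /bump.
have lk : v (lift ord0 (s k)) = nth (v ord0) l k by rewrite nth_lst.
case: (leqP i k) => ik /=.
  rewrite add1n ltnNge (leqW ik) /= subSn // /= nth_drop subnKC //.
by rewrite add0n ik nth_take.
Qed.
End ListOfFunction.

Lemma sign_cancel1 (K : comNzRingType) i (s x y : K) :
  (-1) ^+ i * s * ((-1) ^+ i * x * y) = s * (x * y).
Proof. by rewrite mulrAC !mulrA -expr2 sqrr_sign mul1r; ring. Qed.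

Lemma sign_cancel2 (K : comNzRingType) i p (s x y : K) :
  (-1) ^+ i * (-1) ^+ p * s * (x * ((-1) ^+ i * y)) = s * ((-1) ^+ p * x * y).
Proof.
rewrite mulrCA -!mulrA mulrCA !mulrA.
have := sqrr_sign K i; move: ((-1) ^+ i) ((-1) ^+ p) => e f e2.
by rewrite -[RHS]mul1r -e2; ring.
Qed.

Lemma sum_lift_perm (V : nmodType) n (F : 'S_n.+1 -> V) i j :
  \sum_(s : 'S_n.+1 | s i == j) F s = \sum_(s : 'S_n) F (lift_perm i j s).
Proof.
rewrite (reindex (lift_perm i j)); last first.
  (* The inverse of the lift: i is deleted from the source and s i from the target. *)
  pose ulsf i (s : 'S_n.+1) k := odflt k (unlift (s i) (s (lift i k))).
  have ulsfK i1 (s : 'S_n.+1) k: lift (s i1) (ulsf i1 s k) = s (lift i1 k).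
    rewrite /ulsf; have:= neq_lift i1 k.
    by rewrite -(can_eq (permK s)) => /unlift_some[] ? ? ->.
  have inj_ulsf: injective (ulsf i _).
    move=> s; apply: can_inj (ulsf (s i) s^-1%g) _ => k'.
    by rewrite {1}/ulsf ulsfK !permK liftK.
  exists (fun s => perm (inj_ulsf s)) => [s _ | s].
    by apply/permP=> k'; rewrite permE /ulsf lift_perm_lift lift_perm_id liftK.
  move/(s _ =P _) => si0; apply/permP=> k.
  case: (unliftP i k) => [k'|] ->; rewrite ?lift_perm_id //.
  by rewrite lift_perm_lift -si0 permE ulsfK.
by apply: eq_bigl => s; rewrite lift_perm_id eqxx.
Qed.

Lemma sum_by_preimage (V : nmodType) n (F : 'S_n.+1 -> V) :
  \sum_s F s = \sum_i \sum_(s : 'S_n) F (lift_perm i ord0 s).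
Proof.
rewrite (partition_big (fun s : 'S_n.+1 => s^-1%g ord0) xpredT) //=.
apply: eq_bigr => i _; rewrite -sum_lift_perm; apply: eq_bigl => s.
by apply/eqP/eqP => [<-|<-]; rewrite ?permKV ?permK.
Qed.

(** Sorts permutations by the image a of [ord0]: for a = [ord0] this index is a fixed point,
    otherwise the transposition inserts it into a cycle of s. *)
Lemma sum_by_tperm (V : nmodType) n (F : 'S_n.+1 -> V) :
  \sum_s F s =
  \sum_a \sum_(s : 'S_n) F (lift_perm ord0 ord0 s * tperm ord0 a)%g.
Proof.
rewrite (partition_big (fun s : 'S_n.+1 => s ord0) xpredT) //=.
apply: eq_bigr => a _; rewrite (reindex_inj (mulIg (tperm ord0 a))) /=.
rewrite -(sum_lift_perm (fun u => F (u * tperm ord0 a)%g)).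
apply: eq_bigl => s; rewrite permM.
by rewrite -[X in _ == X](tpermL ord0 a) (inj_eq perm_inj).
Qed.

Section WedgeSum.
Context {T : Type} {K : comNzRingType}.
Implicit Types (a b : shuffle T K).

Definition homog p a := forall s, size s != p -> a s = 0.
Definition antisym a :=
  forall s1 v w s2, a (s1 ++ v :: w :: s2) = - a (s1 ++ w :: v :: s2).

Lemma homog_contract v p a : homog p.+1 a -> homog p (contract v a).
Proof. by move=> Ha s sp; apply: Ha. Qed.

Lemma antisym_contract v a : antisym a -> antisym (contract v a).
Proof. by move=> Ha s1 x y s2; exact: (Ha (v :: s1)). Qed.

Lemma antisym_sbar a : antisym a -> antisym (sbar a).
Proof. by move=> Ha s1 v w s2; rewrite /sbar Ha mulrN !size_cat. Qed.

Lemma antisym_insert a v s2 s1 : antisym a ->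
  a (s1 ++ v :: s2) = (-1) ^+ size s1 * a (v :: s1 ++ s2).
Proof.
move=> Ha; elim/last_ind: s1 s2 => [|s1 w IH] s2; first by rewrite mul1r.
rewrite cat_rcons Ha IH cat_rcons size_rcons exprS mulN1r mulNr.
by [].
Qed.

Definition wedge_sum n p a b (v : 'I_n -> T) : K :=
  \sum_(s : 'S_n) (-1) ^+ s *
     (a (take p (lst (v \o s))) * b (drop p (lst (v \o s)))).

(** Induction on n by the position i of the first vector. If i < p it is an argument of a, otherwise
    of b; moving it to the front costs a sign that the sign of the permutation absorbs, up to the
    (-1)^p of [sbar a] in the second case. The p positions of the first kind contribute equally, and
    so do the q others, whence p (p-1)! q! = p! q! and its twin. *)
Lemma wedge_sumE n p q a b (v : 'I_n -> T) : n = (p + q)%N ->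
  homog p a -> homog q b -> antisym a -> antisym b ->
  wedge_sum p a b v = (p`! * q`!)%:R * (a * b) (lst v).
Proof.
elim: n p q a b v => [|n IH] p q a b v npq Ha Hb Aa Ab.
  have [-> ->] : p = 0%N /\ q = 0%N by lia.
  have lnil (w : 'I_0 -> T) : lst w = [::] by apply: size0nil; rewrite size_lst.
  rewrite /wedge_sum (big_pred1 1%g) => [|s]; last first.
    by apply/esym/eqP/permP => -[].
  by rewrite odd_perm1 expr0 mul1r !lnil /= mul1r shuffle_nil.
pose v0 := v ord0; pose w := v \o lift ord0.
have C1 (i : 'I_n.+1) : (i < p)%N ->
    \sum_(s : 'S_n) (-1) ^+ lift_perm i ord0 s *
     (a (take p (lst (v \o lift_perm i ord0 s))) *
      b (drop p (lst (v \o lift_perm i ord0 s)))) =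
    ((p.-1)`! * q`!)%:R * (contract v0 a * b) (lst w).
  case: p Ha npq => // p Ha npq ip.
  rewrite -(IH p q) //; [|lia|exact: homog_contract|exact: antisym_contract].
  apply: eq_bigr => s _; rewrite lst_lift_perm -/w -/v0.
  set l := lst _; have sl : size l = n by rewrite size_lst.
  have st : size (take i l) = i by rewrite size_takel // sl; lia.
  rewrite take_cat drop_cat st ltnNge (ltnW ip) /= subSn //= drop_drop subnK //.
  rewrite antisym_insert // st /contract -takeD subnKC //.
  rewrite odd_lift_perm addbF signr_addb signr_odd.
  exact: sign_cancel1.
have C2 (i : 'I_n.+1) : (p <= i)%N ->
    \sum_(s : 'S_n) (-1) ^+ lift_perm i ord0 s *
     (a (take p (lst (v \o lift_perm i ord0 s))) *
      b (drop p (lst (v \o lift_perm i ord0 s)))) =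
    (p`! * (q.-1)`!)%:R * (sbar a * contract v0 b) (lst w).
  move=> pi; have := ltn_ord i.
  case: q {C1} Hb npq => [|q] Hb npq; first by lia.
  move=> ilt; rewrite -(IH p q) //; first last.
  - exact: antisym_contract.
  - exact: antisym_sbar.
  - exact: homog_contract.
  - by move=> s sp; rewrite /sbar Ha // mulr0.
  - by lia.
  apply: eq_bigr => s _; rewrite lst_lift_perm -/w -/v0.
  set l := lst _; have sl : size l = n by rewrite size_lst.
  have st : size (take i l) = i by rewrite size_takel // sl; lia.
  have sp : size (take p l) = p by rewrite size_takel // sl; lia.
  rewrite take_cat drop_cat st.
  have -> : (if (p < i)%N then take p (take i l)
    else take i l ++ take (p - i) (v0 :: drop i l)) = take p l.
    case: ltnP => [pi'|ip]; first by rewrite take_takel // ltnW.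
    have -> : i = p :> nat by lia.
    by rewrite subnn take0 cats0.
  have -> : (if (p < i)%N then drop p (take i l) ++ v0 :: drop i l
    else drop (p - i) (v0 :: drop i l)) =
    take (i - p) (drop p l) ++ v0 :: drop (i - p) (drop p l).
    case: ltnP => [pi'|ip]; first by rewrite take_drop drop_drop subnK // ltnW.
    have -> : i = p :> nat by lia.
    by rewrite subnn take0 !drop0.
  rewrite antisym_insert // cat_take_drop size_takel ?size_drop ?sl; last by lia.
  rewrite /contract /sbar sp odd_lift_perm addbF signr_addb signr_odd.
  have -> : (-1) ^+ i = (-1) ^+ (i - p) * (-1) ^+ p :> K by rewrite -exprD subnK.
  exact: sign_cancel2.
rewrite /wedge_sum sum_by_preimage.
pose c1 := ((p.-1)`! * q`!)%:R * (contract v0 a * b) (lst w).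
pose c2 := (p`! * (q.-1)`!)%:R * (sbar a * contract v0 b) (lst w).
rewrite (eq_bigr (fun i : 'I_n.+1 => if (i < p)%N then c1 else c2)); last first.
  by move=> i _; case: ltnP => ip; [exact: C1|exact: C2].
rewrite -(big_mkord xpredT (fun i => if (i < p)%N then c1 else c2)).
have pn : (p <= n.+1)%N by rewrite npq leq_addr.
rewrite (big_cat_nat _ pn) //=.
rewrite (eq_big_nat _ _ (F2 := fun=> c1)); last by move=> i /andP[_ ->].
rewrite [X in _ + X](eq_big_nat _ _ (F2 := fun=> c2)); last first.
  by move=> i /andP[pi _]; rewrite ltnNge pi.
have nq : (n.+1 - p = q)%N by lia.
rewrite !sumr_const_nat subn0 nq lstS -/v0 -/w shuffle_cons mulrDr.
congr (_ + _).
  rewrite /c1; case: (p) Ha => [|p'] Ha.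
    suff -> : contract v0 a = 0 by rewrite mul0r shuffleE !mulr0.
    by apply/shufP => s; exact: Ha.
  by rewrite -[LHS]mulr_natl mulrA -natrM mulnA factS.
rewrite /c2; case: (q) Hb => [|q'] Hb.
  suff -> : contract v0 b = 0 by rewrite mulr0 shuffleE !mulr0.
  by apply/shufP => s; exact: Hb.
by rewrite -[LHS]mulr_natl mulrA -natrM mulnCA factS.
Qed.
End WedgeSum.

Section Minors.
Variables (C : comNzRingType) (m : nat).

(** Polarised sum of principal minors: when all the N l are equal to N, it is s! times the
    coefficient of t^s in det(1 + t N). *)
Definition minors s (N : 'I_s -> 'M[C]_m) : C :=
  \sum_(I : {ffun 'I_s -> 'I_m}) \sum_(t : 'S_s) (-1) ^+ t *
    \prod_l N l (I l) (I (t l)).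

Lemma sum_ffunS s (F : {ffun 'I_s.+1 -> 'I_m} -> C) :
  \sum_I F I = \sum_(J : {ffun 'I_s -> 'I_m}) \sum_x
     F [ffun i => oapp J x (unlift ord0 i)].
Proof.
rewrite pair_big /=.
rewrite (reindex (fun p : {ffun 'I_s -> 'I_m} * 'I_m =>
   [ffun i : 'I_s.+1 => oapp p.1 p.2 (unlift ord0 i)])) //=.
exists (fun I => ([ffun i => I (lift ord0 i)], I ord0)) => [[J x] _|I _] /=.
  congr (_, _); last by rewrite ffunE unlift_none.
  by apply/ffunP => i; rewrite !ffunE liftK.
apply/ffunP => i; rewrite ffunE; case: unliftP => [j|] -> /=; rewrite ?ffunE //.
Qed.

(* Newton's identities in polarized form: they express the minors of N by traces
   of products of the N l. *)
Lemma minorsS s (N : 'I_s.+1 -> 'M[C]_m) :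
  minors N = \tr (N ord0) * minors (fun l => N (lift ord0 l)) -
    \sum_b minors (fun l => if l == b then N (lift ord0 b) *m N ord0
                            else N (lift ord0 l)).
Proof.
rewrite /minors sum_ffunS mulr_sumr [X in _ - X]exchange_big -sumrB /=.
apply: eq_bigr => J _.
under eq_bigr do rewrite sum_by_tperm big_ord_recl.
(* Permutations fixing [ord0]: the index attached to [ord0] runs freely over the diagonal of
   [N ord0], which gives the trace. *)
rewrite big_split /=; congr (_ + _).
  rewrite /mxtrace mulr_suml; apply: eq_bigr => x _; rewrite mulr_sumr.
  apply: eq_bigr => t _; rewrite tperm1 mulg1 odd_lift_perm addbb addFb.
  rewrite mulrCA big_ord_recl lift_perm_id !ffunE unlift_none /=.
  congr (_ * (_ * _)); apply: eq_bigr => k _.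
  by rewrite lift_perm_lift !ffunE !liftK.
(* In the other permutations [ord0] lies in a longer cycle. Summing over its index multiplies
   [N ord0] into the matrix that precedes it in the cycle, and the transposition gives the minus
   sign. *)
rewrite exchange_big /=; under eq_bigr do rewrite exchange_big.
rewrite exchange_big /= -sumrN; under [RHS]eq_bigr do rewrite -sumrN.
rewrite [RHS]exchange_big; apply: eq_bigr => t _ /=.
rewrite (reindex_inj (@perm_inj _ t)); apply: eq_bigr => b _.
rewrite odd_permM odd_lift_perm addbb addFb odd_tperm neq_lift addbT.
under eq_bigr do rewrite signrN.
rewrite -mulr_sumr mulNr; congr (- (_ * _)).
rewrite (bigD1 b) //= eqxx mxE mulr_suml; apply: eq_bigr => x _.
rewrite big_ord_recl permM lift_perm_id tpermL !ffunE unlift_none liftK /=.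
rewrite (bigD1 b) //= permM lift_perm_lift tpermR !ffunE liftK unlift_none /=.
rewrite mulrCA mulrA; congr (_ * _); apply: eq_bigr => k kb.
rewrite (negbTE kb) permM lift_perm_lift tpermD ?neq_lift //.
  by rewrite !ffunE !liftK.
by rewrite (inj_eq lift_inj) (inj_eq perm_inj) eq_sym.
Qed.
End Minors.

(** * Smooth calculus *)

Lemma open_near (T : topologicalType) (A : set T) u : open A -> A u -> \near u, A u.
Proof. by move=> oA Au; exact: open_nbhs_nbhs. Qed.

Section NearDifferentiable.
Context {R : realType} {V W : normedModType R}.

(** Locality of differentiability reduces to this case by writing g = f + (g - f). *)
Lemma differentiable_near0 (h : V -> W) x :
  (\near x, h x = 0) -> differentiable h x.
Proof.
move=> hx0; have h0 : h x = 0 := nbhs_singleton hx0.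
have o : h \o shift x = cst (h x) + (\0 : V -> W) +o_ (0 : V) id.
  apply/eqaddoP => e e0; near=> y; rewrite !fctE h0 addr0 subr0.
  have -> : h (y + x) = 0.
    near: y; have := hx0; rewrite (near_shift 0 x) /=.
    by apply: filterS => y; rewrite /= subr0.
  by rewrite normr0 mulr_ge0 // ltW.
have c0 : continuous (\0 : V -> W) by exact: cst_continuous.
by apply/diff_locallyP; rewrite (diff_unique c0 o).
Unshelve. all: by end_near. Qed.

Lemma near_eq_differentiable (f g : V -> W) x :
  (\near x, f x = g x) -> differentiable f x -> differentiable g x.
Proof.
move=> fg df; have -> : g = f + (g - f) by rewrite addrC subrK.
apply: differentiableD => //; apply: differentiable_near0.
by apply: filterS fg => y fgy; rewrite !fctE fgy subrr.
Qed.
End NearDifferentiable.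

Section Ck.
Context {R : realType} {V W : normedModType R}.
Implicit Types (A B : set V) (f g : V -> W).

(** Closure properties are proved by finite orders: the derivative of f g contains f and g
    undifferentiated, so the induction hypothesis must apply to functions and to their derivatives
    alike, which [ckW] allows. *)
Fixpoint ck n A f : Prop := (forall u, A u -> differentiable f u) /\
  (if n is n'.+1 then forall v, ck n' A (fun u => 'D_v f u) else True).

Lemma ck_diff n A f u : ck n A f -> A u -> differentiable f u.
Proof. by case: n => [|n] [+ _]; exact. Qed.

Lemma smooth_diff A f u : smooth_on A f -> A u -> differentiable f u.
Proof. by move=> /(_ [::]); exact. Qed.

Lemma smooth_derive A f v : smooth_on A f -> smooth_on A (fun u => 'D_v f u).
Proof. by move=> sf s u; exact: (sf (v :: s)). Qed.

Lemma smoothP A f : smooth_on A f <-> forall n, ck n A f.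
Proof.
split=> [sf n|cf s]; last first.
  elim: s f cf => [|v s IH] f cf u Au; first exact: (ck_diff (cf 0%N) Au).
  by apply: (IH (fun u => 'D_v f u)) => // n; have [_] := cf n.+1; exact.
elim: n f sf => [|n IH] f sf; split=> //.
- by move=> u Au; exact: smooth_diff sf Au.
- by move=> u Au; exact: smooth_diff sf Au.
- move=> v; by apply: IH; exact: smooth_derive.
Qed.

Lemma ckW n A f : ck n.+1 A f -> ck n A f.
Proof.
elim: n f => [|n IH] f [df Df]; split=> // v.
exact: IH.
Qed.

Lemma ck_eq n A f g : open A -> (forall u, A u -> f u = g u) ->
  ck n A f -> ck n A g.
Proof.
move=> oA; elim: n f g => [|n IH] f g fg [df Df]; split=> //.
- move=> u Au; apply: near_eq_differentiable (df u Au).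
  by near do apply: fg; exact: open_near.
- move=> u Au; apply: near_eq_differentiable (df u Au).
  by near do apply: fg; exact: open_near.
move=> v; apply: IH (Df v) => u Au; apply: near_eq_derive.
by near do apply: fg; exact: open_near.
Unshelve. all: by end_near. Qed.

Lemma smooth_eq A f g : open A -> (forall u, A u -> f u = g u) ->
  smooth_on A f -> smooth_on A g.
Proof.
by move=> oA fg /smoothP sf; apply/smoothP => n; exact: ck_eq (sf n).
Qed.

Lemma smooth_sub A B f : A `<=` B -> smooth_on B f -> smooth_on A f.
Proof. by move=> AB sf s u /AB; exact: sf. Qed.

Lemma smooth_local A f :
  (forall u, A u -> exists2 B, B u & smooth_on B f) -> smooth_on A f.
Proof. by move=> H s u Au; have [B Bu sB] := H u Au; exact: sB. Qed.

Lemma ckD n A f g : open A -> ck n A f -> ck n A g -> ck n A (fun u => f u + g u).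
Proof.
move=> oA; elim: n f g => [|n IH] f g [df Df] [dg Dg]; split=> //.
- by move=> u Au; apply: differentiableD; [exact: df|exact: dg].
- by move=> u Au; apply: differentiableD; [exact: df|exact: dg].
move=> v; apply: ck_eq (IH _ _ (Df v) (Dg v)) => // u Au.
by rewrite -deriveD //; apply: diff_derivable; [exact: df|exact: dg].
Qed.

Lemma ck_cst n A (w : W) : ck n A (fun=> w).
Proof.
elim: n w => [|n IH] w; split=> // v.
have -> : (fun u => 'D_v (fun=> w) u) = (fun=> 0 : W) => //.
by apply/funext => u; exact: derive_cst.
Qed.

Lemma ckZ n A f (c : R) : open A -> ck n A f -> ck n A (fun u => c *: f u).
Proof.
move=> oA; elim: n f => [|n IH] f [df Df]; split=> //.
- by move=> u Au; apply: differentiableZ; exact: df.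
- by move=> u Au; apply: differentiableZ; exact: df.
move=> v; apply: ck_eq (IH _ (Df v)) => // u Au.
by rewrite -deriveZ //; apply: diff_derivable; exact: df.
Qed.

Lemma smoothD A f g : open A -> smooth_on A f -> smooth_on A g ->
  smooth_on A (fun u => f u + g u).
Proof. by move=> oA /smoothP sf /smoothP sg; apply/smoothP => n; exact: ckD. Qed.

Lemma smooth_cst A (w : W) : smooth_on A (fun=> w).
Proof. by apply/smoothP => n; exact: ck_cst. Qed.

Lemma smoothZ A f (c : R) : open A -> smooth_on A f -> smooth_on A (fun u => c *: f u).
Proof. by move=> oA /smoothP sf; apply/smoothP => n; exact: ckZ. Qed.

Lemma smooth_sum A I (r : seq I) (F : I -> V -> W) : open A ->
  (forall i, smooth_on A (F i)) -> smooth_on A (fun u => \sum_(i <- r) F i u).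
Proof.
move=> oA sF; elim: r => [|i r IH].
  by under eq_fun do rewrite big_nil; exact: smooth_cst.
by under eq_fun do rewrite big_cons; exact: smoothD.
Qed.

Lemma ck_lin n A (l : V -> W) : (forall u, differentiable l u) ->
  (forall v u, 'D_v l u = l v) -> ck n A l.
Proof.
move=> dl Dl; case: n => [|n]; split=> // v.
by under eq_fun do rewrite Dl; exact: ck_cst.
Qed.
End Ck.

Section CkScalar.
Context {R : realType} {V : normedModType R}.
Implicit Types (A : set V) (f g : V -> R^o).

Lemma ckM n A f g : open A -> ck n A f -> ck n A g ->
  ck n A (fun u => f u * g u : R^o).
Proof.
move=> oA; elim: n f g => [|n IH] f g cf cg.
  have [df _] := cf; have [dg _] := cg.
  by split=> // u Au; apply: differentiableM; [exact: df|exact: dg].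
have [df Df] := cf; have [dg Dg] := cg.
split=> [u Au|v]; first by apply: differentiableM; [exact: df|exact: dg].
apply: (@ck_eq _ _ _ n A (fun u => f u * 'D_v g u + g u * 'D_v f u : R^o)) => //.
  move=> u Au; rewrite -[LHS]deriveM //; apply: diff_derivable; first exact: df.
  exact: dg.
apply: ckD => //; apply: IH; by [exact: ckW|exact: Df|exact: Dg].
Qed.

Lemma ckV n A f : open A -> (forall u, A u -> f u != 0) -> ck n A f ->
  ck n A (fun u => (f u)^-1 : R^o).
Proof.
move=> oA f0; elim: n f f0 => [|n IH] f f0 cf.
  have [df _] := cf.
  by split=> // u Au; apply: differentiableV; [exact: df|exact: f0].
have [df Df] := cf.
split=> [u Au|v]; first by apply: differentiableV; [exact: df|exact: f0].
apply: (@ck_eq _ _ _ n A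
   (fun u => (-1) *: ((f u)^-1 * (f u)^-1 * 'D_v f u) : R^o)) => //.
  move=> u Au; rewrite deriveV ?f0 //; last by apply: diff_derivable; exact: df.
  by rewrite scaleN1r scaleNr -exprVn expr2 /GRing.scale/=.
have ci := IH f f0 (ckW cf).
by apply: ckZ => //; apply: ckM; by [|exact: ckM|exact: Df].
Qed.

Lemma smoothM A f g : open A -> smooth_on A f -> smooth_on A g ->
  smooth_on A (fun u => f u * g u : R^o).
Proof. by move=> oA /smoothP sf /smoothP sg; apply/smoothP => n; exact: ckM. Qed.

Lemma smoothV A f : open A -> (forall u, A u -> f u != 0) -> smooth_on A f ->
  smooth_on A (fun u => (f u)^-1 : R^o).
Proof. by move=> oA f0 /smoothP sf; apply/smoothP => n; exact: ckV. Qed.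

Lemma smooth_prod A I (r : seq I) (F : I -> V -> R^o) : open A ->
  (forall i, smooth_on A (F i)) ->
  smooth_on A (fun u => \prod_(i <- r) F i u : R^o).
Proof.
move=> oA sF; elim: r => [|i r IH].
  by under eq_fun do rewrite big_nil; exact: smooth_cst.
by under eq_fun do rewrite big_cons; exact: smoothM.
Qed.
End CkScalar.

Section CkRow.
Context {R : realType} {V : normedModType R} {m : nat}.
Implicit Types (A : set V) (f : V -> 'rV[R]_m).

Lemma derive_coord f u v j : derivable f u v ->
  ('D_v f u) 0 j = 'D_v (fun u => f u 0 j : R^o) u.
Proof. by move=> df; rewrite derive_mx // mxE. Qed.

Lemma diff_coord f u j : differentiable f u ->
  differentiable (fun u => f u 0 j : R^o) u.
Proof.
move=> df; apply: (@differentiable_comp _ _ _ _ f (fun N : 'rV[R]_m => N 0 j)) => //.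
exact: differentiable_coord.
Qed.

Lemma diff_row f u : (forall j, differentiable (fun u => f u 0 j : R^o) u) ->
  differentiable f u.
Proof.
move=> df.
have -> : f = \sum_(j < m) (fun u => f u 0 j *: delta_mx 0 j).
  apply/funext => z; rewrite fct_sumE; apply/rowP => j.
  by rewrite {1}(row_sum_delta (f z)).
by apply: differentiable_sum => j; apply: differentiableZl; exact: df.
Qed.

Lemma ck_coord n A f j : open A -> ck n A f -> ck n A (fun u => f u 0 j : R^o).
Proof.
move=> oA; elim: n f => [|n IH] f [df Df]; split=> //.
- by move=> u Au; apply: diff_coord; exact: df.
- by move=> u Au; apply: diff_coord; exact: df.
move=> v; apply: ck_eq (IH _ (Df v)) => // u Au.
by rewrite derive_coord //; apply: diff_derivable; exact: df.
Qed.

Lemma ck_row n A f : open A -> (forall j, ck n A (fun u => f u 0 j : R^o)) ->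
  ck n A f.
Proof.
move=> oA; elim: n f => [|n IH] f cf.
  by split=> // u Au; apply: diff_row => j; have [+ _] := cf j; exact.
have df u : A u -> differentiable f u.
  by move=> Au; apply: diff_row => j; have [+ _] := cf j; exact.
split=> // v; apply: IH => j; have [_ /(_ v)] := cf j.
apply: ck_eq => // u Au; rewrite derive_coord //.
by apply: diff_derivable; exact: df.
Qed.

Lemma smooth_coord A f j : open A -> smooth_on A f ->
  smooth_on A (fun u => f u 0 j : R^o).
Proof. by move=> oA /smoothP sf; apply/smoothP => n; exact: ck_coord. Qed.

Lemma smooth_row A f : open A ->
  (forall j, smooth_on A (fun u => f u 0 j : R^o)) -> smooth_on A f.
Proof.
move=> oA sf; apply/smoothP => n; apply: ck_row => // j.
by move: n; apply/smoothP.
Qed.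
End CkRow.

Section Compose.
Context {R : realType} {V : normedModType R} {m : nat}.

Lemma derive_comp {W : normedModType R} (f : V -> 'rV[R]_m) (g : 'rV[R]_m -> W) u v :
  differentiable f u -> differentiable g (f u) ->
  'D_v (g \o f) u = 'D_('D_v f u) g (f u).
Proof.
move=> df dg.
have dgf : differentiable (g \o f) u by exact: differentiable_comp.
rewrite (deriveE v dgf) (deriveE v df) (deriveE _ dg).
by rewrite (diff_comp df dg).
Qed.

Lemma derive_sumE {W : normedModType R} (g : 'rV[R]_m -> W) u (w : 'rV[R]_m) :
  differentiable g u ->
  'D_w g u = \sum_j w 0 j *: 'D_(delta_mx 0 j) g u.
Proof.
move=> dg; rewrite (deriveE w dg) {1}(row_sum_delta w) linear_sum.
by apply: eq_bigr => j _; rewrite linearZ (deriveE _ dg).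
Qed.

(** The chain rule is expanded in coordinates, so that the derivative of the composite is a sum of
    products to which [ckM] and the induction hypothesis apply. *)
Lemma ck_comp n A B (f : V -> 'rV[R]_m) (g : 'rV[R]_m -> R^o) :
  open A -> (forall u, A u -> B (f u)) ->
  ck n A f -> ck n B g -> ck n A (g \o f).
Proof.
move=> oA AB; elim: n g => [|n IH] g cf cg.
  have [df _] := cf; have [dg _] := cg; split=> // u Au.
  by apply: differentiable_comp; [exact: df|apply: dg; exact: AB].
have [df Df] := cf; have [dg Dg] := cg; split=> [u Au|v].
  by apply: differentiable_comp; [exact: df|apply: dg; exact: AB].
apply: (@ck_eq _ _ _ n A (fun u => \sum_j (('D_v f u) 0 j : R^o) *
   ((fun y => 'D_(delta_mx 0 j) g y) \o f) u : R^o)) => //.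
  move=> u Au; rewrite derive_comp; [|exact: df|apply: dg; exact: AB].
  by rewrite [RHS]derive_sumE //; apply: dg; exact: AB.
have : forall r : seq 'I_m, ck n A (fun u => \sum_(j <- r) (('D_v f u) 0 j : R^o) *
   ((fun y => 'D_(delta_mx 0 j) g y) \o f) u : R^o).
  elim=> [|j r IHr]; first by under eq_fun do rewrite big_nil; exact: ck_cst.
  under eq_fun do rewrite big_cons; apply: ckD => //; apply: ckM => //.
    exact: ck_coord oA (Df v).
  by apply: IH; [exact: ckW|exact: Dg].
exact.
Qed.

Lemma smooth_comp A B (f : V -> 'rV[R]_m) (g : 'rV[R]_m -> R^o) :
  open A -> (forall u, A u -> B (f u)) ->
  smooth_on A f -> smooth_on B g -> smooth_on A (g \o f).
Proof.
move=> oA AB /smoothP sf /smoothP sg; apply/smoothP => n.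
exact: (ck_comp (B := B)).
Qed.
End Compose.

(** * Symmetry of second derivatives *)

Section Clairaut.
Context {R : realType} {V : normedModType R}.
Implicit Types (A : set V) (f : V -> R^o).

Lemma line_derivative f (u v : V) (t : R) : differentiable f (u + t *: v) ->
  is_derive t 1 (fun t : R => f (u + t *: v) : R) ('D_v f (u + t *: v)).
Proof.
move=> df; pose g (s : R) : V := u + s *: v.
have did : differentiable (id : R -> R) t by exact/derivable1_diffP/derivable_id.
have dl : differentiable (fun s : R => s *: v) t by exact: differentiableZl.
have dg : differentiable g t by apply: differentiableD.
have dfg : differentiable (f \o g) t by exact: differentiable_comp.
have Dg : 'D_1 g t = v.
  rewrite deriveD ?derive_cst ?add0r; last 2 first.
  - exact: derivable_cst.
  - exact: diff_derivable.
  by rewrite deriveE // diffZl // -(deriveE (1 : R^o) did) derive_id scale1r.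
have -> : 'D_v f (u + t *: v) = 'D_1 (f \o g) t.
  rewrite (deriveE (1 : R^o) dfg) (diff_comp dg df) /= -(deriveE (1 : R^o) dg) Dg.
  by rewrite -deriveE.
by apply: DeriveDef => //; exact: diff_derivable.
Qed.

Lemma mean_value f (u v : V) (h : R) : 0 < h ->
  (forall t, 0 <= t <= h -> differentiable f (u + t *: v)) ->
  exists2 t, 0 <= t <= h & f (u + h *: v) - f u = h * 'D_v f (u + t *: v).
Proof.
move=> h0 df; have dp t : 0 <= t <= h -> is_derive t 1
    (fun t : R => f (u + t *: v) : R) ('D_v f (u + t *: v)).
  by move=> th; apply: line_derivative; exact: df.
have [||c] := @MVT R (fun t => f (u + t *: v))
   (fun t => 'D_v f (u + t *: v)) 0 h h0.
- by move=> t; rewrite in_itv /= => /andP[t0 th]; apply: dp; rewrite !ltW.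
- apply: derivable_within_continuous => t; rewrite in_itv /= => th.
  by have [] := dp t th.
rewrite in_itv /= => /andP[c0 ch].
by rewrite scale0r addr0 subr0 mulrC => e; exists c => //; rewrite !ltW.
Qed.

Lemma derive_translate f (a v z : V) : 'D_v (fun z => f (z + a)) z = 'D_v f (z + a).
Proof. by rewrite /derive; under eq_fun do rewrite /= -addrA. Qed.

Lemma differentiable_translate f (a z : V) : differentiable f (z + a) ->
  differentiable (fun z => f (z + a)) z.
Proof.
by move=> df; apply: (@differentiable_comp _ _ _ _ (fun z => z + a) f).
Qed.

(** The mean value theorem is applied along v to the increment of f in the direction w, then along w
    to the derivative that appears. *)
Lemma second_difference f (u v w : V) (h : R) : 0 < h ->
  (forall s t, 0 <= s <= h -> 0 <= t <= h ->
     differentiable f (u + s *: v + t *: w) /\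
     differentiable (fun z => 'D_v f z) (u + s *: v + t *: w)) ->
  exists s t, [/\ 0 <= s <= h, 0 <= t <= h &
    f (u + h *: v + h *: w) - f (u + h *: v) - (f (u + h *: w) - f u) =
    h * (h * 'D_w (fun z => 'D_v f z) (u + s *: v + t *: w))].
Proof.
move=> h0 df; pose g z := f (z + h *: w) - f z : R^o.
have h00 : 0 <= (0 : R) <= h by rewrite lexx ltW.
have hhh : 0 <= h <= h by rewrite lexx ltW.
have d0 s : 0 <= s <= h -> differentiable f (u + s *: v).
  by move=> sh; have [] := df s 0 sh h00; rewrite scale0r addr0.
have d1 s : 0 <= s <= h -> differentiable (fun z => f (z + h *: w)) (u + s *: v).
  by move=> sh; apply: differentiable_translate; have [] := df s h sh hhh.
have [|s sh e] := @mean_value g u v h h0.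
  by move=> s sh; apply: differentiableB; [exact: d1|exact: d0].
have [|t th e2] := @mean_value (fun z => 'D_v f z) (u + s *: v) w h h0.
  by move=> t th; have [] := df s t sh th.
exists s, t; split=> //; rewrite -e2 -[LHS]/(g (u + h *: v) - g u) e.
congr (_ * _); rewrite deriveB ?derive_translate //; apply: diff_derivable.
  exact: d1.
exact: d0.
Qed.

Lemma not_close (x y z : R^o) :
  `|x - z| < `|x - y| / 2 -> `|y - z| < `|x - y| / 2 -> False.
Proof.
move=> l1 l2; have := ltrD l1 l2; rewrite -splitr ltNge => /negP; apply.
by rewrite [X in _ <= _ + X]distrC; apply: le_trans (ler_normD _ _); rewrite addrA subrK.
Qed.

(** The mixed second difference is symmetric in v and w, and it is h^2 times either mixed derivative
    at some point of a small parallelogram. If the two derivatives differed at u, continuity would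
    put them within half of their distance from a common value. *)
Lemma clairaut A f (u v w : V) : open A -> smooth_on A f -> A u ->
  'D_w (fun z => 'D_v f z) u = 'D_v (fun z => 'D_w f z) u.
Proof.
move=> oA sf Au; apply/eqP; rewrite -subr_eq0 -normr_eq0; apply/negP => /negP n0.
pose e : R := `|'D_w (fun z => 'D_v f z) u - 'D_v (fun z => 'D_w f z) u| / 2.
have e0 : 0 < e by rewrite divr_gt0 // lt_def n0 normr_ge0.
have cvw v1 w1 : \forall z \near u,
   `|'D_w1 (fun z => 'D_v1 f z) u - 'D_w1 (fun z => 'D_v1 f z) z| < e.
  have sD := smooth_derive w1 (smooth_derive v1 sf).
  have /cvgrPdist_lt := differentiable_continuous (smooth_diff sD Au).
  by apply.
have near3 := filterI (open_near oA Au) (filterI (cvw v w) (cvw w v)).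
have [r /= r0 Hr] := (nbhs_ballP _ _).1 (near3 _ _).
pose c := `|v| + `|w| + 1.
have c0 : 0 < c by have := normr_ge0 v; have := normr_ge0 w; rewrite /c; lra.
(* Since c exceeds |v| + |w| and h c < r, the parallelogram with sides h v and h w stays in the ball
   of radius r. *)
pose h := r / 2 / c.
have h0 : 0 < h by rewrite !divr_gt0.
have box s t : 0 <= s <= h -> 0 <= t <= h -> ball u r (u + s *: v + t *: w).
  move=> /andP[s0 sh] /andP[t0 th]; rewrite -ball_normE /= -addrA opprD addNKr.
  rewrite normrN (le_lt_trans (ler_normD _ _)) // !normrZ !ger0_norm //.
  have hc : h * c < r by rewrite /h mulfVK ?gt_eqF // ltr_pdivrMr // ltr_pMr // ltr1n.
  apply: le_lt_trans hc; rewrite /c !mulrDr mulr1 -[leLHS]addr0.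
  by rewrite lerD // ?(ltW h0) // lerD // ler_wpM2r.
have [|s [t [sh th E1]]] := @second_difference f u v w h h0.
  move=> s t sh th; have [Az _] := Hr _ (box s t sh th).
  split; first exact: smooth_diff sf Az.
  exact: smooth_diff (smooth_derive v sf) Az.
have [|s' [t' [sh' th' E2]]] := @second_difference f u w v h h0.
  move=> s' t' sh' th'; rewrite addrAC.
  have [Az _] := Hr _ (box t' s' th' sh').
  split; first exact: smooth_diff sf Az.
  exact: smooth_diff (smooth_derive w sf) Az.
have E : 'D_w (fun z => 'D_v f z) (u + s *: v + t *: w) =
    'D_v (fun z => 'D_w f z) (u + s' *: w + t' *: v).
  have hn0 : h != 0 by rewrite gt_eqF.
  move: E1 E2; move: ('D_w _ _) ('D_v _ _) => X Y; rewrite [u + h *: w + _]addrAC.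
  move: (f _) (f _) (f _) (f _) => a1 a2 a3 a4 E1 E2.
  have /(mulfI hn0)/(mulfI hn0)// : h * (h * X) = h * (h * Y).
  by rewrite -E1 -E2; ring.
have [_ [l1 _]] := Hr _ (box s t sh th).
have [_ [_ l2]] := Hr _ (box t' s' th' sh').
rewrite addrAC -E in l2; exact: (not_close l1 l2).
Qed.
End Clairaut.

Section SmoothMatrix.
Context {R : realType} {V : normedModType R}.
Implicit Types A : set V.

Definition msmooth A p q (B : V -> 'M[R]_(p, q)) :=
  forall i j, smooth_on A (fun u => B u i j : R^o).

Lemma msmooth_row A q (f : V -> 'rV[R]_q) : open A ->
  msmooth A f <-> smooth_on A f.
Proof.
move=> oA; split=> [sf|sf i j]; first by apply: smooth_row => // j; exact: sf.
by rewrite ord1; exact: smooth_coord.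
Qed.

Lemma msmooth_sub A A' p q (B : V -> 'M[R]_(p, q)) :
  A `<=` A' -> msmooth A' B -> msmooth A B.
Proof. by move=> AA sB i j; exact: smooth_sub AA (sB i j). Qed.

Lemma msmooth_eq A p q (B B' : V -> 'M[R]_(p, q)) : open A ->
  (forall u, A u -> B u = B' u) -> msmooth A B -> msmooth A B'.
Proof. by move=> oA BB sB i j; apply: smooth_eq (sB i j) => // u /BB ->. Qed.

Lemma msmooth_cst A p q (N : 'M[R]_(p, q)) : msmooth A (fun=> N).
Proof. by move=> i j; exact: smooth_cst. Qed.

Lemma msmoothM A p q r (B : V -> 'M[R]_(p, q)) (B' : V -> 'M[R]_(q, r)) :
  open A -> msmooth A B -> msmooth A B' -> msmooth A (fun u => B u *m B' u).
Proof.
move=> oA sB sB' i j; under eq_fun do rewrite mxE.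
by apply: smooth_sum => // k; exact: smoothM.
Qed.

Lemma smooth_det A p (B : V -> 'M[R]_p) : open A -> msmooth A B ->
  smooth_on A (fun u => \det (B u) : R^o).
Proof.
move=> oA sB; apply: smooth_sum => // s; apply: smoothM => //.
  exact: smooth_cst.
by apply: smooth_prod => // i; exact: sB.
Qed.

Lemma msmooth_inv A p (B : V -> 'M[R]_p) : open A ->
  (forall u, A u -> B u \in unitmx) -> msmooth A B ->
  msmooth A (fun u => invmx (B u)).
Proof.
move=> oA uB sB.
apply: (@msmooth_eq A _ _ (fun u => (\det (B u))^-1 *: \adj (B u))) => //.
  by move=> u Au; rewrite /invmx uB.
move=> i j; under eq_fun do rewrite !mxE.
apply: smoothM => //.
  apply: smoothV => //; last exact: smooth_det.
  by move=> u /uB; rewrite unitmxE unitfE.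
apply: smoothM => //; first exact: smooth_cst.
apply: smooth_det => // k l; under eq_fun do rewrite !mxE; exact: sB.
Qed.

Lemma smooth_compr {W : normedModType R} {m p} (A : set W) (B : set 'rV[R]_m)
    (f : W -> 'rV[R]_m) (g : 'rV[R]_m -> 'rV[R]_p) :
  open A -> open B -> (forall u, A u -> B (f u)) ->
  smooth_on A f -> smooth_on B g -> smooth_on A (g \o f).
Proof.
move=> oA oB AB sf sg; apply: smooth_row => // j.
apply: (smooth_comp (B := B) (g := fun y => g y 0 j : R^o)) => //.
exact: smooth_coord.
Qed.
End SmoothMatrix.

Section SmoothJacobian.
Context {R : realType} {p q : nat}.
Implicit Types (A : set 'rV[R]_p) (f : 'rV[R]_p -> 'rV[R]_q).

Lemma jacobianE f u i j : differentiable f u ->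
  'J f u i j = ('D_(delta_mx 0 i) f u) 0 j.
Proof. by move=> df; rewrite deriveEjacobian // -rowE [RHS]mxE. Qed.

Lemma msmooth_jacobian A f : open A -> smooth_on A f -> msmooth A (fun u => 'J f u).
Proof.
move=> oA sf i j.
apply: (@smooth_eq _ _ _ _ (fun u => ('D_(delta_mx 0 i) f u) 0 j : R^o)) => //.
  by move=> u Au; rewrite jacobianE //; exact: smooth_diff sf Au.
by apply: smooth_coord => //; exact: smooth_derive.
Qed.
End SmoothJacobian.

(** * Flat functions and bump functions *)

Section Flat.
Context {R : realType}.

(** The powers t^-n are included to make the family stable under differentiation: the derivative of
    [flat n] is a combination of [flat n.+1] and [flat n.+2]. *)
Definition flat (n : nat) (t : R) : R := if 0 < t then t ^- n * expR (- t^-1) else 0.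

Lemma flat_gt0 n t : 0 < t -> 0 < flat n t.
Proof. by move=> t0; rewrite /flat t0 mulr_gt0 ?expR_gt0 // invr_gt0 exprn_gt0. Qed.

Lemma flat_ge0 n t : 0 <= flat n t.
Proof. by rewrite /flat; case: ifP => // t0; rewrite mulr_ge0 ?expR_ge0 // invr_ge0 exprn_ge0 // ltW. Qed.

Lemma flat_le0 n t : t <= 0 -> flat n t = 0.
Proof. by rewrite /flat ltNge => ->. Qed.

Lemma flat_bound n : exists2 C, 0 <= C & forall t, `|flat n t| <= C * `|t| ^+ 2.
Proof.
(* exp(1/t) is the k-th power of exp(1/(t k)), which is at least 1/(t k); with k = n + 2 the
   quotient by t^n still leaves the factor t^2 that makes the derivative at 0 vanish. *)
pose k := n.+2; pose K : R := k%:R.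
have K0 : 0 < K by rewrite ltr0n.
exists (K ^+ k) => [|t]; first by rewrite exprn_ge0 // ltW.
rewrite ger0_norm ?flat_ge0 // /flat; case: ifP => [t0|_]; last first.
  by rewrite mulr_ge0 ?exprn_ge0 // ltW.
rewrite gtr0_norm //.
have e1 : (t * K)^-1 <= expR (t * K)^-1.
  by apply: le_trans (expR_ge1Dx _); rewrite lerDr.
have e2 : (t * K) ^- k <= expR t^-1.
  have -> : t^-1 = (t * K)^-1 * k%:R by rewrite invfM mulfVK // gt_eqF.
  rewrite -exprVn expRM_natr; apply: lerXn2r => //; rewrite nnegrE ?expR_ge0 //.
  by rewrite invr_ge0 mulr_ge0 // ltW.
rewrite expRN mulrC ler_pdivrMr ?exprn_gt0 //.
have -> : K ^+ k * t ^+ 2 * t ^+ n = (t * K) ^+ k.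
  by rewrite exprMn [RHS]mulrC -mulrA -exprD.
by rewrite -[leRHS]invrK lef_pV2 // posrE ?expR_gt0 // invr_gt0 exprn_gt0 // mulr_gt0.
Qed.

Lemma is_derive_flat n (t : R) :
  is_derive t (1 : R) (flat n) (- n%:R * flat n.+1 t + flat n.+2 t).
Proof.
have [t0|t0|->] := ltgtP t 0.
- have e : \near t, (cst 0 : R -> R) t = flat n t.
    by near=> s; rewrite flat_le0 // ltW //; near: s; exact: lt_nbhsl.
  rewrite !flat_le0 ?(ltW t0) // mulr0 addr0.
  exact: near_eq_is_derive e _.
- have e : \near t, (fun s => (s ^+ n)^-1 * expR (- s^-1)) t = flat n t.
    near=> s; rewrite /flat ifT //; near: s; exact: lt_nbhsr.
  apply: (near_eq_is_derive e).
  rewrite /flat t0.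
  have tn0 : t != 0 by rewrite gt_eqF.
  have tN0 : t ^+ n != 0 by rewrite expf_neq0.
  have h1 : is_derive t 1 (fun s : R => s ^+ n) (n%:R * t ^+ n.-1).
    apply: DeriveDef; first exact: exprn_derivable.
    by rewrite exp_derive /GRing.scale /= mulr1.
  have h2 : is_derive t 1 (fun s : R => (s ^+ n)^-1) (- (t ^+ n) ^- 2 *: (n%:R * t ^+ n.-1)).
    exact: (@is_deriveV R (fun s : R => s ^+ n)).
  have h3 : is_derive t 1 (fun s : R => - s^-1) (- (- t ^- 2 *: 1)).
    apply: is_deriveN; apply: (@is_deriveV R id) => //.
  have h4 := @is_derive1_comp R expR (fun s => - s^-1) t _ _ (is_derive_expR (- t^-1)) h3.
  have h5 := is_deriveM h2 h4.
  apply: is_derive_eq h5 _; rewrite /GRing.scale /= !mulr1 opprK.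
  case: (n) tN0 => [|k] tN0; rewrite ?expr0 ?invr1 ?mul0r ?mulr0 ?oppr0 ?mul0r ?addr0 ?add0r ?mul1r.
    by rewrite mulrC.
  rewrite /= !exprS; have tk0 : t ^+ k != 0 by rewrite expf_neq0.
  move: (expR _) (t ^+ k) tk0 => E T T0; field.
  by rewrite tn0 T0.
have [C C0 HC] := flat_bound n.
rewrite !flat_le0 // mulr0 addr0.
have cv : h^-1 *: (flat n (h *: 1 + 0) - flat n 0) @[h --> (0 : R)^'] --> (0 : R).
  apply/cvgr0Pnorm_lt => e e0; near=> h.
  rewrite addr0 [flat n 0]flat_le0 // subr0 [h *: 1]mulr1 normrM normfV.
  have h0 : 0 < `|h| by rewrite normr_gt0; near: h; exact: nbhs_dnbhs_neq.
  have hC : `|h| < e / (C + 1).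
    by near: h; apply: dnbhs0_lt; rewrite divr_gt0 // ltr_wpDl.
  rewrite mulrC ltr_pdivrMr //; apply: le_lt_trans (HC h) _.
  rewrite expr2 mulrA ltr_pM2r //.
  move: hC; rewrite ltr_pdivlMr ?ltr_wpDl //; apply: le_lt_trans.
  by rewrite mulrC ler_pM2l // lerDl.
apply: DeriveDef; first by apply/cvg_ex; exists 0.
exact/cvg_lim.
Unshelve. all: by end_near. Qed.

Lemma ck_flat {V : normedModType R} k n (A : set V) (p : V -> R^o) :
  open A -> smooth_on A p -> ck k A (fun u => flat n (p u) : R^o).
Proof.
move=> oA sp; have df j u : A u -> differentiable (fun u => flat j (p u) : R^o) u.
  move=> Au; apply: (@differentiable_comp _ _ _ _ p (flat j : R -> R^o)).
    exact: smooth_diff sp Au.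
  by apply/derivable1_diffP; have [] := is_derive_flat j (p u).
elim: k n => [|k IH] n; split=> //; [exact: df|exact: df|].
move=> v; apply: (@ck_eq _ _ _ k A (fun u => ((- n%:R) *: (flat n.+1 (p u) : R^o)
   + flat n.+2 (p u)) * 'D_v p u : R^o)) => //.
  move=> u Au; have dp := smooth_diff sp Au.
  have dfp : differentiable (flat n : R -> R^o) (p u).
    by apply/derivable1_diffP; have [] := is_derive_flat n (p u).
  rewrite [RHS](deriveE v (differentiable_comp dp dfp)) (diff_comp dp dfp) /=.
  have lin (w : R^o) : 'd (flat n : R -> R^o) (p u) w =
      w *: ('d (flat n : R -> R^o) (p u) (1 : R^o)).
    by rewrite -linearZ /= [w *: _]mulr1.
  rewrite -(deriveE v dp) lin -(deriveE (1 : R^o) dfp).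
  have [_ ->] := is_derive_flat n (p u).
  by rewrite mulrC.
apply: ckM => //; last by move/smoothP: (smooth_derive v sp).
by apply: ckD => //; apply: ckZ.
Qed.

Lemma smooth_flat {V : normedModType R} (A : set V) (p : V -> R^o) :
  open A -> smooth_on A p -> smooth_on A (fun u => flat 0 (p u) : R^o).
Proof. by move=> oA sp; apply/smoothP => k; exact: ck_flat. Qed.
End Flat.

Section Bump.
Context {R : realType} {m : nat}.
Implicit Types (a u : 'rV[R]_m) (r : R).

Lemma smooth_id (A : set 'rV[R]_m) : smooth_on A (id : 'rV[R]_m -> 'rV[R]_m).
Proof.
by apply/smoothP => n; apply: ck_lin => [u|v u]; last exact: derive_id.
Qed.

Lemma bump_exists a r : 0 < r -> exists b : 'rV[R]_m -> R^o,
  [/\ smooth_on setT b,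
      forall u, (forall i, `|u 0 i - a 0 i| <= r / 2) -> b u = 1 &
      forall u i, r <= `|u 0 i - a 0 i| -> b u = 0].
Proof.
move=> r0; pose t i u : R := ((u 0 i - a 0 i) / r) ^+ 2.
(* The profile is 1 for s <= 1/4 and 0 for s >= 1; as s is the square of a rescaled coordinate,
   these bounds mean distances r/2 and r. *)
pose psi (s : R) : R := flat 0 (1 - s) / (flat 0 (1 - s) + flat 0 (s - 4^-1)).
have den s : flat 0 (1 - s) + flat 0 (s - 4^-1) != 0.
  rewrite gt_eqF //; have [s1|s1] := ltP s 1.
    by rewrite ltr_pwDl ?flat_ge0 ?flat_gt0 ?subr_gt0.
  by rewrite ltr_wpDl ?flat_ge0 ?flat_gt0 // subr_gt0; lra.
have st i : smooth_on setT (t i : 'rV[R]_m -> R^o).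
  rewrite /t; under eq_fun do rewrite expr2.
  have sc : smooth_on setT (fun u : 'rV[R]_m => (u 0 i - a 0 i) / r : R^o).
    apply: smoothM; [exact: openT| |exact: smooth_cst].
    apply: smoothD; [exact: openT| |exact: smooth_cst].
    by apply: (smooth_coord i); [exact: openT|exact: smooth_id].
  by apply: smoothM => //; exact: openT.
have s1 i : smooth_on setT (fun u : 'rV[R]_m => flat 0 (1 - t i u) : R^o).
  apply: (smooth_flat (p := fun u => 1 - t i u)); first exact: openT.
  apply: smoothD; [exact: openT|exact: smooth_cst|].
  by under eq_fun do rewrite -scaleN1r; apply: smoothZ => //; exact: openT.
have s2 i : smooth_on setT (fun u : 'rV[R]_m => flat 0 (t i u - 4^-1) : R^o).
  apply: (smooth_flat (p := fun u => t i u - 4^-1)); first exact: openT.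
  by apply: smoothD; [exact: openT|exact: st|exact: smooth_cst].
exists (fun u => \prod_i psi (t i u)); split.
- apply: smooth_prod; first exact: openT.
  move=> i; apply: smoothM; [exact: openT|exact: s1|].
  apply: smoothV; [exact: openT|by move=> u _; exact: den|].
  by apply: smoothD; [exact: openT| |].
- move=> u Hu; apply: big1 => i _.
  have t4 : t i u - 4^-1 <= 0.
    have h2 : `|(u 0 i - a 0 i) / r| <= 2^-1.
      by rewrite normrM normfV (gtr0_norm r0) ler_pdivrMr // mulrC.
    rewrite subr_le0 /t -real_normK ?num_real //.
    have := normr_ge0 ((u 0 i - a 0 i) / r); move: (`|_|) h2 => y; nra.
  have := den R (t i u); rewrite /psi (flat_le0 _ t4) addr0 => d0.
  exact: divff.
move=> u i Hu; rewrite (bigD1 i) //= /psi [flat 0 (1 - _)]flat_le0 ?mul0r //.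
have h2 : 1 <= `|(u 0 i - a 0 i) / r|.
  by rewrite normrM normfV (gtr0_norm r0) ler_pdivlMr // mul1r.
rewrite subr_le0 /t -real_normK ?num_real //.
by move: (`|_|) h2 => y; nra.
Qed.
End Bump.

(** * Charts and vector fields *)

Lemma mulmx_ext (R : nzRingType) p q (A B : 'M[R]_(p, q)) :
  (forall v : 'rV_p, v *m A = v *m B) -> A = B.
Proof. by move=> AB; apply/row_matrixP => i; rewrite !rowE. Qed.

Lemma open_from_near (T : topologicalType) (A : set T) :
  (forall u, A u -> \near u, A u) -> open A.
Proof. by move=> H; rewrite openE => u /H. Qed.

Section DirectionalDerivative.
Context {R : realType} {m : nat}.
Implicit Types (A : set 'rV[R]_m) (g : 'rV[R]_m -> R^o) (X : 'rV[R]_m -> 'rV[R]_m).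

Lemma smooth_dir A X g : open A -> smooth_on A X -> smooth_on A g ->
  smooth_on A (fun u => 'D_(X u) g u).
Proof.
move=> oA sX sg.
apply: (@smooth_eq _ _ _ _ (fun u => \sum_j X u 0 j * 'D_(delta_mx 0 j) g u : R^o)) => //.
  by move=> u Au; rewrite [RHS]derive_sumE //; exact: smooth_diff sg Au.
apply: smooth_sum => // j; apply: smoothM => //; first exact: smooth_coord.
exact: smooth_derive.
Qed.

Lemma smooth_dir_row A p X (g : 'rV[R]_m -> 'rV[R]_p) : open A ->
  smooth_on A X -> smooth_on A g -> smooth_on A (fun u => 'D_(X u) g u).
Proof.
move=> oA sX sg; apply: smooth_row => // j.
apply: (@smooth_eq _ _ _ _ (fun u => 'D_(X u) (fun u => g u 0 j : R^o) u)) => //.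
  move=> u Au; rewrite derive_coord //.
  by apply: diff_derivable; exact: smooth_diff sg Au.
by apply: smooth_dir => //; exact: smooth_coord.
Qed.

Lemma derive_sum_fun (V : normedModType R) I (r : seq I) (F : I -> V -> R^o) (u v : V) :
  (forall i, differentiable (F i) u) ->
  'D_v (fun u => \sum_(i <- r) F i u : R^o) u = \sum_(i <- r) 'D_v (F i) u /\
  differentiable (fun u => \sum_(i <- r) F i u : R^o) u.
Proof.
move=> dF; elim: r => [|i r [IH IHd]].
  under eq_fun do rewrite big_nil.
  by rewrite big_nil derive_cst.
under eq_fun do rewrite big_cons.
rewrite big_cons; split; last exact: differentiableD.
by rewrite -IH -deriveD //; exact: diff_derivable.
Qed.

Lemma derive_mul (V : normedModType R) (f g : V -> R^o) (u v : V) :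
  differentiable f u -> differentiable g u ->
  'D_v (fun u => f u * g u : R^o) u = 'D_v f u * g u + f u * 'D_v g u.
Proof.
move=> df dg; rewrite [LHS]deriveM; try exact: diff_derivable.
by rewrite addrC /GRing.scale /= [g u * _]mulrC.
Qed.

(** Product rule for a derivative along a variable field; its second-order term is the one that
    [clairaut] makes symmetric in brackets and curvatures. *)
Lemma derive_dir A X g u v : open A -> smooth_on A X -> smooth_on A g -> A u ->
  'D_v (fun u => 'D_(X u) g u) u =
  'D_('D_v X u) g u + 'D_v (fun z => 'D_(X u) g z) u.
Proof.
move=> oA sX sg Au.
have dg := smooth_diff sg Au.
have dD j : differentiable (fun z => 'D_(delta_mx 0 j) g z) u.
  exact: smooth_diff (smooth_derive _ sg) Au.
have dX := smooth_diff sX Au.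
have e1 : \near u, \sum_j X u 0 j * 'D_(delta_mx 0 j) g u = 'D_(X u) g u :> R^o.
  apply: filterS (open_near oA Au) => z Az.
  by rewrite [RHS]derive_sumE //; exact: smooth_diff sg Az.
have e2 : \near u, \sum_j (X u) 0 j * 'D_(delta_mx 0 j) g u = 'D_(X u) g u :> R^o.
  exact: e1.
have e3 : \forall z \near u, \sum_j (X u) 0 j * 'D_(delta_mx 0 j) g z = 'D_(X u) g z :> R^o.
  apply: filterS (open_near oA Au) => z Az.
  by rewrite [RHS]derive_sumE //; exact: smooth_diff sg Az.
rewrite -(near_eq_derive _ e1) -(near_eq_derive _ e3).
rewrite (derive_sum_fun (index_enum _) (F := fun j z => X z 0 j * 'D_(delta_mx 0 j) g z) v _).1; last first.
  by move=> j; apply: differentiableM => //; exact: diff_coord.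
rewrite (derive_sum_fun (index_enum _) (F := fun j z => X u 0 j * 'D_(delta_mx 0 j) g z) v _).1; last first.
  by move=> j; apply: differentiableM.
rewrite [X in _ = X + _]derive_sumE // -big_split; apply: eq_bigr => j _ /=.
rewrite derive_mul //; last exact: diff_coord.
rewrite derive_mul // derive_cst mul0r add0r derive_coord //.
exact: diff_derivable.
Qed.
End DirectionalDerivative.

HB.lock Definition transition_jacobian (R : realType) (m : nat) (M : manifold R m)
  (c c' : @chart R m M) (y : M) : 'M[R]_m := 'J (c' \o cinv c) (c y).

HB.lock Definition frep (R : realType) (m : nat) (M : manifold R m)
    (c : @chart R m M) (X : vfield M) (u : 'rV[R]_m) : 'rV[R]_m :=
  X (cinv c u) *m dchart c (cinv c u).

Section ManifoldCalculus.
Context {R : realType} {m : nat} {M : manifold R m}.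
Implicit Types (c : @chart R m M) (x y z : M) (u v w : 'rV[R]_m) (X Y : vfield M).

Lemma smooth_chart_at x : smooth_chart (chart_at x).
Proof. by split=> [|y]; [exact: chart_atP|exact: chart_at_compatible]. Qed.

Section OneChart.
Variable (c : @chart R m M).
Hypothesis ic : is_chart c.

Lemma chartK y : cdom c y -> cinv c (c y) = y.
Proof. by case: ic => _ _ + _ _; exact. Qed.
Lemma cimg_chart y : cdom c y -> cimg c (c y).
Proof. by move=> cy; exists y. Qed.
Lemma cinv_dom u : cimg c u -> cdom c (cinv c u).
Proof. by case=> y cy <-; rewrite chartK. Qed.
Lemma cinvK u : cimg c u -> c (cinv c u) = u.
Proof. by case=> y cy <-; rewrite chartK. Qed.
Lemma cimg_open : open (cimg c). Proof. by case: ic. Qed.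
Lemma cdom_open : open (cdom c). Proof. by case: ic. Qed.
Lemma near_cinv u (P : set M) : cimg c u -> nbhs (cinv c u) P -> \near u, P (cinv c u).
Proof. by case: ic => _ _ _ _ cc cu; exact: cc. Qed.
Lemma near_chart y (P : set 'rV[R]_m) : cdom c y -> nbhs (c y) P -> \near y, P (c y).
Proof. by case: ic => _ _ _ cc _ cy; exact: cc. Qed.
End OneChart.

Definition tr c c' := c' \o cinv c.
Definition overlap c c' : set 'rV[R]_m := [set u | cimg c u /\ cdom c' (cinv c u)].
Notation Jt := (@transition_jacobian R m M).

Lemma JtE c c' y : Jt c c' y = 'J (tr c c') (c y). Proof. by rewrite unlock. Qed.
Lemma frepE c X u : frep c X u = X (cinv c u) *m dchart c (cinv c u).
Proof. by rewrite unlock. Qed.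

Lemma field_repE x X : field_rep x X = frep (chart_at x) X.
Proof. by apply/funext => u; rewrite frepE. Qed.

Lemma overlap_open c c' : is_chart c -> is_chart c' -> open (overlap c c').
Proof.
move=> ic ic'; apply: open_from_near => u [cu c'u]; apply: filterI.
  exact: (open_near (cimg_open ic) cu).
by apply: near_cinv => //; exact: (open_near (cdom_open ic') c'u).
Qed.

Lemma overlapE c c' : is_chart c -> c @` (cdom c `&` cdom c') = overlap c c'.
Proof.
move=> ic; apply/seteqP; split=> [_ [y [cy c'y] <-]|u [cu c'u]].
  by split; [exists y|rewrite chartK].
by exists (cinv c u); [split=> //; exact: cinv_dom|exact: cinvK].
Qed.

Lemma overlap_chart c c' y : is_chart c -> cdom c y -> cdom c' y -> overlap c c' (c y).
Proof. by move=> ic cy c'y; split; [exact: cimg_chart|rewrite chartK]. Qed.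

Lemma overlap_tr c c' u : is_chart c -> is_chart c' -> overlap c c' u ->
  [/\ overlap c' c (tr c c' u) & cinv c' (tr c c' u) = cinv c u].
Proof.
move=> ic ic' [cu c'u]; rewrite /tr /= chartK //; split=> //.
by apply: overlap_chart => //; exact: cinv_dom.
Qed.

(** Each chart is known to be compatible with the atlas only, so near a point the transition is
    factored through the atlas chart attached to that point. *)
Lemma smooth_tr c c' : smooth_chart c -> smooth_chart c' ->
  smooth_on (overlap c c') (tr c c').
Proof.
move=> [ic sc] [ic' sc']; apply: smooth_local => u [cu c'u].
pose z := chart_at (cinv c u); have iz : is_chart z by exact: chart_atP.
have zu : cdom z (cinv c u) by exact: mem_chart_at.
have oB : open (overlap c c' `&` overlap c z).
  by apply: openI; apply: overlap_open.
exists (overlap c c' `&` overlap c z) => //.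
apply: (@smooth_eq _ _ _ _ (tr z c' \o tr c z)) => //.
  by move=> w [_ [cw zw]]; rewrite /tr /= chartK.
apply: (smooth_compr (B := overlap z c')) => //; first exact: overlap_open.
- by move=> w [[cw c'w] [_ zw]]; split; rewrite /tr /=; [exact: cimg_chart|rewrite chartK].
- apply: (@smooth_sub _ _ _ _ (overlap c z)) => //.
  by have [_] := sc (cinv c u); rewrite setIC overlapE.
by have [+ _] := sc' (cinv c u); rewrite overlapE.
Qed.

Lemma diff_tr c c' y : smooth_chart c -> smooth_chart c' -> cdom c y -> cdom c' y ->
  differentiable (tr c c') (c y).
Proof.
move=> sc sc' cy c'y; apply: (smooth_diff (smooth_tr sc sc')).
by apply: overlap_chart => //; case: sc.
Qed.

Lemma mul_Jt c c' y v : smooth_chart c -> smooth_chart c' -> cdom c y -> cdom c' y ->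
  v *m Jt c c' y = 'D_v (tr c c') (c y).
Proof.
by move=> sc sc' cy c'y; rewrite JtE (deriveEjacobian v (diff_tr sc sc' cy c'y)).
Qed.

(** The cocycle rule. As [dchart c y] and [dchart_inv c y] are Jacobians from and to the chart
    attached to y, every change of frame reduces to it. *)
Lemma Jt_mul c c' c'' y : smooth_chart c -> smooth_chart c' -> smooth_chart c'' ->
  cdom c y -> cdom c' y -> cdom c'' y ->
  Jt c c' y *m Jt c' c'' y = Jt c c'' y.
Proof.
move=> sc sc' sc'' cy c'y c''y.
have [ic _] := sc; have [ic' _] := sc'; have [ic'' _] := sc''.
have tcy : tr c c' (c y) = c' y by rewrite /tr /= chartK.
apply: mulmx_ext => v; rewrite mulmxA.
rewrite (mul_Jt _ sc sc'' cy c''y) (mul_Jt _ sc sc' cy c'y).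
rewrite (mul_Jt _ sc' sc'' c'y c''y) -tcy.
rewrite -(derive_comp v (diff_tr sc sc' cy c'y)); last by rewrite tcy; exact: diff_tr.
apply: near_eq_derive.
have := open_near (overlap_open ic ic') (overlap_chart ic cy c'y).
by apply: filterS => u [cu c'u]; rewrite /tr /= chartK.
Qed.

Lemma Jt_id c y : is_chart c -> cdom c y -> Jt c c y = 1%:M.
Proof.
move=> ic cy; apply: mulmx_ext => v; rewrite mulmx1 JtE.
have e : \forall u \near c y, id u = tr c c u.
  apply: filterS (open_near (cimg_open ic) (cimg_chart cy)) => u cu.
  by rewrite /tr /= cinvK.
have de : differentiable (tr c c) (c y) by apply: near_eq_differentiable e _.
by rewrite -(deriveEjacobian v de) -(near_eq_derive _ e) derive_id.
Qed.

Lemma dchartE c y : dchart c y = Jt (chart_at y) c y. Proof. by rewrite JtE. Qed.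
Lemma dchart_invE c y : dchart_inv c y = Jt c (chart_at y) y. Proof. by rewrite JtE. Qed.

Lemma dchartK c y : smooth_chart c -> cdom c y -> dchart c y *m dchart_inv c y = 1%:M.
Proof.
move=> sc cy; rewrite dchartE dchart_invE Jt_mul ?Jt_id //;
  by [exact: mem_chart_at|exact: smooth_chart_at|exact: chart_atP].
Qed.

Lemma dchart_invK c y : smooth_chart c -> cdom c y -> dchart_inv c y *m dchart c y = 1%:M.
Proof.
move=> sc cy; rewrite dchartE dchart_invE Jt_mul ?Jt_id //;
  by [exact: mem_chart_at|exact: smooth_chart_at|case: sc].
Qed.

Lemma dchart_tr c c' y : smooth_chart c -> smooth_chart c' -> cdom c y -> cdom c' y ->
  dchart c y *m Jt c c' y = dchart c' y.
Proof.
move=> sc sc' cy c'y; rewrite !dchartE Jt_mul //;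
  by [exact: mem_chart_at|exact: smooth_chart_at].
Qed.

Lemma dchart_at x : dchart (chart_at x) x = 1%:M.
Proof. by rewrite dchartE Jt_id //; [exact: chart_atP|exact: mem_chart_at]. Qed.

Lemma dchart_inv_at x : dchart_inv (chart_at x) x = 1%:M.
Proof. by rewrite dchart_invE Jt_id //; [exact: chart_atP|exact: mem_chart_at]. Qed.

Lemma frep_tr c c' X u : smooth_chart c -> smooth_chart c' -> overlap c c' u ->
  frep c' X (tr c c' u) = frep c X u *m Jt c c' (cinv c u).
Proof.
move=> sc sc' ou; have [ic _] := sc; have [ic' _] := sc'.
have [_ e] := overlap_tr ic ic' ou; rewrite !frepE e -mulmxA dchart_tr //.
  by apply: cinv_dom => //; case: ou.
by case: ou.
Qed.

Lemma msmooth_Jt c c' : smooth_chart c -> smooth_chart c' ->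
  msmooth (overlap c c') (fun u => Jt c c' (cinv c u)).
Proof.
move=> sc sc'; have [ic _] := sc; have [ic' _] := sc'.
have oo := overlap_open ic ic'.
apply: msmooth_eq (msmooth_jacobian oo (smooth_tr sc sc')) => // u [cu _].
by rewrite JtE cinvK.
Qed.

Lemma smooth_frep_local c X : smooth_chart c ->
  (forall y, cdom c y -> exists c' A, [/\ smooth_chart c', cdom c' y, open A, A (c' y) &
    smooth_on A (frep c' X)]) -> smooth_on (cimg c) (frep c X).
Proof.
move=> sc H; have [ic _] := sc; apply: smooth_local => u cu.
have [c' [A [sc' c'y oA Ay sA]]] := H _ (cinv_dom ic cu).
have [ic' _] := sc'.
pose B := [set u | overlap c c' u /\ A (tr c c' u)].
have oB : open B.
  apply: open_from_near => w [ow Aw]; apply: filterI.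
    exact: (open_near (overlap_open ic ic') ow).
  apply: (differentiable_continuous (smooth_diff (smooth_tr sc sc') ow)).
  exact: (open_near oA Aw).
have BA : B `<=` overlap c c' by move=> w [].
have trB w : B w -> A (tr c c' w) by case.
have s1 : smooth_on B (frep c' X \o tr c c').
  by apply: (smooth_compr oB oA trB) => //; apply: smooth_sub BA (smooth_tr sc sc').
have s2 : msmooth B (fun u => Jt c' c (cinv c' (tr c c' u))).
  move=> i j.
  apply: (smooth_comp (B := overlap c' c) (g := fun w => Jt c' c (cinv c' w) i j : R^o)) => //.
  - by move=> w [ow _]; have [] := overlap_tr ic ic' ow.
  - exact: smooth_sub BA (smooth_tr sc sc').
  - exact: msmooth_Jt.
exists B; first by split.
apply/msmooth_row => //.
apply: msmooth_eq (msmoothM oB ((msmooth_row _ oB).2 s1) s2) => // w [ow _] /=.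
have [ow' e] := overlap_tr ic ic' ow.
rewrite -(frep_tr X sc' sc ow'); congr (frep c X _).
by rewrite {1}/tr /= e cinvK //; case: ow.
Qed.

Lemma smooth_frep c X : smooth_chart c -> smooth_field X -> smooth_on (cimg c) (frep c X).
Proof.
move=> sc sX; apply: smooth_frep_local => // y cy.
exists (chart_at y), (cimg (chart_at y)); split.
- exact: smooth_chart_at.
- exact: mem_chart_at.
- by apply: cimg_open; exact: chart_atP.
- by apply: cimg_chart; exact: mem_chart_at.
- by rewrite -field_repE; exact: sX.
Qed.

Lemma smooth_field_local X :
  (forall y, exists c A, [/\ smooth_chart c, cdom c y, open A, A (c y) &
    smooth_on A (frep c X)]) -> smooth_field X.
Proof.
by move=> H x; rewrite field_repE; apply: (@smooth_frep_local (chart_at x)) => //; exact: smooth_chart_at.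
Qed.

Lemma vactE c X (f : M -> R) y : smooth_chart c -> cdom c y ->
  differentiable (f \o cinv c : 'rV[R]_m -> R^o) (c y) ->
  vact X f y = 'D_(frep c X (c y)) (f \o cinv c : 'rV[R]_m -> R^o) (c y).
Proof.
move=> sc cy df; have [ic _] := sc.
have sz := smooth_chart_at y; have zy : cdom (chart_at y) y by exact: mem_chart_at.
have [iz _] := sz; pose z := chart_at y.
rewrite frepE chartK // dchartE mul_Jt //.
have tzy : tr z c (z y) = c y by rewrite /tr /= chartK.
rewrite -tzy -derive_comp; [|exact: diff_tr|by rewrite tzy].
apply: near_eq_derive.
have := open_near (overlap_open iz ic) (overlap_chart iz zy cy).
by apply: filterS => u [zu cu]; rewrite /tr /fun_rep /= chartK.
Qed.

(** The bracket is defined at each point in the attached chart. Transporting both halves to c adds a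
    second-order term in the transition map, [T X Y] or [T Y X]; these agree by Clairaut and
    cancel. *)
Lemma bracketE c X Y u : smooth_chart c -> smooth_field X -> smooth_field Y ->
  cimg c u -> frep c (bracket X Y) u =
  'D_(frep c X u) (frep c Y) u - 'D_(frep c Y u) (frep c X) u.
Proof.
move=> sc sX sY cu; have [ic _] := sc; pose y := cinv c u.
have cy : cdom c y by exact: cinv_dom.
have zy : cdom (chart_at y) y by exact: mem_chart_at.
have sz : smooth_chart (chart_at y) by exact: smooth_chart_at.
have [iz _] := sz; set z := chart_at y in zy sz iz.
have oo := overlap_open iz ic; have oy : overlap z c (z y) by exact: overlap_chart.
have tzy : tr z c (z y) = u by rewrite /tr /= chartK // cinvK.
have dtr := diff_tr sz sc zy cy.
pose T (A B : vfield M) : 'rV[R]_m :=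
    \row_j 'D_(A y) (fun w => 'D_(B y) (fun w => tr z c w 0 j : R^o) w) (z y).
have key A B : smooth_field A -> smooth_field B ->
    'D_(frep c A u) (frep c B) u =
    'D_('D_(A y) (frep z B) (z y)) (tr z c) (z y) + T A B.
  move=> sA sB.
  have -> : frep c A u = 'D_(A y) (tr z c) (z y).
    by rewrite -mul_Jt // frepE -/y dchartE.
  have dB : differentiable (frep c B) u by exact: smooth_diff (smooth_frep sc sB) cu.
  have dBz := smooth_diff (smooth_frep sz sB) (cimg_chart zy).
  have dB' : differentiable (frep c B) (tr z c (z y)) by rewrite tzy.
  have := derive_comp (A y) dtr dB'; rewrite tzy => <-.
  have e : \forall w \near z y, 'D_(frep z B w) (tr z c) w = (frep c B \o tr z c) w.
    apply: filterS (open_near oo oy) => w ow.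
    rewrite /= frep_tr // JtE cinvK //; last by case: ow.
    by rewrite (deriveEjacobian _ (smooth_diff (smooth_tr sz sc) ow)).
  rewrite -(near_eq_derive _ e); apply/rowP => j.
  have oBz : overlap z c `<=` cimg z by move=> w [].
  rewrite derive_coord; last first.
    apply: diff_derivable; apply: near_eq_differentiable.
      by apply: filterS e => w ->.
    by apply: differentiable_comp => //; rewrite tzy.
  have e2 : \forall w \near z y, 'D_(frep z B w) (fun w => tr z c w 0 j : R^o) w =
      ('D_(frep z B w) (tr z c) w) 0 j.
    apply: filterS (open_near oo oy) => w ow; rewrite derive_coord //.
    by apply: diff_derivable; exact: (smooth_diff (smooth_tr sz sc) ow).
  rewrite -(near_eq_derive _ e2).
  rewrite (@derive_dir _ _ (overlap z c)) //; last first.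
  - by apply: smooth_coord => //; exact: smooth_tr.
  - exact: smooth_sub oBz (smooth_frep sz sB).
  have fBy : frep z B (z y) = B y by rewrite frepE chartK // /z dchart_at mulmx1.
  rewrite mxE [in RHS]mxE fBy; congr (_ + _).
  by rewrite derive_coord //; exact: diff_derivable.
have TT : T X Y = T Y X.
  apply/rowP => j; rewrite [LHS]mxE [RHS]mxE.
  have sj := smooth_coord j oo (smooth_tr sz sc).
  exact: (clairaut (Y y) (X y) oo sj oy).
have e : frep c (bracket X Y) u =
    'D_('D_(X y) (frep z Y) (z y)) (tr z c) (z y) -
    'D_('D_(Y y) (frep z X) (z y)) (tr z c) (z y).
  rewrite frepE -/y dchartE -(mul_Jt _ sz sc zy cy) -(mul_Jt _ sz sc zy cy) -mulmxBl.
  by rewrite /bracket !field_repE.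
rewrite e (key X Y sX sY) (key Y X sY sX) TT.
have addKK (a b t : 'rV[R]_m) : a - b = (a + t) - (b + t).
  by rewrite opprD addrACA subrr addr0.
exact: addKK.
Qed.

Lemma smooth_bracket X Y : smooth_field X -> smooth_field Y -> smooth_field (bracket X Y).
Proof.
move=> sX sY x; have sz := smooth_chart_at x; have [iz _] := sz.
have oz := cimg_open iz.
apply: (@smooth_eq _ _ _ _ (fun u =>
  'D_(frep (chart_at x) X u) (frep (chart_at x) Y) u +
  (-1) *: 'D_(frep (chart_at x) Y u) (frep (chart_at x) X) u)) => //.
  by move=> u zu; rewrite scaleN1r -bracketE // field_repE.
apply: smoothD => //; last apply: smoothZ => //;
  by apply: smooth_dir_row => //; exact: smooth_frep.
Qed.
End ManifoldCalculus.

Notation Jt := (@transition_jacobian _ _ _).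

(** * Cutoff functions and global extension of local fields *)

Section Cutoff.
Context {R : realType} {m : nat}.
Implicit Types (a u : 'rV[R]_m) (r : R) (A K : set 'rV[R]_m).

Definition box a r : set 'rV[R]_m := [set u | forall i, `|u 0 i - a 0 i| < r].
Definition cbox a r : set 'rV[R]_m := [set u | forall i, `|u 0 i - a 0 i| <= r].

Lemma boxE a r : 0 < r -> box a r = ball a r.
Proof.
move=> r0; apply/seteqP; split=> u /=.
  by move=> H; split=> // i j; rewrite ord1 /ball /= distrC; exact: H.
by move=> [_ H] i; have := H 0 i; rewrite /ball /= distrC.
Qed.

Lemma box_open a r : 0 < r -> open (box a r).
Proof. by move=> r0; rewrite boxE //; exact: ball_open. Qed.

Lemma nbhs_box a A : nbhs a A -> exists2 r, 0 < r & box a r `<=` A.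
Proof.
move=> /nbhs_ballP[r /= r0 H]; exists r => //; rewrite boxE //.
Qed.

Lemma cbox_compact a r : compact (cbox a r).
Proof.
have -> : cbox a r = [set v : 'rV[R]_m | forall i, `[a 0 i - r, a 0 i + r]%classic (v 0 i)].
  apply/seteqP; split=> u /= H i; have := H i; rewrite /= in_itv /= ler_distl; lra.
apply: (@rV_compact _ _ (fun i => `[a 0 i - r, a 0 i + r]%classic)) => i.
exact: segment_compact.
Qed.

Lemma cutoff_exists A a : open A -> A a -> exists b : 'rV[R]_m -> R^o, exists U K,
  [/\ open U /\ U a, U `<=` A, smooth_on setT b /\ (forall u, U u -> b u = 1),
      compact K /\ K `<=` A & forall u, ~ K u -> b u = 0].
Proof.
move=> oA Aa; have [r r0 Hr] := nbhs_box (open_near oA Aa).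
have r2 : 0 < r / 2 by rewrite divr_gt0.
have [b [sb b1 b0]] := bump_exists a r2.
exists b, (box a (r / 2 / 2)), (cbox a (r / 2)); split.
- split; first by apply: box_open; rewrite divr_gt0.
  by move=> i; rewrite subrr normr0 !divr_gt0.
- by move=> u Hu; apply: Hr => i; have := Hu i; rewrite /=; lra.
- by split=> // u Hu; apply: b1 => i; apply: ltW; exact: Hu.
- split; first exact: cbox_compact.
  by move=> u Hu; apply: Hr => i; have := Hu i; rewrite /=; lra.
move=> u /existsNP[i /negP]; rewrite -ltNge => Hu; apply: (b0 u i); exact: ltW.
Qed.

Lemma smooth_cutoff {W : normedModType R} A K (b : 'rV[R]_m -> R^o)
    (g h : 'rV[R]_m -> W) :
  open A -> compact K -> K `<=` A -> (forall u, ~ K u -> h u = 0) ->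
  smooth_on A h -> smooth_on setT h.
Proof.
move=> oA cK KA h0 sh; apply: smooth_local => u _.
have [Au|nAu] := pselect (A u); first by exists A.
have clK : closed K by apply: compact_closed => //; exact: norm_hausdorff.
exists (~` K) => [Ku|]; first by apply: nAu; exact: KA.
apply: (@smooth_eq _ _ _ _ (fun=> 0)); first exact: closed_openC.
  by move=> w Kw; rewrite h0.
exact: smooth_cst.
Qed.
End Cutoff.

Section Extension.
Context {R : realType} {m : nat} {M : manifold R m}.
Implicit Types (c : @chart R m M) (x y z : M) (u v w : 'rV[R]_m) (X Y : vfield M).

Lemma smooth_fun_local (f : M -> R) c : smooth_chart c ->
  (forall y, cdom c y -> exists c' A, [/\ smooth_chart c', cdom c' y, open A, A (c' y) &
    smooth_on A (f \o cinv c' : _ -> R^o)]) ->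
  smooth_on (cimg c) (f \o cinv c : _ -> R^o).
Proof.
move=> sc H; have [ic _] := sc; apply: smooth_local => u cu.
have [c' [A [sc' c'y oA Ay sA]]] := H _ (cinv_dom ic cu).
have [ic' _] := sc'.
pose B := [set u | overlap c c' u /\ A (tr c c' u)].
have oB : open B.
  apply: open_from_near => w [ow Aw]; apply: filterI.
    exact: (open_near (overlap_open ic ic') ow).
  apply: (differentiable_continuous (smooth_diff (smooth_tr sc sc') ow)).
  exact: (open_near oA Aw).
exists B; first by split.
have BA : B `<=` overlap c c' by move=> w [].
apply: (@smooth_eq _ _ _ _ ((f \o cinv c') \o tr c c')) => //.
  by move=> w [[cw c'w] Aw]; rewrite /tr /= chartK.
apply: (smooth_comp oB _ (smooth_sub BA (smooth_tr sc sc')) sA).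
by move=> w [].
Qed.

Lemma smooth_fun_rep (f : M -> R) c : smooth_chart c -> smooth_fun f ->
  smooth_on (cimg c) (f \o cinv c : _ -> R^o).
Proof.
move=> sc sf; apply: smooth_fun_local => // y cy.
exists (chart_at y), (cimg (chart_at y)); split.
- exact: smooth_chart_at.
- exact: mem_chart_at.
- by apply: cimg_open; exact: chart_atP.
- by apply: cimg_chart; exact: mem_chart_at.
- exact: sf.
Qed.

(* Away from the compact set [cinv c @` K] the extension by zero vanishes; this
   set is closed because M is Hausdorff. *)
Lemma chart_compact_compl c K y : smooth_chart c -> compact K -> K `<=` cimg c ->
  ~ cdom c y -> exists A, [/\ open A, A (chart_at y y) &
    forall u, A u -> cimg (chart_at y) u /\ ~ (cinv c @` K) (cinv (chart_at y) u)].
Proof.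
move=> sc cK Kc ncy; have [ic _] := sc; have iz := @chart_atP _ _ M y.
have zy := mem_chart_at y.
have clK : closed (cinv c @` K).
  apply: compact_closed; first exact: carrier_hausdorff.
  apply: continuous_compact => //.
  apply: continuous_in_subspaceT => u /set_mem Ku.
  by case: ic => _ _ _ _; apply; exact: Kc.
exists [set u | cimg (chart_at y) u /\ (~` (cinv c @` K)) (cinv (chart_at y) u)].
split=> //.
- apply: open_from_near => u [zu Ku]; apply: filterI.
    exact: (open_near (cimg_open iz) zu).
  apply: near_cinv => //; apply: (open_near (closed_openC clK) Ku).
- split; first exact: cimg_chart.
  rewrite chartK // => -[u Ku e]; apply: ncy; rewrite -e; apply: cinv_dom => //.
  exact: Kc.
Qed.

(** The set U precedes the field g, so that many fields can be extended from the same U. The last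
    clause keeps the extension inside a distribution in which g takes its values. *)
Lemma extend_field c A (a : 'rV[R]_m) : smooth_chart c -> open A -> A `<=` cimg c -> A a ->
  exists U, [/\ open U, U a, U `<=` A & forall g, smooth_on A g ->
    exists X, [/\ smooth_field X, forall u, U u -> frep c X u = g u &
      forall y, X y = 0 \/ cdom c y /\
        exists t : R, X y = t *: g (c y) *m dchart_inv c y]].
Proof.
move=> sc oA Ac Aa; have [ic _] := sc.
have [b [U [K [[oU Ua] UA [sb b1] [cK KA] b0]]]] := cutoff_exists oA Aa.
exists U; split=> // g sg; pose h u : 'rV[R]_m := b u *: g u.
have sh : smooth_on setT h.
  apply: (@smooth_cutoff _ _ _ A K b) => //; first by move=> u /b0 b0u; rewrite /h b0u scale0r.
  apply: smooth_row => // j; under eq_fun do rewrite mxE.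
  by apply: smoothM => //; [apply: smooth_sub sb|exact: smooth_coord].
pose X y : 'rV[R]_m := if pselect (cdom c y) then h (c y) *m dchart_inv c y else 0.
have XE u : cimg c u -> frep c X u = h u.
  move=> cu; rewrite frepE /X; case: pselect => [cy|[]]; last exact: cinv_dom.
  by rewrite cinvK // -mulmxA dchart_invK // mulmx1.
exists X; split; last 1 first.
- move=> y; rewrite /X; case: pselect => [cy|ncy]; last by left.
  by right; split=> //; exists (b (c y)).
- apply: smooth_field_local => y; have [cy|ncy] := pselect (cdom c y).
    exists c, (cimg c); split=> //; [exact: cimg_open|exact: cimg_chart|].
    apply: (@smooth_eq _ _ _ _ h); [exact: cimg_open|by move=> u /XE ->|].
    exact: smooth_sub (@subsetT _ _) sh.
  have [B [oB By HB]] := chart_compact_compl sc cK (subset_trans KA Ac) ncy.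
  exists (chart_at y), B; split=> //; [exact: smooth_chart_at|exact: mem_chart_at|].
  apply: (@smooth_eq _ _ _ _ (fun=> 0)) => //; last exact: smooth_cst.
  move=> u /HB[zu nK]; rewrite frepE /X; case: pselect => [cy|ncy2]; last by rewrite mul0mx.
  rewrite /h b0 ?scale0r ?mul0mx // => Ku; apply: nK; exists (c (cinv (chart_at y) u)) => //.
  exact: chartK.
- by move=> u Uu; rewrite XE /h ?b1 ?scale1r //; apply: Ac; exact: UA.
Qed.

Lemma extend_fun c A (a : 'rV[R]_m) : smooth_chart c -> open A -> A `<=` cimg c -> A a ->
  exists U, [/\ open U, U a, U `<=` A & forall g : _ -> R^o, smooth_on A g ->
    exists f : M -> R, [/\ smooth_fun f, forall u, U u -> f (cinv c u) = g u &
      forall y, f y <> 0 -> cdom c y /\ A (c y)]].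
Proof.
move=> sc oA Ac Aa; have [ic _] := sc.
have [b [U [K [[oU Ua] UA [sb b1] [cK KA] b0]]]] := cutoff_exists oA Aa.
exists U; split=> // g sg; pose h u : R^o := b u * g u.
have h0 u : ~ K u -> h u = 0 by move=> /b0 b0u; rewrite /h b0u mul0r.
have sh : smooth_on setT h.
  apply: (@smooth_cutoff _ _ _ A K b) => //.
  by apply: smoothM => //; apply: smooth_sub sb.
pose f y : R := if pselect (cdom c y) then h (c y) else 0.
have fE u : cimg c u -> f (cinv c u) = h u.
  move=> cu; rewrite /f; case: pselect => [cy|[]]; last exact: cinv_dom.
  by rewrite cinvK.
exists f; split; last 1 first.
- move=> y; rewrite /f; case: pselect => // cy hy; split=> //.
  by apply: contrapT => nA; apply: hy; apply: h0 => Ky; apply: nA; exact: KA.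
- move=> x; apply: smooth_fun_local; first exact: smooth_chart_at.
  move=> y _; have [cy|ncy] := pselect (cdom c y).
    exists c, (cimg c); split=> //; [exact: cimg_open|exact: cimg_chart|].
    apply: (@smooth_eq _ _ _ _ h); [exact: cimg_open|by move=> u /fE|].
    exact: smooth_sub (@subsetT _ _) sh.
  have [B [oB By HB]] := chart_compact_compl sc cK (subset_trans KA Ac) ncy.
  exists (chart_at y), B; split=> //; [exact: smooth_chart_at|exact: mem_chart_at|].
  apply: (@smooth_eq _ _ _ _ (fun=> 0)) => //; last exact: smooth_cst.
  move=> u /HB[zu nK]; rewrite /f /=; case: pselect => [cy|//].
  rewrite h0 // => Ku; apply: nK; exists (c (cinv (chart_at y) u)) => //.
  exact: chartK.
- by move=> u Uu; rewrite fE /h ?b1 ?mul1r //; apply: Ac; exact: UA.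
Qed.
End Extension.

#[local] Opaque derive diff dchart dchart_inv.

(** * Connections and curvature *)

Section Fields.
Context {R : realType} {m : nat} {M : manifold R m}.
Implicit Types (c : @chart R m M) (x y z : M) (u v w : 'rV[R]_m) (X Y Z : vfield M).

Lemma smooth_fun_cst (k : R) : smooth_fun (fun _ : M => k).
Proof. by move=> x; exact: smooth_cst. Qed.

Lemma smooth_field_comb (f : M -> R) X Y : smooth_fun f -> smooth_field X -> smooth_field Y ->
  smooth_field (fun y => f y *: X y + Y y).
Proof.
move=> sf sX sY x; have oz : open (cimg (chart_at x)) by apply: cimg_open; exact: chart_atP.
have -> : field_rep x (fun y => f y *: X y + Y y) =
  (fun u => fun_rep x f u *: field_rep x X u + field_rep x Y u).
  by apply/funext => u; rewrite /field_rep mulmxDl -scalemxAl.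
apply: smoothD => //; apply: smooth_row => // j; under eq_fun do rewrite mxE.
by apply: smoothM => //; apply: smooth_coord.
Qed.

Lemma smooth_field0 : smooth_field (fun _ : M => 0).
Proof.
move=> x; have -> : field_rep x (fun=> 0) = (fun=> 0); last exact: smooth_cst.
by apply/funext => u; rewrite /field_rep mul0mx.
Qed.

Lemma fieldE c X y : smooth_chart c -> cdom c y -> X y = frep c X (c y) *m dchart_inv c y.
Proof.
move=> sc cy; have [ic _] := sc.
by rewrite frepE chartK // -mulmxA dchartK // mulmx1.
Qed.

Lemma frep_fieldE c X u : smooth_chart c -> cimg c u ->
  X (cinv c u) = frep c X u *m dchart_inv c (cinv c u).
Proof.
move=> sc cu; have [ic _] := sc.
by rewrite {1}(@fieldE c X) // ?cinvK //; exact: cinv_dom.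
Qed.

Lemma near_frep c X Y (U : set 'rV[R]_m) u : smooth_chart c -> open U -> U `<=` cimg c -> U u ->
  (forall w, U w -> frep c X w = frep c Y w) -> \forall y \near cinv c u, X y = Y y.
Proof.
move=> sc oU Uc Uu H; have [ic _] := sc; have cu := Uc _ Uu.
have cy := cinv_dom ic cu.
have := near_chart ic cy (P := U); rewrite cinvK // => /(_ (open_near oU Uu)) nU.
near=> y; rewrite (fieldE X sc (y := y)) ?(fieldE Y sc (y := y)) ?H //; near: y => //.
  exact: (open_near (cdom_open ic) cy).
exact: (open_near (cdom_open ic) cy).
Unshelve. all: by end_near. Qed.

Lemma near_bump x (P : set M) : (\near x, P x) -> exists f : M -> R,
  [/\ smooth_fun f, f x = 1 & forall y, f y <> 0 -> P y].
Proof.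
move=> nP; have sz := smooth_chart_at x; have [iz _] := sz.
have zx := mem_chart_at x.
pose A := [set u | cimg (chart_at x) u /\ P° (cinv (chart_at x) u)].
have oA : open A.
  apply: open_from_near => u [zu Pu]; apply: filterI.
    exact: (open_near (cimg_open iz) zu).
  by apply: near_cinv => //; apply: (open_near _ Pu); exact: open_interior.
have Ac : A `<=` cimg (chart_at x) by move=> u [].
have Aa : A (chart_at x x) by split; [exact: cimg_chart|rewrite chartK].
have [U [oU Ux _ /(_ (fun=> 1))[|f [sf fU fA]]]] := extend_fun sz oA Ac Aa.
  exact: smooth_cst.
exists f; split=> // [|y /fA[zy [_ Py]]].
  by have := fU _ Ux; rewrite chartK.
by move: Py; rewrite chartK // => /interior_subset.
Qed.
End Fields.

Section Connection.
Context {R : realType} {m : nat} {M : manifold R m}.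
Variable nabla : vfield M -> vfield M -> vfield M.
Hypothesis cn : is_connection nabla.
Implicit Types (c : @chart R m M) (x y z : M) (u v w : 'rV[R]_m) (X Y Z : vfield M).

Lemma nabla0l Z x : smooth_field Z -> nabla (fun=> 0) Z x = 0.
Proof.
move=> sZ; have s0 := @smooth_field0 R m M.
have := nabla_linear cn (smooth_fun_cst 1) s0 s0 sZ x.
under eq_fun do rewrite scaler0 addr0.
by rewrite scale1r => /eqP; rewrite -subr_eq subrr eq_sym => /eqP.
Qed.

Lemma nabla0r X x : smooth_field X -> nabla X (fun=> 0) x = 0.
Proof.
move=> sX; have s0 := @smooth_field0 R m M.
have := nabla_leibniz cn (smooth_fun_cst 0) sX s0 x.
under eq_fun do rewrite scaler0.
by rewrite scaler0 scale0r addr0.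
Qed.

(** A connection is given on global fields, so its locality has to be derived: with a bump function
    f supported where X = X', the field f (X - X') is 0, and linearity over functions gives the
    claim at x, where f = 1. *)
Lemma nabla_locl X X' Z x : smooth_field X -> smooth_field X' -> smooth_field Z ->
  (\near x, X x = X' x) -> nabla X Z x = nabla X' Z x.
Proof.
move=> sX sX' sZ /near_bump[f [sf fx fP]].
pose W y := (-1) *: X' y + X y.
have sW : smooth_field W by apply: smooth_field_comb => //; exact: smooth_fun_cst.
have W0 : nabla W Z x = 0.
  have := nabla_linear cn sf sW (@smooth_field0 R m M) sZ x.
  have -> : (fun y => f y *: W y + 0) = (fun=> 0).
    apply/funext => y; rewrite addr0; have [->|/eqP/fP e] := eqVneq (f y) 0.
      by rewrite scale0r.
    by rewrite /W e scaleN1r addNr scaler0.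
  by rewrite fx scale1r nabla0l // addr0.
have := nabla_linear cn (smooth_fun_cst 1) sW sX' sZ x.
have -> : (fun y => 1 *: W y + X' y) = X.
  by apply/funext => y; rewrite /W scale1r scaleN1r addrAC addNr add0r.
by rewrite W0 scaler0 add0r.
Qed.

(** The same argument with the Leibniz rule; its extra term X(f) W(x) vanishes because the two
    fields agree at x. *)
Lemma nabla_locr X Z Z' x : smooth_field X -> smooth_field Z -> smooth_field Z' ->
  (\near x, Z x = Z' x) -> nabla X Z x = nabla X Z' x.
Proof.
move=> sX sZ sZ' nZ; have e := nbhs_singleton nZ; have [f [sf fx fP]] := near_bump nZ.
pose W y := (-1) *: Z' y + Z y.
have sW : smooth_field W by apply: smooth_field_comb => //; exact: smooth_fun_cst.
have W0 : nabla X W x = 0.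
  have := nabla_leibniz cn sf sX sW x.
  have -> : (fun y => f y *: W y) = (fun=> 0).
    apply/funext => y; have [->|/eqP/fP ey] := eqVneq (f y) 0.
      by rewrite scale0r.
    by rewrite /W ey scaleN1r addNr scaler0.
  rewrite fx scale1r nabla0r // => ->; rewrite /W e scaleN1r addNr scaler0 add0r //.
have := nabla_add cn sX sW sZ' x.
have -> : (fun y => W y + Z' y) = Z.
  by apply/funext => y; rewrite /W scaleN1r addrAC addNr add0r.
by rewrite W0 add0r.
Qed.

Lemma nabla_suml I (r : seq I) (f : I -> M -> R) (E : I -> vfield M) Z x :
  (forall i, smooth_fun (f i)) -> (forall i, smooth_field (E i)) -> smooth_field Z ->
  smooth_field (fun y => \sum_(i <- r) f i y *: E i y) /\
  nabla (fun y => \sum_(i <- r) f i y *: E i y) Z x =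
  \sum_(i <- r) f i x *: nabla (E i) Z x.
Proof.
move=> sf sE sZ; elim: r => [|i r [IHs IH]].
  under eq_fun do rewrite big_nil.
  by rewrite big_nil nabla0l //; split => //; exact: smooth_field0.
under eq_fun do rewrite big_cons.
by split; [exact: smooth_field_comb|rewrite big_cons nabla_linear // IH].
Qed.

Lemma nabla_sumr I (r : seq I) (f : I -> M -> R) (E : I -> vfield M) X x :
  (forall i, smooth_fun (f i)) -> (forall i, smooth_field (E i)) -> smooth_field X ->
  smooth_field (fun y => \sum_(i <- r) f i y *: E i y) /\
  nabla X (fun y => \sum_(i <- r) f i y *: E i y) x =
  \sum_(i <- r) (vact X (f i) x *: E i x + f i x *: nabla X (E i) x).
Proof.
move=> sf sE sX; elim: r => [|i r [IHs IH]].
  under eq_fun do rewrite big_nil.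
  by rewrite big_nil nabla0r //; split => //; exact: smooth_field0.
under eq_fun do rewrite big_cons.
split; first exact: smooth_field_comb.
have sfE : smooth_field (fun y => f i y *: E i y).
  have := smooth_field_comb (sf i) (sE i) (@smooth_field0 R m M).
  by under eq_fun do rewrite addr0.
by rewrite big_cons (nabla_add cn sX sfE IHs) IH nabla_leibniz.
Qed.

(* theta v is the matrix of nabla_v in the coordinate frame of the chart c *)
Definition connection_matrix c (U : set 'rV[R]_m)
    (theta : 'rV[R]_m -> 'rV[R]_m -> 'M[R]_m) : Prop :=
  [/\ open U, U `<=` cimg c, forall v, msmooth U (theta v),
      forall (k : R) v w u, U u -> theta (k *: v + w) u = k *: theta v u + theta w u &
      forall X Z, smooth_field X -> smooth_field Z -> forall u, U u ->
        frep c (nabla X Z) u =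
        'D_(frep c X u) (frep c Z) u + frep c Z u *m theta (frep c X u) u].

Lemma theta_sum (U : set 'rV[R]_m) (theta : 'rV[R]_m -> 'rV[R]_m -> 'M[R]_m) :
  (forall (k : R) v w u, U u -> theta (k *: v + w) u = k *: theta v u + theta w u) ->
  forall v u, U u -> theta v u = \sum_j v 0 j *: theta (delta_mx 0 j) u.
Proof.
move=> lt v u Uu; rewrite [in LHS](row_sum_delta v).
have t0 : theta 0 u = 0.
  have := lt 1 0 0 u Uu; rewrite scaler0 addr0 scale1r.
  by move/eqP; rewrite -subr_eq subrr eq_sym => /eqP.
elim: (index_enum _) => [|j r IH]; first by rewrite !big_nil.
by rewrite !big_cons lt // IH.
Qed.

(** The fields E v extend the constant fields of the chart, and row i of theta v is nabla_(E v) E_i.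
    Near a point all fields are combinations of the coordinate ones, and locality with the Leibniz
    rule gives the formula. *)
Lemma connection_matrix_exists c a : smooth_chart c -> cimg c a ->
  exists U theta, U a /\ connection_matrix c U theta.
Proof.
move=> sc ca; have [ic _] := sc.
have [U [oU Ua Uc HU]] := extend_field sc (cimg_open ic) (@subset_refl _ _) ca.
have /choice[E HE] : forall v, exists X, smooth_field X /\ forall u, U u -> frep c X u = v.
  by move=> v; have [|X [sX XU _]] := HU (fun=> v); [exact: smooth_cst|exists X].
have sE v : smooth_field (E v) by have [] := HE v.
have EU v u : U u -> frep c (E v) u = v by have [_] := HE v; exact.
pose theta v u : 'M[R]_m :=
  \matrix_(i, j) (frep c (nabla (E v) (E (delta_mx 0 i))) u) 0 j.
have theta_row v u i : row i (theta v u) = frep c (nabla (E v) (E (delta_mx 0 i))) u.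
  by apply/rowP => j; rewrite !mxE.
have lt (k : R) v w u : U u -> theta (k *: v + w) u = k *: theta v u + theta w u.
  move=> Uu; apply/row_matrixP => i; rewrite linearP /= !theta_row.
  rewrite ![frep c (nabla _ _) u]frepE.
  have -> : nabla (E (k *: v + w)) (E (delta_mx 0 i)) (cinv c u) =
      nabla (fun y => (fun=> k) y *: E v y + E w y) (E (delta_mx 0 i)) (cinv c u).
    have sc1 := smooth_field_comb (smooth_fun_cst k) (sE v) (sE w).
    apply: nabla_locl => //; apply: (near_frep sc oU) => // u' Uu'.
    by rewrite EU // frepE mulmxDl -scalemxAl -!frepE !EU.
  by rewrite (nabla_linear cn (smooth_fun_cst k)) // mulmxDl scalemxAl.
exists U, theta; split=> //; split=> //.
  move=> v i j; apply: (@smooth_eq _ _ _ _ (fun u =>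
    (frep c (nabla (E v) (E (delta_mx 0 i))) u) 0 j : R^o)) => //.
    by move=> u Uu; rewrite mxE.
  apply: smooth_coord => //; apply: smooth_sub Uc _; apply: smooth_frep => //.
  exact: nabla_smooth.
move=> X Z sX sZ u Uu; have cu := Uc _ Uu; pose y := cinv c u.
have cy : cdom c y by exact: cinv_dom.
have cyu : c y = u by rewrite cinvK.
(* Linearity and the Leibniz rule hold for global functions, so the coefficients of X and Z in the
   frame E are extended from a neighbourhood of u. *)
have [U1 [oU1 U1u U1U HU1]] := extend_fun sc oU Uc Uu.
have ext T : smooth_field T -> exists f : 'I_m -> M -> R,
    (forall j, smooth_fun (f j)) /\ (forall j w, U1 w -> f j (cinv c w) = frep c T w 0 j).
  move=> sT; have /choice[f Hf] : forall j, exists f : M -> R,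
      smooth_fun f /\ forall w, U1 w -> f (cinv c w) = frep c T w 0 j.
    move=> j; have [|f [sf fU _]] := HU1 (fun w => frep c T w 0 j : R^o); last by exists f.
    by apply: smooth_coord => //; apply: smooth_sub Uc (smooth_frep sc sT).
  by exists f; split=> j; have [] := Hf j.
have U1c : U1 `<=` cimg c by move=> w /U1U/Uc.
have near_sum T (f : 'I_m -> M -> R) : (forall j w, U1 w -> f j (cinv c w) = frep c T w 0 j) ->
    \forall z \near y, T z = \sum_j f j z *: E (delta_mx 0 j) z.
  move=> Hf; apply: (near_frep (Y := fun z => \sum_j f j z *: E (delta_mx 0 j) z) sc oU1) => // w Uw.
  rewrite [LHS](row_sum_delta (frep c T w)) [RHS]frepE mulmx_suml.
  by apply: eq_bigr => j _; rewrite -scalemxAl Hf // -frepE EU //; exact: U1U.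
have [f [sf Hf]] := ext Z sZ; have [g [sg Hg]] := ext X sX.
have sD j : smooth_field (E (delta_mx 0 j)) by [].
have [sS eS] := nabla_sumr (index_enum _) y sf sD sX.
rewrite frepE -/y (nabla_locr sX sZ sS (near_sum Z f Hf)) eS mulmx_suml.
have fy j : f j y = frep c Z u 0 j by exact: Hf.
have gy j : g j y = frep c X u 0 j by exact: Hg.
have Ey v : E v y *m dchart c y = v by rewrite -frepE EU.
have nE j : nabla X (E (delta_mx 0 j)) y *m dchart c y = row j (theta (frep c X u) u).
  have [sT eT] := nabla_suml (index_enum _) y sg sD (sE (delta_mx 0 j)).
  rewrite (nabla_locl sX sT _ (near_sum X g Hg)) // eT mulmx_suml (theta_sum lt) //.
  rewrite linear_sum; apply: eq_bigr => b _.
  by rewrite -scalemxAl gy linearZ /= theta_row [frep c (nabla _ _) u]frepE.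
have vf j : vact X (f j) y = ('D_(frep c X u) (frep c Z) u) 0 j.
  have dZ : differentiable (frep c Z) u by exact: smooth_diff (smooth_frep sc sZ) cu.
  have e : \forall w \near u, (frep c Z w 0 j : R^o) = (f j \o cinv c) w.
    by apply: filterS (open_near oU1 U1u) => w U1w; rewrite /= Hf.
  rewrite (vactE X sc cy); rewrite cyu.
    by rewrite -(near_eq_derive _ e) derive_coord //; exact: diff_derivable.
  by apply: near_eq_differentiable e _; exact: diff_coord.
rewrite [X in _ = X + _](row_sum_delta ('D_(frep c X u) (frep c Z) u)).
rewrite [X in _ = _ + X]mulmx_sum_row -big_split; apply: eq_bigr => j _ /=.
by rewrite mulmxDl -!scalemxAl Ey nE vf fy.
Qed.

(* d theta - theta ^ theta; products are in this order because vectors are rows *)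
Definition curvature_matrix (theta : 'rV[R]_m -> 'rV[R]_m -> 'M[R]_m) v w u : 'M[R]_m :=
  \matrix_(i, j) ('D_v (fun u => theta w u i j : R^o) u) -
  \matrix_(i, j) ('D_w (fun u => theta v u i j : R^o) u) +
  (theta w u *m theta v u - theta v u *m theta w u).

(** Expanding nabla_X (nabla_Y Z) in coordinates, the second derivatives of Z are symmetric by
    Clairaut, the products of a first derivative of Z with theta are symmetric as a whole, and the
    terms in which X differentiates Y cancel against the bracket. *)
Lemma curvature_local c U theta X Y Z u : smooth_chart c -> connection_matrix c U theta ->
  smooth_field X -> smooth_field Y -> smooth_field Z -> U u ->
  frep c (fun x => nabla X (nabla Y Z) x - nabla Y (nabla X Z) x
                   - nabla (bracket X Y) Z x) u =
  frep c Z u *m curvature_matrix theta (frep c X u) (frep c Y u) u.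
Proof.
move=> sc [oU Uc st lt cE] sX sY sZ Uu.
pose T v w : 'M[R]_m := \matrix_(i, j) ('D_v (fun u => theta w u i j : R^o) u).
pose S v w : 'rV[R]_m := \row_j 'D_v (fun p => 'D_w (fun p => frep c Z p 0 j : R^o) p) u.
have rep F : smooth_field F -> smooth_on U (frep c F).
  by move=> sF; apply: smooth_sub Uc _; exact: smooth_frep.
have dlin F v v' : smooth_field F -> 'D_(v - v') (frep c F) u =
    'D_v (frep c F) u - 'D_v' (frep c F) u.
  move=> sF; have dF := smooth_diff (rep F sF) Uu.
  by rewrite (deriveE _ dF) linearB -(deriveE _ dF) -(deriveE _ dF).
have thB v v' : theta (v - v') u = theta v u - theta v' u.
  by rewrite addrC -scaleN1r lt // scaleN1r addrC.
have key A B : smooth_field A -> smooth_field B ->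
    frep c (nabla A (nabla B Z)) u =
    'D_('D_(frep c A u) (frep c B) u) (frep c Z) u + S (frep c A u) (frep c B u) +
    'D_(frep c A u) (frep c Z) u *m theta (frep c B u) u +
    frep c Z u *m theta ('D_(frep c A u) (frep c B) u) u +
    frep c Z u *m T (frep c A u) (frep c B u) +
    ('D_(frep c B u) (frep c Z) u + frep c Z u *m theta (frep c B u) u)
      *m theta (frep c A u) u.
  move=> sA sB; rewrite cE //; last exact: nabla_smooth.
  rewrite cE //; congr (_ + _).
  set v := frep c A u; set w := frep c B u.
  have dB := smooth_diff (rep B sB) Uu; have dZ := smooth_diff (rep Z sZ) Uu.
  have dth i j w' : differentiable (fun p => theta w' p i j : R^o) u.
    exact: smooth_diff (st w' i j) Uu.
  apply/rowP => j.
  have dN : differentiable (frep c (nabla B Z)) u.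
    by apply: (smooth_diff (rep _ _) Uu); exact: nabla_smooth.
  rewrite (derive_coord _ (diff_derivable dN)).
  pose F1 p : R^o := 'D_(frep c B p) (fun p => frep c Z p 0 j : R^o) p.
  pose G b i p : R^o := frep c B p 0 b * theta (delta_mx 0 b) p i j.
  pose F2 i p : R^o := \sum_b G b i p.
  pose F3 i p : R^o := frep c Z p 0 i * F2 i p.
  have eF : \forall p \near u, F1 p + \sum_i F3 i p = frep c (nabla B Z) p 0 j :> R^o.
    apply: filterS (open_near oU Uu) => p Uz; rewrite cE // mxE; congr (_ + _).
      by rewrite /F1 derive_coord //; apply: diff_derivable; exact: smooth_diff (rep Z sZ) Uz.
    rewrite mxE; apply: eq_bigr => i _; congr (_ * _).
    by rewrite (theta_sum lt) // summxE; apply: eq_bigr => b _; rewrite mxE.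
  have dF1 : differentiable F1 u.
    apply: (smooth_diff _ Uu); apply: smooth_dir => //; first exact: rep.
    by apply: smooth_coord => //; exact: rep.
  have dG b i : differentiable (G b i) u.
    by apply: differentiableM => //; exact: diff_coord.
  have [D2 dF2] : (forall i, 'D_v (F2 i) u = \sum_b 'D_v (G b i) u) /\
      forall i, differentiable (F2 i) u.
    by split=> i; have [] := derive_sum_fun (index_enum _) v (fun b => dG b i).
  have dF3 i : differentiable (F3 i) u.
    by apply: differentiableM => //; exact: diff_coord.
  have [D3 dS3] := derive_sum_fun (index_enum _) v dF3.
  rewrite -(near_eq_derive _ eF) (deriveD (diff_derivable dF1) (diff_derivable dS3)) D3.
  have -> : 'D_v F1 u = ('D_('D_v (frep c B) u) (frep c Z) u) 0 j + S v w 0 j.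
    rewrite /F1 (@derive_dir _ _ U) //; last 2 first.
    - exact: rep.
    - by apply: smooth_coord => //; exact: rep.
    by rewrite (derive_coord _ (diff_derivable dZ)) [S v w 0 j]mxE.
  have F2u i : F2 i u = theta w u i j.
    by rewrite (theta_sum lt) // summxE; apply: eq_bigr => b _; rewrite mxE.
  have D2u i : 'D_v (F2 i) u = theta ('D_v (frep c B) u) u i j + T v w i j.
    rewrite D2 (theta_sum lt) // summxE [T v w i j]mxE.
    have -> : 'D_v (fun p => theta w p i j : R^o) u =
        \sum_b w 0 b * 'D_v (fun p => theta (delta_mx 0 b) p i j : R^o) u.
      have e : \forall p \near u, \sum_b w 0 b * theta (delta_mx 0 b) p i j = theta w p i j :> R^o.
        apply: filterS (open_near oU Uu) => p Uz; rewrite (theta_sum lt w) // summxE.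
        by apply: eq_bigr => b _; rewrite mxE.
      rewrite -(near_eq_derive _ e).
      have db b : differentiable (fun p => w 0 b * theta (delta_mx 0 b) p i j : R^o) u.
        exact: differentiableM.
      have [-> _] := derive_sum_fun (index_enum _) v db.
      apply: eq_bigr => b _; rewrite (derive_mul _ (differentiable_cst _ _) (dth i j _)).
      by rewrite derive_cst mul0r add0r.
    rewrite -big_split; apply: eq_bigr => b _ /=.
    rewrite (derive_mul _ (diff_coord _ dB) (dth i j _)) mxE.
    by rewrite (derive_coord _ (diff_derivable dB)).
  have -> : \sum_i 'D_v (F3 i) u =
      \sum_i (('D_v (frep c Z) u) 0 i * theta w u i j +
       frep c Z u 0 i * theta ('D_v (frep c B) u) u i j + frep c Z u 0 i * T v w i j).
    apply: eq_bigr => i _; rewrite (derive_mul _ (diff_coord _ dZ) (dF2 i)).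
    by rewrite (derive_coord _ (diff_derivable dZ)) F2u D2u mulrDr addrA.
  rewrite !big_split /= -!addrA !mxE.
  by do 2! congr (_ + _).
have SS : S (frep c X u) (frep c Y u) = S (frep c Y u) (frep c X u).
  apply/rowP => j; rewrite [LHS]mxE [RHS]mxE.
  have sj := smooth_coord j oU (rep Z sZ).
  exact: (clairaut (frep c Y u) (frep c X u) oU sj Uu).
have -> : forall A B C : vfield M, frep c (fun x => A x - B x - C x) u =
    frep c A u - frep c B u - frep c C u.
  by move=> A B C; rewrite !frepE !mulmxBl.
have sb := smooth_bracket sX sY.
pose l v := 'D_v (frep c Z) u; pose d A B := 'D_(frep c A u) (frep c B) u.
have lB v v' : l (v - v') = l v - l v' by exact: dlin.
have kb : frep c (nabla (bracket X Y) Z) u =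
    l (d X Y - d Y X) + frep c Z u *m theta (d X Y - d Y X) u.
  by rewrite (cE _ _ sb sZ u Uu) (bracketE sc sX sY (Uc _ Uu)).
have kXY : frep c (nabla X (nabla Y Z)) u = l (d X Y) + S (frep c X u) (frep c Y u) +
    l (frep c X u) *m theta (frep c Y u) u + frep c Z u *m theta (d X Y) u +
    frep c Z u *m T (frep c X u) (frep c Y u) +
    (l (frep c Y u) + frep c Z u *m theta (frep c Y u) u) *m theta (frep c X u) u.
  exact: key.
have kYX : frep c (nabla Y (nabla X Z)) u = l (d Y X) + S (frep c Y u) (frep c X u) +
    l (frep c Y u) *m theta (frep c X u) u + frep c Z u *m theta (d Y X) u +
    frep c Z u *m T (frep c Y u) (frep c X u) +
    (l (frep c X u) + frep c Z u *m theta (frep c X u) u) *m theta (frep c Y u) u.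
  exact: key.
have -> : curvature_matrix theta (frep c X u) (frep c Y u) u =
    T (frep c X u) (frep c Y u) - T (frep c Y u) (frep c X u) +
    (theta (frep c Y u) u *m theta (frep c X u) u -
     theta (frep c X u) u *m theta (frep c Y u) u) by [].
clear key dlin; clearbody l d S T; rewrite kb kXY kYX SS lB thB.
rewrite !(mulmxDl, mulmxDr, mulmxN, mulmxA).
move: (S _ _) (l (d _ _)) (l (d _ _)) (_ *m theta (d _ _) u) (_ *m theta (d _ _) u)
  => S1 l1 l2 l3 l4.
move: (l _ *m _) (l _ *m _) (_ *m T _ _) (_ *m T _ _) => l5 l6 T1 T2.
move: (_ *m theta _ _ *m _) (_ *m theta _ _ *m _) => t1 t2.
by apply/rowP => j; rewrite !mxE; ring.
Qed.

Lemma curvature_exists : exists Omega, is_curvature nabla Omega.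
Proof.
have /choice[th Hth] : forall x, exists theta, exists2 U, U (chart_at x x) &
    connection_matrix (chart_at x) U theta.
  move=> x; have [|U [theta [Ux H]]] :=
    connection_matrix_exists (smooth_chart_at x) (a := chart_at x x).
    by apply: cimg_chart; exact: mem_chart_at.
  by exists theta, U.
exists (fun x (A : 'M[R]_(1 + 1, m)) =>
   curvature_matrix (th x) (usubmx A) (dsubmx A) (chart_at x x)).
move=> X Y Z sX sY sZ x; have [U Ux H] := Hth x.
have := curvature_local (smooth_chart_at x) H sX sY sZ Ux.
have zx := @mem_chart_at _ _ M x.
rewrite !frepE chartK ?dchart_at ?mulmx1 //; try exact: chart_atP.
by rewrite /rows2 col_mxKu col_mxKd.
Qed.

Lemma curvature_rep Omega c U theta u v w : is_curvature nabla Omega ->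
  smooth_chart c -> connection_matrix c U theta -> U u ->
  Omega (cinv c u) (rows2 (v *m dchart_inv c (cinv c u)) (w *m dchart_inv c (cinv c u))) =
  dchart c (cinv c u) *m curvature_matrix theta v w u *m dchart_inv c (cinv c u).
Proof.
move=> cO sc H Uu; have [oU Uc _ _ _] := H; have [ic _] := sc.
have cu := Uc _ Uu; have cy := cinv_dom ic cu; set y := cinv c u.
have [U1 [oU1 U1u U1U HU]] := extend_field sc oU Uc Uu.
have E t : exists X, smooth_field X /\ frep c X u = t.
  by have [|X [sX XU _]] := HU (fun=> t); [exact: smooth_cst|exists X; rewrite XU].
apply: mulmx_ext => z; have [Z [sZ eZ]] := E (z *m dchart c y).
have [X [sX eX]] := E v; have [Y [sY eY]] := E w.
have Fy F t : frep c F u = t -> F y = t *m dchart_inv c y.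
  by move=> <-; exact: frep_fieldE.
have Xy := Fy X _ eX; have Yy := Fy Y _ eY.
have Zy : Z y = z by rewrite (Fy Z _ eZ) -mulmxA (dchartK sc cy) mulmx1.
have := cO X Y Z sX sY sZ y; rewrite Xy Yy Zy => <-.
pose F x := nabla X (nabla Y Z) x - nabla Y (nabla X Z) x - nabla (bracket X Y) Z x.
have eF : frep c F u = z *m dchart c y *m curvature_matrix theta v w u.
  by have := curvature_local sc H sX sY sZ Uu; rewrite eX eY eZ.
apply: (etrans (Fy F _ eF)).
move: (curvature_matrix _ _ _ _) (dchart c y) (dchart_inv c y) => K1 J1 J2.
by rewrite !mulmxA.
Qed.
End Connection.

Lemma conj_solve (R : nzRingType) m (J1 J2 : 'M[R]_m) (a z v : 'rV[R]_m)
    (T : 'rV[R]_m -> 'M[R]_m) : J1 *m J2 = 1%:M -> J2 *m J1 = 1%:M ->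
  a *m J1 = z *m J1 *m T (v *m J2 *m J1) -> a = z *m (J1 *m T v *m J2).
Proof.
move=> J12 J21 /(congr1 (fun b => b *m J2)).
by rewrite -(mulmxA a) J12 mulmx1 -(mulmxA v) J21 mulmx1 => ->; rewrite !mulmxA.
Qed.

(** The Leibniz terms of the two connections cancel, so their difference is a tensor: read at each x
    in the attached chart, it has the conjugated expression in every other chart. *)
Lemma connection_difference (R : realType) (m : nat) (M : manifold R m)
  (nabla nabla' : vfield M -> vfield M -> vfield M) :
  is_connection nabla -> is_connection nabla' ->
  exists A : M -> 'rV[R]_m -> 'M[R]_m, forall c U theta theta' u v,
    smooth_chart c -> connection_matrix nabla c U theta ->
    connection_matrix nabla' c U theta' -> U u ->
    A (cinv c u) (v *m dchart_inv c (cinv c u)) =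
    dchart c (cinv c u) *m (theta' v u - theta v u) *m dchart_inv c (cinv c u).
Proof.
move=> cn cn'.
have dif c U theta theta' X Z u : smooth_chart c -> connection_matrix nabla c U theta ->
    connection_matrix nabla' c U theta' -> smooth_field X -> smooth_field Z -> U u ->
    (nabla' X Z (cinv c u) - nabla X Z (cinv c u)) *m dchart c (cinv c u) =
    Z (cinv c u) *m dchart c (cinv c u) *m
     (theta' (X (cinv c u) *m dchart c (cinv c u)) u - theta (X (cinv c u) *m dchart c (cinv c u)) u).
  move=> sc [_ Uc _ _ e] [_ _ _ _ e'] sX sZ Uu.
  have := e X Z sX sZ u Uu; have := e' X Z sX sZ u Uu.
  rewrite mulmxBl -!frepE => -> ->; rewrite mulmxBr.
  have addKK (a b t : 'rV[R]_m) : (t + a) - (t + b) = a - b.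
    by rewrite opprD addrACA subrr add0r.
  exact: addKK.
have ex x : exists th th' U, [/\ U (chart_at x x),
    connection_matrix nabla (chart_at x) U th & connection_matrix nabla' (chart_at x) U th'].
  have sz := smooth_chart_at x; have zx : cimg (chart_at x) (chart_at x x).
    by apply: cimg_chart; exact: mem_chart_at.
  have [U [th [Ux [oU Uc st lt e]]]] := connection_matrix_exists cn sz zx.
  have [U' [th' [U'x [oU' U'c st' lt' e']]]] := connection_matrix_exists cn' sz zx.
  exists th, th', (U `&` U'); split=> //; split.
  - exact: openI.
  - by move=> u [/Uc].
  - by move=> v; apply: msmooth_sub (st v) => u [].
  - by move=> k v w u [Uu _]; exact: lt.
  - by move=> X Z sX sZ u [Uu _]; exact: e.
  - exact: openI.
  - by move=> u [/Uc].
  - by move=> v; apply: msmooth_sub (st' v) => u [].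
  - by move=> k v w u [_ Uu]; exact: lt'.
  - by move=> X Z sX sZ u [_ Uu]; exact: e'.
have /choice[th /choice[th' Hth]] := ex.
exists (fun x v => th' x v (chart_at x x) - th x v (chart_at x x)).
move=> c U theta theta' u v sc H H' Uu.
have [oU Uc _ _ _] := H; have [ic _] := sc.
have cu := Uc _ Uu; have cy := cinv_dom ic cu; set y := cinv c u.
have [U1 [oU1 U1u U1U HU]] := extend_field sc oU Uc Uu.
have E t : exists X, smooth_field X /\ X y = t.
  have [|X [sX XU _]] := HU (fun=> t *m dchart c y); first exact: smooth_cst.
  exists X; split=> //; have := frep_fieldE X sc cu; rewrite XU // => ->.
  by rewrite -mulmxA dchartK // mulmx1.
apply: mulmx_ext => z; have [Z [sZ eZ]] := E z.
have [X [sX eX]] := E (v *m dchart_inv c y).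
have [V [Vy Hy Hy']] := Hth y.
have zy := @mem_chart_at _ _ M y; have iz := @chart_atP _ _ M y.
have d1 := dif _ _ _ _ X Z _ (smooth_chart_at y) Hy Hy' sX sZ Vy.
have e := dif _ _ _ _ X Z _ sc H H' sX sZ Uu.
rewrite (chartK iz zy) (dchart_at y) eX eZ in d1.
move: d1; rewrite (mulmx1 (v *m dchart_inv c y)) (mulmx1 z) (mulmx1 (_ - _)) => <-.
rewrite -/y eX eZ in e; by apply: (conj_solve (T := fun w => theta' w u - theta w u) (dchartK sc cy) (dchart_invK sc cy)).
Qed.

(** * Differential forms in a chart *)

(* Functions are extended by 0 outside of U, so that Leibniz equality is equality
   on U. *)
Record sfun (R : realType) (m : nat) (U : set 'rV[R]_m) (oU : open U)
    (u0 : 'rV[R]_m) (Uu0 : U u0) := SFun {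
  sfun_val :> 'rV[R]_m -> R^o;
  sfun_smooth : smooth_on U sfun_val;
  sfun_out : forall u, ~ U u -> sfun_val u = 0 }.

Section SFun.
Context {R : realType} {m : nat} {U : set 'rV[R]_m} {oU : open U}.
Context {u0 : 'rV[R]_m} {Uu0 : U u0}.
Local Notation K := (sfun oU Uu0).
Implicit Types f g h : K.

HB.instance Definition _ := gen_eqMixin K.
HB.instance Definition _ := gen_choiceMixin K.

Lemma sfunP f g : (forall u, U u -> f u = g u) -> f = g.
Proof.
move=> fg; have e : f = g :> ('rV[R]_m -> R^o).
  apply/funext => u; have [Uu|nU] := pselect (U u); first exact: fg.
  by rewrite !sfun_out.
case: f g e {fg} => [f sf f0] [g sg g0] /= e; case: g / e sg g0 => sg g0.
by congr SFun; exact: Prop_irrelevance.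
Qed.

Definition restrict (f : 'rV[R]_m -> R^o) : 'rV[R]_m -> R^o :=
  fun u => if pselect (U u) then f u else 0.

Lemma restrictE (f : 'rV[R]_m -> R^o) u : U u -> restrict f u = f u.
Proof. by rewrite /restrict; case: pselect. Qed.

Lemma restrict_smooth (f : 'rV[R]_m -> R^o) : smooth_on U f -> smooth_on U (restrict f).
Proof. by apply: smooth_eq => // u Uu; rewrite restrictE. Qed.

Lemma restrict_out (f : 'rV[R]_m -> R^o) u : ~ U u -> restrict f u = 0.
Proof. by rewrite /restrict; case: pselect. Qed.

Definition mk (f : 'rV[R]_m -> R^o) (sf : smooth_on U f) : K :=
  SFun oU Uu0 (restrict_smooth sf) (@restrict_out f).

Lemma mkE (f : 'rV[R]_m -> R^o) (sf : smooth_on U f) u : U u -> mk sf u = f u.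
Proof. by move=> Uu; rewrite /= restrictE. Qed.

Definition sf_add f g : K := mk (smoothD oU (sfun_smooth f) (sfun_smooth g)).
Definition sf_opp f : K := mk (smoothZ (-1) oU (sfun_smooth f)).
Definition sf_mul f g : K := mk (smoothM oU (sfun_smooth f) (sfun_smooth g)).
Definition sf_zero : K := mk (smooth_cst (0 : R^o)).
Definition sf_one : K := mk (smooth_cst (1 : R^o)).

Lemma sf_addE f g u : U u -> sf_add f g u = f u + g u. Proof. exact: mkE. Qed.
Lemma sf_oppE f u : U u -> sf_opp f u = - f u.
Proof. by move=> Uu; rewrite mkE // scaleN1r. Qed.
Lemma sf_mulE f g u : U u -> sf_mul f g u = f u * g u. Proof. exact: mkE. Qed.
Lemma sf_zeroE u : U u -> sf_zero u = 0. Proof. exact: mkE. Qed.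
Lemma sf_oneE u : U u -> sf_one u = 1. Proof. exact: mkE. Qed.

Lemma sf_addA : associative sf_add.
Proof. by move=> f g h; apply: sfunP => u Uu; rewrite !sf_addE // addrA. Qed.
Lemma sf_addC : commutative sf_add.
Proof. by move=> f g; apply: sfunP => u Uu; rewrite !sf_addE // addrC. Qed.
Lemma sf_add0 : left_id sf_zero sf_add.
Proof. by move=> f; apply: sfunP => u Uu; rewrite sf_addE // sf_zeroE // add0r. Qed.
Lemma sf_addN : left_inverse sf_zero sf_opp sf_add.
Proof. by move=> f; apply: sfunP => u Uu; rewrite sf_addE // sf_oppE // sf_zeroE // addNr. Qed.

HB.instance Definition _ := GRing.isZmodule.Build K sf_addA sf_addC sf_add0 sf_addN.

Lemma sf_mulA : associative sf_mul.
Proof. by move=> f g h; apply: sfunP => u Uu; rewrite !sf_mulE // mulrA. Qed.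
Lemma sf_mulC : commutative sf_mul.
Proof. by move=> f g; apply: sfunP => u Uu; rewrite !sf_mulE // mulrC. Qed.
Lemma sf_mul1 : left_id sf_one sf_mul.
Proof. by move=> f; apply: sfunP => u Uu; rewrite sf_mulE // sf_oneE // mul1r. Qed.
Lemma sf_mulD : left_distributive sf_mul sf_add.
Proof. by move=> f g h; apply: sfunP => u Uu; rewrite !(sf_mulE, sf_addE) // mulrDl. Qed.
(** The point [u0] is carried in the type to make this ring nontrivial. *)
Lemma sf_one_neq0 : sf_one != sf_zero.
Proof.
apply/eqP => /(congr1 (fun f : K => f u0)); rewrite sf_oneE // sf_zeroE //.
by move/eqP; rewrite oner_eq0.
Qed.

HB.instance Definition _ := GRing.Zmodule_isComNzRing.Build K
  sf_mulA sf_mulC sf_mul1 sf_mulD sf_one_neq0.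

Definition sf_der (v : 'rV[R]_m) f : K := mk (smooth_derive v (sfun_smooth f)).

Lemma sf_derE v f u : U u -> sf_der v f u = 'D_v f u. Proof. exact: mkE. Qed.

Lemma near_on (f g : 'rV[R]_m -> R^o) u : U u -> (forall u, U u -> f u = g u) ->
  \near u, f u = g u.
Proof. by move=> Uu fg; apply: filterS (open_near oU Uu) => w; exact: fg. Qed.

Lemma sf_derD v f g : sf_der v (f + g) = sf_der v f + sf_der v g.
Proof.
apply: sfunP => u Uu; rewrite [RHS]sf_addE // !sf_derE //.
have df := smooth_diff (sfun_smooth f) Uu; have dg := smooth_diff (sfun_smooth g) Uu.
rewrite -(deriveD (diff_derivable df) (diff_derivable dg)).
by apply: near_eq_derive; apply: near_on => // w Uw; rewrite [LHS]sf_addE.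
Qed.

Lemma sf_derM v f g : sf_der v (f * g) = sf_der v f * g + f * sf_der v g.
Proof.
apply: sfunP => u Uu; rewrite [RHS]sf_addE // ![X in _ = X + _]sf_mulE // ![X in _ = _ + X]sf_mulE //.
rewrite !sf_derE //.
have df := smooth_diff (sfun_smooth f) Uu; have dg := smooth_diff (sfun_smooth g) Uu.
rewrite -(derive_mul v df dg).
by apply: near_eq_derive; apply: near_on => // w Uw; rewrite [LHS]sf_mulE.
Qed.

Lemma sf_derC v w f : sf_der v (sf_der w f) = sf_der w (sf_der v f).
Proof.
apply: sfunP => u Uu.
have e (a b : 'rV[R]_m) : sf_der a (sf_der b f) u = 'D_a (fun z => 'D_b f z) u.
  apply: (etrans (sf_derE a (sf_der b f) Uu)).
  by apply: near_eq_derive; apply: near_on => // z Uz; exact: sf_derE.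
apply: (etrans (e v w)); apply: esym; apply: (etrans (e w v)).
exact: (clairaut v w oU (sfun_smooth f) Uu).
Qed.

Section Eval.
Variables (u : 'rV[R]_m) (Uu : U u).
Definition sf_eval (f : K) : R := f u.
Lemma sf_eval_additive : zmod_morphism sf_eval.
Proof.
move=> f g; rewrite /sf_eval -[f - g]/(sf_add f (sf_opp g)).
by rewrite sf_addE // sf_oppE.
Qed.
Lemma sf_eval_multiplicative : monoid_morphism sf_eval.
Proof.
split; first by rewrite /sf_eval; exact: sf_oneE.
by move=> f g; rewrite /sf_eval; exact: sf_mulE.
Qed.
End Eval.
End SFun.

Definition eval_at (R : realType) (m : nat) (U : set 'rV[R]_m) (oU : open U)
  (u0 : 'rV[R]_m) (Uu0 : U u0) (u : 'rV[R]_m) of U u : sfun oU Uu0 -> R := sf_eval u.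
Arguments eval_at {R m U} oU {u0} Uu0 {u} Uu f : simpl never.
Arguments sf_der : simpl never.
Arguments mk : simpl never.

HB.instance Definition _ (R : realType) (m : nat) (U : set 'rV[R]_m) (oU : open U)
  (u0 : 'rV[R]_m) (Uu0 : U u0) (u : 'rV[R]_m) (Uu : U u) :=
  GRing.isZmodMorphism.Build _ _ (eval_at oU Uu0 Uu) (sf_eval_additive Uu).
HB.instance Definition _ (R : realType) (m : nat) (U : set 'rV[R]_m) (oU : open U)
  (u0 : 'rV[R]_m) (Uu0 : U u0) (u : 'rV[R]_m) (Uu : U u) :=
  GRing.isMonoidMorphism.Build _ _ (eval_at oU Uu0 Uu) (sf_eval_multiplicative Uu).

Section Delete.
Context {V : Type} {K : comNzRingType} (D : V -> K -> K).

Definition delete T i (s : seq T) := take i s ++ drop i.+1 s.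

Lemma sdiffE (x0 : V) (a : shuffle V K) s :
  sdiff D a s = \sum_(i < size s) (-1) ^+ i * D (nth x0 s i) (a (delete i s)).
Proof.
rewrite /sdiff; elim: s a => [|v s IH] a /=; first by rewrite big_ord0.
rewrite big_ord_recl expr0 mul1r /delete /= drop0 IH -sumrN; congr (_ + _).
by apply: eq_bigr => i _; rewrite /= exprS mulN1r mulNr.
Qed.
End Delete.

Section Forms.
Context {R : realType} {m : nat} {M : manifold R m}.
Local Notation V := 'rV[R]_m.
Implicit Types (c : @chart R m M) (x y : M) (u v w : V).

Definition lform := M -> shuffle V R.
Implicit Types (a b : lform).

Definition pull c u : shuffle V R -> shuffle V R :=
  smap idfun (fun v => v *m dchart_inv c (cinv c u)).

HB.instance Definition _ c u := GRing.RMorphism.on (pull c u).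

Definition lrep c a u s : R^o := pull c u (a (cinv c u)) s.

Record lsmooth a : Prop := LSmooth {
  lsmooth_lin : forall x, multilin (a x);
  lsmooth_alt : forall x, altern (a x);
  lsmooth_rep : forall x s, smooth_on (cimg (chart_at x)) (fun u => lrep (chart_at x) a u s) }.

Definition dl a : lform := fun x s =>
  \sum_(i < size s) (-1) ^+ i *
    'D_(nth 0 s i) (fun u => lrep (chart_at x) a u (delete i s)) (chart_at x x).

Section Represents.
Variables (U : set V) (oU : open U) (u0 : V) (Uu0 : U u0).
Local Notation K := (sfun oU Uu0).

Definition evU u (Uu : U u) : shuffle V K -> shuffle V R :=
  smap (eval_at oU Uu0 Uu) id.
HB.instance Definition _ u (Uu : U u) := GRing.RMorphism.on (evU Uu).

(** [ahat] is the coordinate expression of a over U, with coefficients in the ring of smooth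
    functions on U. Identities are proved for such expressions by algebra and brought to points by
    the ring morphisms [evU] and [pull]. *)
Definition represents c (ahat : shuffle V K) a :=
  forall u (Uu : U u), evU Uu ahat = pull c u (a (cinv c u)).

Lemma represents_smooth c ahat a s : represents c ahat a ->
  smooth_on U (fun u => lrep c a u s).
Proof.
move=> H; apply: (@smooth_eq _ _ _ _ (ahat s)) => //; last exact: sfun_smooth.
move=> u Uu; have := congr1 (fun f => f s) (H u Uu).
by rewrite /evU /smap map_id.
Qed.

Lemma represents_exists c a :
  (forall s, smooth_on U (fun u => lrep c a u s)) -> exists ahat, represents c ahat a.
Proof.
move=> H; exists (fun s => mk (H s)) => u Uu; apply/shufP => s.
by rewrite {1}/evU {1}/smap map_id; exact: mkE.
Qed.

(** [dl] at x differentiates in the chart attached to x, as [sdiff] does with the derivations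
    [sf_der]; at the centre of that chart no change of frame remains. *)
Lemma represents_dl x ahat a (Ux : U (chart_at x x)) : represents (chart_at x) ahat a ->
  dl a x = evU Ux (sdiff (fun v => sf_der v) ahat).
Proof.
move=> H; apply/shufP => s; rewrite /evU /smap map_id (sdiffE _ 0) rmorph_sum.
apply: eq_bigr => i _; rewrite rmorphM rmorphXn rmorphN1; congr (_ * _).
apply: esym; apply: (etrans (sf_derE _ _ Ux)); apply: near_eq_derive.
apply: filterS (open_near oU Ux) => u Uu.
have := congr1 (fun f => f (delete i s)) (H u Uu).
by rewrite /evU {1}/smap map_id => e; exact: e.
Qed.
End Represents.
Arguments represents {U} oU {u0} Uu0 c ahat a.
Arguments evU {U oU u0 Uu0 u} Uu _.

Lemma pull_id x : pull (chart_at x) (chart_at x x) =1 id.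
Proof.
move=> f; apply/shufP => s; rewrite /pull /smap /= chartK; first last.
- exact: mem_chart_at.
- exact: chart_atP.
rewrite dchart_inv_at; congr f; rewrite -[RHS]map_id; apply: eq_map => v.
exact: mulmx1.
Qed.

Lemma cimg_at x : cimg (chart_at x) (chart_at x x).
Proof. by apply: cimg_chart; exact: mem_chart_at. Qed.

Lemma ocimg x : open (cimg (chart_at x)).
Proof. by apply: cimg_open; exact: chart_atP. Qed.
Arguments ocimg x : clear implicits.

Definition lmul a b : lform := fun x => a x * b x.
Definition ladd a b : lform := fun x => a x + b x.
Definition lcst (k : R) : lform := fun=> (fun s => if s is [::] then k else 0).

Lemma hat_exists x a : lsmooth a -> exists ahat,
  represents (ocimg x) (cimg_at x) (chart_at x) ahat a.
Proof. by move=> sa; apply: represents_exists => s; exact: lsmooth_rep. Qed.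

Lemma dlM x a b : lsmooth a -> lsmooth b ->
  dl (lmul a b) x = dl a x * b x + sbar (a x) * dl b x.
Proof.
move=> sa sb; have [ah Ha] := hat_exists x sa; have [bh Hb] := hat_exists x sb.
have Hab : represents (ocimg x) (cimg_at x) (chart_at x) (ah * bh) (lmul a b).
  by move=> u Uu; rewrite !rmorphM /= Ha Hb.
have ex := Ha _ (cimg_at x); have exb := Hb _ (cimg_at x).
rewrite pull_id chartK in ex; [|exact: chart_atP|exact: mem_chart_at].
rewrite pull_id chartK in exb; [|exact: chart_atP|exact: mem_chart_at].
rewrite (represents_dl (cimg_at x) Hab) (represents_dl (cimg_at x) Ha).
rewrite (represents_dl (cimg_at x) Hb) (sdiffM (@sf_derD _ _ _ _ _ _) (@sf_derM _ _ _ _ _ _)).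
rewrite rmorphD !rmorphM /= exb; congr (_ + _ * _).
rewrite -ex; apply/shufP => s; rewrite /evU /smap /sbar size_map map_id.
by rewrite rmorphM rmorphXn rmorphN1.
Qed.

Lemma dlD x a b : lsmooth a -> lsmooth b -> dl (ladd a b) x = dl a x + dl b x.
Proof.
move=> sa sb; have [ah Ha] := hat_exists x sa; have [bh Hb] := hat_exists x sb.
have Hab : represents (ocimg x) (cimg_at x) (chart_at x) (ah + bh) (ladd a b).
  by move=> u Uu; rewrite !rmorphD /= Ha Hb.
rewrite (represents_dl (cimg_at x) Hab) (represents_dl (cimg_at x) Ha).
by rewrite (represents_dl (cimg_at x) Hb) (sdiffD (@sf_derD _ _ _ _ _ _)) rmorphD.
Qed.

Lemma lsmoothM a b : lsmooth a -> lsmooth b -> lsmooth (lmul a b).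
Proof.
move=> sa sb; split=> [x|x|x s].
- by apply: multilinM; exact: lsmooth_lin.
- by apply: alternM; exact: lsmooth_alt.
have [ah Ha] := hat_exists x sa; have [bh Hb] := hat_exists x sb.
apply: (@represents_smooth _ (ocimg x) _ (cimg_at x) _ (ah * bh)) => u Uu.
by rewrite !rmorphM /= Ha Hb.
Qed.

Lemma alternD (a b : shuffle V R) : altern a -> altern b -> altern (a + b).
Proof. by move=> Ha Hb s1 v s2; rewrite shuffleE Ha Hb addr0. Qed.

Lemma lsmoothD a b : lsmooth a -> lsmooth b -> lsmooth (ladd a b).
Proof.
move=> sa sb; split=> [x|x|x s].
- by apply: multilin_shufD; exact: lsmooth_lin.
- by apply: alternD; exact: lsmooth_alt.
have [ah Ha] := hat_exists x sa; have [bh Hb] := hat_exists x sb.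
apply: (@represents_smooth _ (ocimg x) _ (cimg_at x) _ (ah + bh)) => u Uu.
by rewrite !rmorphD /= Ha Hb.
Qed.

Lemma lsmooth_cst k : lsmooth (lcst k).
Proof.
split=> [x|x|x s].
- by move=> [|v1 s1] c v w s2 /=; rewrite mulr0 addr0.
- by move=> [|v1 s1].
rewrite /lrep /pull /smap /=; case: s => [|v s] /=; exact: smooth_cst.
Qed.

Lemma dl_cst k x : dl (lcst k) x = 0.
Proof.
apply/shufP => s; apply: big1 => i _.
rewrite [X in _ * X](_ : _ = 0) ?mulr0 //.
rewrite /lrep /pull /smap /=; case: (delete i s) => [|v s'] /=; exact: derive_cst.
Qed.

Lemma lcstM k (f : shuffle V R) x s : (lcst k x * f) s = k * f s.
Proof.
elim: s f => [|v s IH] f; first by rewrite shuffle_nil.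
rewrite shuffle_cons.
have -> : contract v (lcst k x) = 0 by [].
have -> : sbar (lcst k x) = lcst k x.
  by apply/shufP => -[|w t]; rewrite /sbar /= ?mul1r ?mulr0.
by rewrite mul0r shuffleE add0r IH.
Qed.

End Forms.
Arguments ocimg {R m M} x.

Lemma row_row' (R : Type) p q (A : 'M[R]_(p, q)) i k : row k (row' i A) = row (lift i k) A.
Proof. by apply/rowP => j; rewrite !mxE. Qed.

(** * Forms on matrices of rows and forms on lists *)

Section Rows.
Context {R : realType} {m : nat}.
Local Notation V := 'rV[R]_m.
Implicit Types (a b : shuffle V R).

Definition mat p (s : seq V) : 'M[R]_(p, m) := \matrix_(i < p) s`_i.
Definition rows p (A : 'M[R]_(p, m)) : seq V := lst (fun i => row i A).

Lemma size_rows p (A : 'M[R]_(p, m)) : size (rows A) = p.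
Proof. exact: size_lst. Qed.

Lemma row_mat p s (i : 'I_p) : row i (mat p s) = s`_i.
Proof. by rewrite rowK. Qed.

Lemma matK p (A : 'M[R]_(p, m)) : mat p (rows A) = A.
Proof. by apply/row_matrixP => i; rewrite row_mat nth_lst. Qed.

Lemma rowsK p s : size s = p -> rows (mat p s) = s.
Proof.
move=> sp; apply: (@eq_from_nth _ 0); first by rewrite size_rows.
move=> i; rewrite size_rows => ip; have := nth_lst 0 (fun j => row j (mat p s)) (Ordinal ip).
by rewrite row_mat.
Qed.

Lemma rows_split p (A : 'M[R]_(p, m)) (i : 'I_p) :
  rows A = take i (rows A) ++ row i A :: drop i.+1 (rows A).
Proof.
rewrite -[LHS](cat_take_drop i); congr (_ ++ _).
by rewrite (drop_nth 0) ?size_rows // nth_lst.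
Qed.

Lemma row'_rows p (A B : 'M[R]_(p, m)) (i : 'I_p) : row' i A = row' i B ->
  take i (rows A) = take i (rows B) /\ drop i.+1 (rows A) = drop i.+1 (rows B).
Proof.
move=> e; have AB (j : 'I_p) : j != i -> row j A = row j B.
  move=> ji; have [k -> |//] := unliftP i j.
    by have := congr1 (row k) e; rewrite !row_row'.
  by move=> ei; rewrite ei eqxx in ji.
have nthE (j : nat) (jp : (j < p)%N) : j != i ->
    nth 0 (rows A) j = nth 0 (rows B) j.
  move=> ji; have := nth_lst 0 (fun k => row k A) (Ordinal jp).
  have := nth_lst 0 (fun k => row k B) (Ordinal jp).
  by rewrite /rows => /= -> ->; apply: AB.
have ip := ltn_ord i.
split; apply: (@eq_from_nth _ 0); rewrite ?size_drop ?size_takel ?size_rows // 1?ltnW //.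
- move=> j ji; rewrite !nth_take // nthE //; last by rewrite ltn_eqF.
  exact: ltn_trans ip.
- move=> j; rewrite ltn_subRL => jp; rewrite !nth_drop nthE //.
  by rewrite gtn_eqF // leq_addr.
Qed.

Lemma multilin0 a s1 s2 : multilin a -> a (s1 ++ 0 :: s2) = 0.
Proof.
move=> la; have := la s1 1 0 0 s2; rewrite scaler0 addr0 mul1r.
by move/eqP; rewrite -subr_eq subrr eq_sym => /eqP.
Qed.

Lemma multilinZD a s1 (c d : R) v w s2 : multilin a ->
  a (s1 ++ (c *: v + d *: w) :: s2) = c * a (s1 ++ v :: s2) + d * a (s1 ++ w :: s2).
Proof.
move=> la; rewrite la; congr (_ + _).
by have := la s1 d w 0 s2; rewrite addr0 (multilin0 _ _ la) addr0.
Qed.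

Lemma antisym_of a : multilin a -> altern a -> antisym a.
Proof.
move=> la aa s1 v w s2.
have l1 t : a (s1 ++ (1 *: v + w) :: t :: s2) =
    a (s1 ++ v :: t :: s2) + a (s1 ++ w :: t :: s2) by rewrite la mul1r.
have l2 t : a (s1 ++ t :: (1 *: v + w) :: s2) =
    a (s1 ++ t :: v :: s2) + a (s1 ++ t :: w :: s2).
  by have := la (rcons s1 t) 1 v w s2; rewrite !cat_rcons mul1r.
have := aa s1 (1 *: v + w) s2; rewrite l1 !l2 !aa add0r addr0.
by move/eqP; rewrite addr_eq0 => /eqP.
Qed.

Lemma altern_far a s1 v s2 s3 : antisym a -> altern a ->
  a (s1 ++ v :: s2 ++ v :: s3) = 0.
Proof.
move=> ya aa; elim/last_ind: s2 s3 => [|s2 w IH] s3; first exact: aa.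
have e := ya (s1 ++ v :: s2) w v s3; rewrite -!catA /= in e.
by rewrite cat_rcons e IH oppr0.
Qed.
End Rows.

Section FormsOfMatrices.
Context {R : realType} {m : nat} {M : manifold R m}.
Local Notation V := 'rV[R]_m.
Implicit Types (x : M) (a b : lform (M := M)).

(** Extension by zero to the other degrees lets forms of all degrees live in one ring. *)
Definition lf p (w : dform M p) : lform (M := M) :=
  fun x s => if size s == p then w x (mat p s) else 0.
Definition fl p a : dform M p := fun x A => a x (rows A).
Arguments fl p a : clear implicits.

Lemma fl_lf p (w : dform M p) : fl p (lf w) = w.
Proof.
by apply/funext => x; apply/funext => A; rewrite /fl /lf size_rows eqxx matK.
Qed.

Lemma lf_homog p (w : dform M p) x : homog p (lf w x).
Proof. by move=> s; rewrite /lf => /negbTE->. Qed.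

Lemma lf_multilin p (w : dform M p) x : multilinear (w x) -> multilin (lf w x).
Proof.
move=> lw s1 c v u s2; rewrite /lf !size_cat /=.
case: ifP => // [sp|_]; last by rewrite mulr0 addr0.
have ip : (size s1 < p)%N by rewrite -(eqP sp) addnS ltnS leq_addr.
pose i := Ordinal ip.
have nth_i (t : V) : (s1 ++ t :: s2)`_i = t by rewrite nth_cat ltnn subnn.
have nth_j (t t' : V) (j : 'I_p) : j != i -> (s1 ++ t :: s2)`_j = (s1 ++ t' :: s2)`_j.
  move=> ji; rewrite !nth_cat; case: ltnP => // sj.
  case ej : (j - size s1)%N => [|k //]; case/eqP: ji; apply/val_inj => /=.
  by apply/eqP; rewrite eqn_leq sj -subn_eq0 ej.
rewrite (lw i _ (mat p (s1 ++ v :: s2)) (mat p (s1 ++ u :: s2)) c 1) ?mul1r //.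
- by rewrite !row_mat !nth_i scale1r.
- by apply/row_matrixP => k; rewrite !row_row' !row_mat; apply: nth_j; rewrite eq_sym neq_lift.
- by apply/row_matrixP => k; rewrite !row_row' !row_mat; apply: nth_j; rewrite eq_sym neq_lift.
Qed.

Lemma lf_altern p (w : dform M p) x : alternating_form (w x) -> altern (lf w x).
Proof.
move=> aw s1 v s2; rewrite /lf size_cat /=; case: ifP => // sp.
have jp : ((size s1).+1 < p)%N by rewrite -(eqP sp) !addnS !ltnS leq_addr.
have ip : (size s1 < p)%N by exact: ltnW.
apply: (aw (Ordinal ip) (Ordinal jp)); first by rewrite -val_eqE /= ltn_eqF.
by rewrite !row_mat /= !nth_cat ltnn subnn ltnNge leqnSn /= subSnn.
Qed.

Lemma mat_mulmx p s (B : 'M[R]_m) : size s = p ->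
  mat p [seq v *m B | v <- s] = mat p s *m B.
Proof.
move=> sp; apply/row_matrixP => i; rewrite row_mul !row_mat (nth_map 0) //.
by rewrite sp.
Qed.

Lemma rows_mulmx p (A : 'M[R]_(p, m)) (B : 'M[R]_m) :
  rows (A *m B) = [seq v *m B | v <- rows A].
Proof.
have sz : size [seq v *m B | v <- rows A] = p by rewrite size_map size_rows.
by rewrite -[RHS](rowsK sz) mat_mulmx ?matK ?size_rows.
Qed.

Lemma lrep_lf p (w : dform M p) x s u :
  lrep (chart_at x) (lf w) u s = if size s == p then form_rep x w (mat p s) u else 0.
Proof.
rewrite /lrep /pull /smap /lf /= size_map; case: eqVneq => // sp.
by rewrite mat_mulmx.
Qed.

Lemma lf_smooth p (w : dform M p) : smooth_form w -> lsmooth (lf w).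
Proof.
move=> [lw aw sw]; split=> [x|x|x s].
- exact: lf_multilin.
- exact: lf_altern.
under eq_fun do rewrite lrep_lf.
by case: (size s == p); [exact: sw|exact: smooth_cst].
Qed.

Lemma fl_smooth p a : lsmooth a -> smooth_form (fl p a).
Proof.
move=> [la aa sa]; split=> [x|x|x A].
- move=> i A B C b c e eB eC; rewrite /fl.
  have [tB dB] := row'_rows eB; have [tC dC] := row'_rows eC.
  rewrite (rows_split A i) (rows_split B i) (rows_split C i) tB dB tC dC e.
  exact: multilinZD.
- move=> i j A; wlog ij : i j / (i < j)%N => [H|_ e].
    have [ij|ji|/val_inj->] := ltngtP i j; last by rewrite eqxx.
      exact: H.
    by rewrite eq_sym => ? e; apply: (H j i).
  rewrite /fl (rows_split A i) -(cat_take_drop (j - i.+1) (drop i.+1 (rows A))).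
  have jn : (j - i.+1 < size (drop i.+1 (rows A)))%N.
    by rewrite size_drop size_rows ltn_sub2r // (leq_ltn_trans ij).
  rewrite (drop_nth 0 jn) nth_drop subnKC // nth_lst -e.
  by apply: altern_far => //; exact: antisym_of.
- have := sa x (rows A); apply: smooth_eq; first exact: ocimg.
  by move=> u zu; rewrite /lrep /pull /smap /form_rep /fl rows_mulmx.
Qed.

(** The factor 1 / (p! q!) of [wedge] cancels the multiplicity found in [wedge_sumE]. *)
Lemma lf_wedge p q (w : dform M p) (w' : dform M q) x :
  antisym (lf w x) -> antisym (lf w' x) ->
  lf (wedge w w') x = lf w x * lf w' x.
Proof.
move=> aw aw'; apply/shufP => s.
case: (eqVneq (size s) (p + q)%N) => [sp|sp]; last first.
  rewrite {1}/lf (negbTE sp) (shuffle_weight (f := fun=> 0%N)) // => s1 s2 _ ss.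
  have [s1p|s1p] := eqVneq (size s1) p; last by left; exact: lf_homog.
  right; apply: lf_homog; apply: contra sp => /eqP s2q; by rewrite -ss s1p s2q.
rewrite {1}/lf sp eqxx /wedge.
have f0 : (p`!%:R * q`!%:R : R) != 0 by rewrite mulf_neq0 // pnatr_eq0 -lt0n fact_gt0.
apply: (mulfI f0); rewrite mulrA mulfV // mul1r -natrM.
pose v (i : 'I_(p + q)) := row i (mat (p + q) s).
have sv : s = lst v by rewrite -[LHS](rowsK sp).
rewrite [in RHS]sv -(wedge_sumE v erefl (@lf_homog p w x) (@lf_homog q w' x) aw aw').
apply: eq_bigr => t _; congr (_ * _).
have rt : lst (v \o t) = rows (row_perm t (mat (p + q) s)).
  by apply: eq_lst => i /=; rewrite /v; apply/rowP => j; rewrite !mxE.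
have tk (B : 'M[R]_(p + q, m)) : take p (rows B) = rows (usubmx B) /\
    drop p (rows B) = rows (dsubmx B).
  split; apply: (@eq_from_nth _ 0); rewrite ?size_takel ?size_drop ?size_rows ?leq_addr ?addKn //.
    move=> i ip; rewrite nth_take // -[i]/(val (lshift q (Ordinal ip))) nth_lst.
    rewrite -[RHS]/(nth 0 (rows (usubmx B)) (Ordinal ip)) nth_lst.
    by apply/rowP => j; rewrite !mxE.
  move=> i iq; rewrite nth_drop -[(p + i)%N]/(val (rshift p (Ordinal iq))) nth_lst.
  rewrite -[RHS]/(nth 0 (rows (dsubmx B)) (Ordinal iq)) nth_lst.
  by apply/rowP => j; rewrite !mxE.
have [t1 t2] := tk (row_perm t (mat (p + q) s)).
by rewrite rt t1 t2 /lf !size_rows !eqxx !matK.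
Qed.

Lemma lf_ext_d p (w : dform M p) : lf (ext_d w) = dl (lf w).
Proof.
apply/funext => x; apply/shufP => s; rewrite {1}/lf /dl.
have szd (i : 'I_(size s)) : size (delete i s) = (size s).-1.
  by rewrite size_cat size_takel ?size_drop 1?ltnW //; have := ltn_ord i; lia.
case: eqVneq => [sp|sp]; last first.
  rewrite big1 // => i _; have := ltn_ord i => si.
  rewrite [X in _ * X](_ : _ = 0) ?mulr0 //.
  have -> : (fun u => lrep (chart_at x) (lf w) u (delete i s)) = (fun=> 0); last exact: derive_cst.
  by apply/funext => u; rewrite lrep_lf szd; case: eqP => // e; case/eqP: sp; lia.
rewrite /ext_d -(big_mkord xpredT (fun i => (-1) ^+ i *
    'D_(s`_i) (fun u => lrep (chart_at x) (lf w) u (delete i s)) (chart_at x x))) sp big_mkord.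
apply: eq_bigr => i _; have si : (i < size s)%N by rewrite sp.
have e : form_rep x w (row' i (mat p.+1 s)) =
    (fun u => lrep (chart_at x) (lf w) u (delete i s)).
  apply/funext => u; rewrite lrep_lf (szd (Ordinal si)) sp eqxx; congr form_rep.
  apply/matrixP => k j; rewrite !mxE /delete nth_cat.
  rewrite size_takel ?(ltnW si) //= /bump; case: (ltnP k i) => ki.
    by rewrite add0n nth_take.
  by rewrite nth_drop add1n addSn subnKC.
by rewrite e (row_mat s i).
Qed.
End FormsOfMatrices.
Arguments fl {R m M} p a.

(** * Connections flat along a foliation *)

Lemma derive_dirP (R : realType) (V : normedModType R) (f : V -> R^o) u (k : R) v w :
  differentiable f u -> 'D_(k *: v + w) f u = k * 'D_v f u + 'D_w f u.
Proof. by move=> df; rewrite !deriveE // linearP. Qed.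

Section FlatConnection.
Context {R : realType} {m : nat} {M : manifold R m}.
Local Notation V := 'rV[R]_m.
Local Notation Jt := (@transition_jacobian R m M).
Implicit Types (x y z : M) (u v w : V) (X Y Z : vfield M).
Variables (r : nat) (L PQ : tdistribution M) (fol : M -> @chart R m M).
Hypothesis folP : forall x, smooth_chart (fol x) /\ cdom (fol x) x.
Hypothesis folL : forall x y, cdom (fol x) y ->
  (L y *m dchart (fol x) y == (pid_mx r : 'M[R]_m))%MS.
Hypothesis PQ_smooth : forall X, smooth_field X -> smooth_field (fun y => X y *m PQ y).
Hypothesis PQ_L : forall y v, (v - v *m PQ y <= L y)%MS.
Hypothesis PQ_L0 : forall y v, (v <= L y)%MS -> v *m PQ y = 0.
Variable phi : M -> V -> 'M[R]_m.
Hypothesis phi_smooth : forall x, msmooth (cimg (fol x)) (phi x).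
Hypothesis phi_unit : forall x u, cimg (fol x) u -> phi x u \in unitmx.
Hypothesis phi_tr : forall x x', exists G : V -> 'M[R]_m,
  msmooth (overlap (fol x) (fol x')) G /\
  forall u, overlap (fol x) (fol x') u ->
   Jt (fol x) (fol x') (cinv (fol x) u) *m phi x' (tr (fol x) (fol x') u) = phi x u *m G u /\
   forall v i j, (v <= (pid_mx r : 'M[R]_m))%MS -> 'D_v (fun u => G u i j : R^o) u = 0.

Definition leaf_part X : vfield M := fun y => X y - X y *m PQ y.

Lemma leaf_part_smooth X : smooth_field X -> smooth_field (leaf_part X).
Proof.
move=> sX; have -> : leaf_part X = (fun y => (-1 : R) *: (X y *m PQ y) + X y).
  by apply/funext => y; rewrite scaleN1r addrC.
by apply: smooth_field_comb => //; [exact: smooth_fun_cst|exact: PQ_smooth].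
Qed.

Lemma leaf_part_dir x X u : cimg (fol x) u ->
  (frep (fol x) (leaf_part X) u <= (pid_mx r : 'M[R]_m))%MS.
Proof.
move=> cu; have [sc _] := folP x; have [ic _] := sc; have cy := cinv_dom ic cu.
rewrite frepE -(eqmxP (folL cy)); exact: submxMr (PQ_L _ _).
Qed.

Definition flat_coord x Z u : V := frep (fol x) Z u *m phi x u.

Lemma flat_coord_smooth x Z l : smooth_field Z ->
  smooth_on (cimg (fol x)) (fun u => flat_coord x Z u 0 l : R^o).
Proof.
move=> sZ; have [sc _] := folP x; have [ic _] := sc; have oc := cimg_open ic.
suff H : msmooth (cimg (fol x)) (flat_coord x Z) by exact: H.
by apply: (msmoothM oc); [apply/(msmooth_row _ oc); exact: smooth_frep|exact: phi_smooth].
Qed.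

Lemma flat_coord_diff x Z l u : smooth_field Z -> cimg (fol x) u ->
  differentiable (fun u => flat_coord x Z u 0 l : R^o) u.
Proof. by move=> sZ; apply: smooth_diff; exact: flat_coord_smooth. Qed.

Definition leaf_deriv x X Z u : V :=
  \row_l 'D_(frep (fol x) (leaf_part X) u) (fun u => flat_coord x Z u 0 l : R^o) u.

(** The derivative along the leaf part of X for which fields with constant flat coordinates are
    parallel. *)
Definition leaf_nabla x X Z : vfield M := fun y =>
  leaf_deriv x X Z (fol x y) *m invmx (phi x (fol x y)) *m dchart_inv (fol x) y.

(** Flat coordinates in two charts differ by right multiplication by G, and G has zero derivative
    along the leaf part of X, so the product rule leaves only the change of frame. *)
Lemma leaf_nabla_indep x x' X Z y : smooth_field X -> smooth_field Z ->
  cdom (fol x) y -> cdom (fol x') y -> leaf_nabla x X Z y = leaf_nabla x' X Z y.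
Proof.
move=> sX sZ cy c'y; have [G [sG HG]] := phi_tr x x'.
have [sc _] := folP x; have [ic _] := sc; have [sc' _] := folP x'; have [ic' _] := sc'.
have oO := overlap_open ic ic'; have Ou := overlap_chart ic cy c'y.
have cu := cimg_chart cy; have yK := chartK ic cy.
set c := fol x in sc ic oO Ou cy cu yK HG sG *; set c' := fol x' in sc' ic' oO Ou c'y HG sG *.
have [GE G0] := HG _ Ou; rewrite yK in GE.
have trE : tr c c' (c y) = c' y by rewrite /tr /= yK.
rewrite trE in GE.
have HD : leaf_deriv x' X Z (c' y) = leaf_deriv x X Z (c y) *m G (c y).
  apply/rowP => l; rewrite !mxE.
  have df k : differentiable (fun u => flat_coord x Z u 0 k : R^o) (c y) by exact: flat_coord_diff.
  have dG k j : differentiable (fun u => G u k j : R^o) (c y) by exact: smooth_diff (sG k j) Ou.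
  have e : \forall u \near c y, \sum_k flat_coord x Z u 0 k * G u k l =
      ((fun u => flat_coord x' Z u 0 l : R^o) \o tr c c') u.
    apply: filterS (open_near oO Ou) => u Ouu.
    have [GEu _] := HG _ Ouu.
    have -> : ((fun u => flat_coord x' Z u 0 l : R^o) \o tr c c') u =
       (frep c Z u *m phi x u *m G u) 0 l.
      by rewrite -[in RHS]mulmxA -GEu mulmxA -(frep_tr Z sc sc' Ouu).
    by rewrite [RHS]mxE.
  have d' : differentiable (fun u => flat_coord x' Z u 0 l : R^o) (tr c c' (c y)).
    by rewrite trE; apply: flat_coord_diff => //; exact: cimg_chart.
  have dtr := diff_tr sc sc' cy c'y.
  set xi := frep c (leaf_part X) (c y).
  have -> : frep (fol x') (leaf_part X) (c' y) = 'D_xi (tr c c') (c y).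
    rewrite -(mul_Jt xi sc sc' cy c'y) -/c' -trE.
    by rewrite (frep_tr (leaf_part X) sc sc' Ou) yK.
  rewrite -trE -(derive_comp xi dtr d') -(near_eq_derive _ e).
  have [-> _] := derive_sum_fun (F := fun k u => flat_coord x Z u 0 k * G u k l : R^o)
     (index_enum 'I_m) xi (fun k => differentiableM (df k) (dG k l)).
  apply: eq_bigr => k _; rewrite !mxE -/c -/xi.
  rewrite (derive_mul xi (df k) (dG k l)) G0 ?mulr0 ?addr0 //.
  exact: leaf_part_dir.
have GJ : G (c y) *m invmx (phi x' (c' y)) = invmx (phi x (c y)) *m Jt c c' y.
  have u1 := phi_unit cu; have u2 := phi_unit (cimg_chart c'y).
  have e2 : Jt c c' y = phi x (c y) *m G (c y) *m invmx (phi x' (c' y)).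
    by rewrite -GE mulmxK.
  by rewrite e2 -mulmxA mulKmx.
have JD : Jt c c' y *m dchart_inv c' y = dchart_inv c y.
  rewrite !dchart_invE; apply: Jt_mul => //; [exact: smooth_chart_at|exact: mem_chart_at].
rewrite /leaf_nabla -/c -/c' HD -[X in X *m dchart_inv c' y]mulmxA GJ.
by rewrite mulmxA -[RHS]mulmxA JD.
Qed.

Definition leaf_connection X Z : vfield M := fun y => leaf_nabla y X Z y.

Lemma leaf_connectionE x X Z y : smooth_field X -> smooth_field Z -> cdom (fol x) y ->
  leaf_connection X Z y = leaf_nabla x X Z y.
Proof. by move=> sX sZ cy; apply: leaf_nabla_indep => //; have [] := folP y. Qed.

Lemma leaf_connection_smooth X Z : smooth_field X -> smooth_field Z ->
  smooth_field (leaf_connection X Z).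
Proof.
move=> sX sZ; apply: smooth_field_local => x; have [sc cx] := folP x.
have [ic _] := sc; have oc := cimg_open ic.
exists (fol x), (cimg (fol x)); split=> //; first exact: cimg_chart.
have e u : cimg (fol x) u -> leaf_deriv x X Z u *m invmx (phi x u) =
    frep (fol x) (leaf_connection X Z) u.
  move=> cu; have cy := cinv_dom ic cu; rewrite frepE (leaf_connectionE sX sZ cy).
  rewrite /leaf_nabla (cinvK ic cu) -[RHS]mulmxA dchart_invK //.
  by move: (_ *m invmx _) => B; rewrite mulmx1.
apply: (smooth_eq oc e); apply/(msmooth_row _ oc); apply: (msmoothM oc); last first.
  by apply: (msmooth_inv oc) => //; exact: phi_unit.
move=> i j; rewrite (ord1 i).
apply: (smooth_eq oc (f := fun u => 'D_(frep (fol x) (leaf_part X) u)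
    (fun u => flat_coord x Z u 0 j : R^o) u)) => [u _|]; first by rewrite mxE.
apply: smooth_dir => //; last exact: flat_coord_smooth.
by apply: smooth_frep => //; exact: leaf_part_smooth.
Qed.

Lemma leaf_connection_linear f X X' Z x : smooth_field Z ->
  leaf_connection (fun y => f y *: X y + X' y) Z x =
  f x *: leaf_connection X Z x + leaf_connection X' Z x.
Proof.
move=> sZ; have [sc cx] := folP x; have [ic _] := sc; have cu := cimg_chart cx.
rewrite /leaf_connection /leaf_nabla.
have -> : leaf_deriv x (fun y => f y *: X y + X' y) Z (fol x x) =
    f x *: leaf_deriv x X Z (fol x x) + leaf_deriv x X' Z (fol x x).
  apply/rowP => l; rewrite !mxE.
  have -> : frep (fol x) (leaf_part (fun y => f y *: X y + X' y)) (fol x x) =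
     f x *: frep (fol x) (leaf_part X) (fol x x) + frep (fol x) (leaf_part X') (fol x x).
    rewrite !frepE chartK // /leaf_part scalemxAl -mulmxDl; congr (_ *m _).
    by rewrite mulmxDl -scalemxAl opprD scalerBr addrACA.
  by rewrite derive_dirP //; exact: flat_coord_diff.
by rewrite !mulmxDl -!scalemxAl.
Qed.

Lemma leaf_connection_add X Z Z' x : smooth_field Z -> smooth_field Z' ->
  leaf_connection X (fun y => Z y + Z' y) x = leaf_connection X Z x + leaf_connection X Z' x.
Proof.
move=> sZ sZ'; have [sc cx] := folP x; have [ic _] := sc; have cu := cimg_chart cx.
rewrite /leaf_connection /leaf_nabla.
have -> : leaf_deriv x X (fun y => Z y + Z' y) (fol x x) =
    leaf_deriv x X Z (fol x x) + leaf_deriv x X Z' (fol x x).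
  apply/rowP => l; rewrite !mxE.
  have d1 := flat_coord_diff l sZ cu; have d2 := flat_coord_diff l sZ' cu.
  rewrite -(deriveD (diff_derivable d1) (diff_derivable d2)).
  apply: (congr1 (fun f : V -> R^o => 'D_(frep (fol x) (leaf_part X) (fol x x)) f (fol x x))).
  by apply/funext => u; rewrite [RHS]/GRing.add /= /flat_coord !frepE !mulmxDl mxE.
by rewrite !mulmxDl.
Qed.

Lemma leaf_connection_leibniz f X Z x : smooth_fun f -> smooth_field Z ->
  leaf_connection X (fun y => f y *: Z y) x =
  vact (leaf_part X) f x *: Z x + f x *: leaf_connection X Z x.
Proof.
move=> sf sZ; have [sc cx] := folP x; have [ic _] := sc; have cu := cimg_chart cx.
have df : differentiable (f \o cinv (fol x) : V -> R^o) (fol x x).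
  by apply: smooth_diff cu; exact: smooth_fun_rep.
rewrite /leaf_connection /leaf_nabla.
have -> : leaf_deriv x X (fun y => f y *: Z y) (fol x x) =
    vact (leaf_part X) f x *: flat_coord x Z (fol x x) + f x *: leaf_deriv x X Z (fol x x).
  apply/rowP => l; rewrite mxE [RHS]mxE [X in _ = X + _]mxE [X in _ = _ + X]mxE [X in _ = _ + _ * X]mxE.
  have d1 := flat_coord_diff l sZ cu.
  rewrite (vactE (leaf_part X) sc cx df).
  have e : f x = (f \o cinv (fol x)) (fol x x) by rewrite /= chartK.
  rewrite [in RHS]e; apply: (etrans _ (derive_mul _ df d1)).
  apply: (congr1 (fun f : V -> R^o => 'D_(frep (fol x) (leaf_part X) (fol x x)) f (fol x x))).
  by apply/funext => u; rewrite /flat_coord !frepE -!scalemxAl mxE.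
rewrite !mulmxDl -!scalemxAl; congr (_ *: _ + _).
rewrite /flat_coord mulmxK; last exact: phi_unit.
by rewrite -(fieldE Z sc cx).
Qed.

Variable nabla : vfield M -> vfield M -> vfield M.
Hypothesis cn : is_connection nabla.

Definition flat_nabla X Z : vfield M := fun y =>
  nabla (fun y => X y *m PQ y) Z y + leaf_connection X Z y.

(** The two summands obey the Leibniz rule with the derivatives along the Q part and the leaf part
    of X, which add up to the derivative along X. *)
Lemma flat_nabla_connection : is_connection flat_nabla.
Proof.
split=> [X Z sX sZ|f X X' Z sf sX sX' sZ x|X Z Z' sX sZ sZ' x|f X Z sf sX sZ x].
- have -> : flat_nabla X Z = fun y => (1 : R) *: nabla (fun y => X y *m PQ y) Z y +
     leaf_connection X Z y by apply/funext => y; rewrite scale1r.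
  apply: smooth_field_comb; [exact: smooth_fun_cst| |exact: leaf_connection_smooth].
  by apply: (nabla_smooth cn) => //; exact: PQ_smooth.
- rewrite /flat_nabla leaf_connection_linear //.
  have -> : (fun y => (f y *: X y + X' y) *m PQ y) =
      (fun y => f y *: (X y *m PQ y) + X' y *m PQ y).
    by apply/funext => y; rewrite mulmxDl -scalemxAl.
  rewrite (nabla_linear cn sf (PQ_smooth sX) (PQ_smooth sX') sZ) scalerDr.
  by rewrite addrACA.
- rewrite /flat_nabla leaf_connection_add // (nabla_add cn (PQ_smooth sX) sZ sZ').
  by rewrite addrACA.
- rewrite /flat_nabla leaf_connection_leibniz // (nabla_leibniz cn sf (PQ_smooth sX) sZ).
  rewrite addrACA -scalerDl -scalerDr; congr (_ *: _ + _).
  have df : differentiable (fun_rep x f) (chart_at x x).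
    apply: smooth_diff (sf x) _; apply: cimg_chart; exact: mem_chart_at.
  rewrite /vact -['D_(X x *m _) _ _]mul1r -(derive_dirP 1 _ _ df) scale1r /leaf_part.
  by rewrite addrC subrK.
Qed.

Lemma flat_nabla0 X Z x : smooth_field X -> smooth_field Z ->
  (\forall y \near x, (X y <= L y)%MS) -> flat_nabla X Z x = leaf_connection X Z x.
Proof.
move=> sX sZ XL; rewrite /flat_nabla.
have -> : nabla (fun y => X y *m PQ y) Z x = nabla (fun _ => 0) Z x.
  apply: (nabla_locl cn) => //; [exact: PQ_smooth|exact: smooth_field0|].
  by apply: filterS XL => y; exact: PQ_L0.
by rewrite (nabla0l cn) // add0r.
Qed.

(** v and w extend to fields tangent to L with constant chart coordinates, which commute near x, and
    z to a field with constant flat coordinates, which is parallel along the leaves. All three terms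
    of the curvature then vanish at x. *)
Lemma flat_nabla_curvature Omega : is_curvature flat_nabla Omega ->
  forall x v w, (v <= L x)%MS -> (w <= L x)%MS -> Omega x (rows2 v w) = 0.
Proof.
move=> cO x v w vL wL; have [sc cx] := folP x; have [ic _] := sc.
have cu := cimg_chart cx; have oc := cimg_open ic; have xK := chartK ic cx.
have [U [oU Uu Uc HU]] := extend_field sc oc (@subset_refl _ _) cu.
have HX t : (t <= L x)%MS -> exists X, [/\ smooth_field X, X x = t,
    forall u, U u -> frep (fol x) X u = t *m dchart (fol x) x &
    \forall y \near x, (X y <= L y)%MS].
  move=> tL; have [X [sX eX _]] := HU _ (smooth_cst (t *m dchart (fol x) x)).
  exists X; split=> //.
    by rewrite (fieldE X sc cx) eX // -mulmxA dchartK // mulmx1.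
  have : \forall y \near x, cdom (fol x) y /\ U (fol x y).
    apply: filterI; first exact: open_near (cdom_open ic) cx.
    exact: (near_chart ic cx (open_near oU Uu)).
  apply: filterS => y [cy Uy]; rewrite (fieldE X sc cy) eX //.
  have tp : (t *m dchart (fol x) x <= (pid_mx r : 'M[R]_m))%MS.
    by rewrite -(eqmxP (folL cx)); exact: submxMr.
  have : (t *m dchart (fol x) x *m dchart_inv (fol x) y <=
     L y *m dchart (fol x) y *m dchart_inv (fol x) y)%MS.
    by apply: submxMr; rewrite (eqmxP (folL cy)).
  by rewrite -[X in (_ <= X)%MS]mulmxA dchartK // mulmx1.
have [X [sX Xx XU XL]] := HX v vL; have [Y [sY Yx YU YL]] := HX w wL.
have sB := smooth_bracket sX sY.
have B0 : \forall y \near x, bracket X Y y = 0.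
  have := @near_frep _ _ _ (fol x) (bracket X Y) (fun=> 0) U (fol x x) sc oU Uc Uu.
  rewrite xK; apply=> u0 Uu0.
  rewrite (bracketE sc sX sY (Uc _ Uu0)) [RHS]frepE mul0mx.
  have nX : \forall u \near u0, v *m dchart (fol x) x = frep (fol x) X u.
    by apply: filterS (open_near oU Uu0) => u Uu1; rewrite XU.
  have nY : \forall u \near u0, w *m dchart (fol x) x = frep (fol x) Y u.
    by apply: filterS (open_near oU Uu0) => u Uu1; rewrite YU.
  rewrite -(near_eq_derive _ nX) -(near_eq_derive _ nY).
  have dc (t a : V) : 'D_t (fun _ : V => a) u0 = 0 by exact: derive_cst.
  by rewrite !dc subrr.
apply: mulmx_ext => z; rewrite mulmx0.
(* Multiplied by [phi x u] this is constant, equal to the flat coordinates of z at x. *)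
pose g u := z *m dchart (fol x) x *m phi x (fol x x) *m invmx (phi x u).
have sg : smooth_on (cimg (fol x)) g.
  apply/(msmooth_row _ oc); apply: (msmoothM oc); first exact: msmooth_cst.
  by apply: (msmooth_inv oc) => //; exact: phi_unit.
have [Z [sZ ZU _]] := HU g sg.
have Zx : Z x = z.
  rewrite (fieldE Z sc cx) ZU // /g mulmxK; last exact: phi_unit.
  by rewrite -mulmxA dchartK // mulmx1.
have N0 T : smooth_field T -> (\forall y \near x, (T y <= L y)%MS) ->
    \forall y \near x, flat_nabla T Z y = 0.
  move=> sT TL.
  have nU : \forall y \near x, cdom (fol x) y /\ U (fol x y).
    apply: filterI; first exact: open_near (cdom_open ic) cx.
    exact: (near_chart ic cx (open_near oU Uu)).
  near=> y.
  have [cy Uy] : cdom (fol x) y /\ U (fol x y) by near: y.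
  rewrite flat_nabla0 //; last by near: y; exact: near_join.
  rewrite (leaf_connectionE sT sZ cy) /leaf_nabla.
  have -> : leaf_deriv x T Z (fol x y) = 0; last by rewrite !mul0mx.
  apply/rowP => l; rewrite !mxE.
  have nc : \forall u \near fol x y, (z *m dchart (fol x) x *m phi x (fol x x)) 0 l =
      flat_coord x Z u 0 l :> R^o.
    apply: filterS (open_near oU Uy) => u Uu1; rewrite /flat_coord ZU // /g mulmxKV //.
    by apply: phi_unit; exact: Uc.
  by rewrite -(near_eq_derive _ nc) derive_cst.
have cn' := flat_nabla_connection.
have D0 S T : smooth_field S -> smooth_field T -> (\forall y \near x, (T y <= L y)%MS) ->
    flat_nabla S (flat_nabla T Z) x = 0.
  move=> sS sT TL; have -> : flat_nabla S (flat_nabla T Z) x = flat_nabla S (fun=> 0) x.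
    apply: (nabla_locr cn') => //; [exact: (nabla_smooth cn')|exact: smooth_field0|].
    exact: N0.
  by rewrite (nabla0r cn').
have := cO X Y Z sX sY sZ x; rewrite Xx Yx Zx => <-.
rewrite (D0 X Y) // (D0 Y X) // subrr sub0r.
have -> : flat_nabla (bracket X Y) Z x = flat_nabla (fun=> 0) Z x.
  by apply: (nabla_locl cn') => //; exact: smooth_field0.
by rewrite (nabla0l cn') // oppr0.
Unshelve. all: by end_near.
Qed.

Lemma flat_connection_exists : exists nabla' Omega',
  [/\ is_connection nabla', is_curvature nabla' Omega' &
   forall x v w, (v <= L x)%MS -> (w <= L x)%MS -> Omega' x (rows2 v w) = 0].
Proof.
have cn' := flat_nabla_connection; have [ Omega' cO'] := curvature_exists cn'.
by exists flat_nabla, Omega'; split=> //; exact: flat_nabla_curvature.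
Qed.
End FlatConnection.

Lemma row_pid (R : fieldType) m r (i : 'I_m) :
  row i (pid_mx r : 'M[R]_m) = if (i < r)%N then delta_mx 0 i else 0.
Proof.
apply/rowP => j; rewrite !mxE; case: ifP => ir; rewrite !mxE ?andbF // andbT /=.
by rewrite eq_sym.
Qed.

Lemma sub_pid_coord (R : fieldType) m r (v : 'rV[R]_m) (j : 'I_m) :
  (v <= (pid_mx r : 'M[R]_m))%MS -> (r <= j)%N -> v 0 j = 0.
Proof.
case/submxP => D -> rj; rewrite mxE big1 // => i _; rewrite mxE.
by case: eqP => [e|_]; rewrite ?mulr0 //= e ltnNge rj mulr0.
Qed.

Lemma sum_row_proj (R : comNzRingType) m (w : 'rV[R]_m) (A B P : 'M[R]_m) :
  A *m B = 1%:M -> \sum_p (w *m A) 0 p *: (row p B *m P) = w *m P.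
Proof.
move=> AB; transitivity (w *m A *m B *m P); last by rewrite -(mulmxA w) AB mulmx1.
rewrite (mulmx_sum_row (w *m A)) mulmx_suml; apply: eq_bigr => p _; exact: scalemxAl.
Qed.

Lemma row_proj (R : comNzRingType) m (a : 'I_m) (A B C P : 'M[R]_m) :
  A *m B = C -> row a C *m P = \sum_p A a p *: (row p B *m P).
Proof.
move=> <-; rewrite row_mul (mulmx_sum_row (row a A)) mulmx_suml; apply: eq_bigr => p _.
by rewrite [in LHS]mxE scalemxAl.
Qed.

Section TwoForms.
Context {R : realType} {m : nat} {M : manifold R m}.
Local Notation V := 'rV[R]_m.
Local Notation Jt := (@transition_jacobian R m M).
Implicit Types (w : dform M 2) (x y : M) (u v t : V).

Lemma lf2E w x u v : lf w x [:: u; v] = w x (rows2 u v).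
Proof.
rewrite /lf /=; congr (w x _); apply/row_matrixP => i; rewrite row_mat /rows2.
case: (split_ordP (i : 'I_(1 + 1))) => j ->; rewrite (ord1 j).
  by rewrite (@rowKu R 1 1 m 0 u v) row_id.
by rewrite (@rowKd R 1 1 m 0 u v) row_id.
Qed.

Variable w : dform M 2.
Hypothesis sw : smooth_form w.

Let lin x : multilin (lf w x).
Proof. by have [lw _ _] := sw; exact: lf_multilin. Qed.

Lemma form2_linl x (c : R) u v t :
  w x (rows2 (c *: u + v) t) = c * w x (rows2 u t) + w x (rows2 v t).
Proof. by rewrite -!lf2E; exact: (@lin x [::] c u v [:: t]). Qed.

Lemma form2_linr x (c : R) u v t :
  w x (rows2 t (c *: u + v)) = c * w x (rows2 t u) + w x (rows2 t v).
Proof. by rewrite -!lf2E; exact: (@lin x [:: t] c u v [::]). Qed.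

Lemma form2_0l x t : w x (rows2 0 t) = 0.
Proof. by rewrite -lf2E; exact: (@multilin0 _ _ _ [::] [:: t] (lin x)). Qed.

Lemma form2_0r x t : w x (rows2 t 0) = 0.
Proof. by rewrite -lf2E; exact: (@multilin0 _ _ _ [:: t] [::] (lin x)). Qed.

Lemma form2_suml x I (r : seq I) (P : pred I) (c : I -> R) (f : I -> V) t :
  w x (rows2 (\sum_(i <- r | P i) c i *: f i) t) =
  \sum_(i <- r | P i) c i * w x (rows2 (f i) t).
Proof.
elim/big_rec2: _ => [|i a b _ <-]; first exact: form2_0l.
exact: form2_linl.
Qed.

Lemma form2_sumr x I (r : seq I) (P : pred I) (c : I -> R) (f : I -> V) t :
  w x (rows2 t (\sum_(i <- r | P i) c i *: f i)) =
  \sum_(i <- r | P i) c i * w x (rows2 t (f i)).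
Proof.
elim/big_rec2: _ => [|i a b _ <-]; first exact: form2_0r.
exact: form2_linr.
Qed.

(** Smoothness of w is given for constant arguments in atlas charts; the arguments are therefore
    expanded in the coordinate frame of the chart attached to the point. *)
Lemma smooth_form2 c (f g : V -> V) : smooth_chart c ->
  smooth_on (cimg c) f -> smooth_on (cimg c) g ->
  smooth_on (cimg c) (fun u => w (cinv c u)
    (rows2 (f u *m dchart_inv c (cinv c u)) (g u *m dchart_inv c (cinv c u))) : R^o).
Proof.
move=> sc sf sg; have [ic _] := sc; apply: smooth_local => u0 cu0.
set c0 := chart_at (cinv c u0); have sc0 : smooth_chart c0 by exact: smooth_chart_at.
have [ic0 _] := sc0; have oO := overlap_open ic ic0.
have Oc u : overlap c c0 u -> cimg c u by case.
exists (overlap c c0); first by split=> //; exact: mem_chart_at.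
have sJ (h : V -> V) : smooth_on (cimg c) h ->
    msmooth (overlap c c0) (fun u => h u *m Jt c c0 (cinv c u)).
  move=> sh; apply: (msmoothM oO); last exact: msmooth_Jt.
  by apply/(msmooth_row _ oO); exact: smooth_sub sh.
have [_ _ srep] := sw.
apply: (smooth_eq oO (f := fun u => \sum_i \sum_j
   ((f u *m Jt c c0 (cinv c u)) 0 i * (g u *m Jt c c0 (cinv c u)) 0 j *
    (form_rep (cinv c u0) w (rows2 (delta_mx 0 i) (delta_mx 0 j)) \o tr c c0) u : R^o))).
  move=> u Ou; have cy0 : cdom c0 (cinv c u) by case: Ou.
  have cy := cinv_dom ic (Oc _ Ou).
  have e (h : V) : h *m dchart_inv c (cinv c u) =
      \sum_i (h *m Jt c c0 (cinv c u)) 0 i *: (delta_mx 0 i *m dchart_inv c0 (cinv c u)).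
    have <- : Jt c c0 (cinv c u) *m dchart_inv c0 (cinv c u) = dchart_inv c (cinv c u).
      by rewrite !dchart_invE; apply: Jt_mul => //; [exact: smooth_chart_at|exact: mem_chart_at].
    rewrite mulmxA [in LHS](row_sum_delta (h *m _)) mulmx_suml.
    by apply: eq_bigr => i _; rewrite -scalemxAl.
  rewrite (e (f u)) (e (g u)) form2_suml; apply: eq_bigr => i _.
  rewrite form2_sumr mulr_sumr; apply: eq_bigr => j _.
  have [_ eu] := overlap_tr ic ic0 Ou.
  rewrite -mulrA /form_rep /= -/c0 eu; congr (_ * (_ * w _ _)).
  exact: (mul_col_mx (delta_mx 0 i : V) (delta_mx 0 j : V)).
apply: smooth_sum => // i; apply: smooth_sum => // j.
apply: smoothM => //; first by apply: smoothM => //; exact: sJ.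
apply: (@smooth_comp _ _ _ _ (cimg c0)) => //.
- by move=> u Ou; have [[]] := overlap_tr ic ic0 Ou.
- exact: smooth_tr.
- exact: srep.
Qed.
End TwoForms.

Section LeafJacobian.
Context {R : realType} {m : nat} {M : manifold R m}.
Local Notation V := 'rV[R]_m.
Local Notation Jt := (@transition_jacobian R m M).
Implicit Types (c : @chart R m M).

Lemma msmooth_Jt_inv c c' : smooth_chart c -> smooth_chart c' ->
  msmooth (overlap c c') (fun u => Jt c' c (cinv c u)).
Proof.
move=> sc sc' i j; have [ic _] := sc; have [ic' _] := sc'; have oO := overlap_open ic ic'.
apply: (@smooth_eq _ _ _ _ ((fun u' => Jt c' c (cinv c' u') i j : R^o) \o tr c c')) => //.
  by move=> u Ou /=; have [_ ->] := overlap_tr ic ic' Ou.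
apply: (@smooth_comp _ _ _ _ (overlap c' c)) => //.
- by move=> u Ou; have [] := overlap_tr ic ic' Ou.
- exact: smooth_tr.
- exact: msmooth_Jt.
Qed.

(* The transverse coordinates of c' are constant on the leaves, so their second
   derivatives along a leaf direction vanish. *)
Lemma Jt_leaf r c c' u (v : V) (i j : 'I_m) : smooth_chart c -> smooth_chart c' ->
  (forall u (z : V), overlap c c' u -> (z <= (pid_mx r : 'M[R]_m))%MS ->
     (z *m Jt c c' (cinv c u) <= (pid_mx r : 'M[R]_m))%MS) ->
  overlap c c' u -> (v <= (pid_mx r : 'M[R]_m))%MS -> (r <= j)%N ->
  'D_v (fun u => Jt c c' (cinv c u) i j : R^o) u = 0.
Proof.
move=> sc sc' HJ Ou vr rj; have [ic _] := sc; have [ic' _] := sc'.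
have oO := overlap_open ic ic'; pose f : V -> R^o := fun u => tr c c' u 0 j.
have sf : smooth_on (overlap c c') f by apply: smooth_coord => //; exact: smooth_tr.
have df z w : overlap c c' z -> 'D_w f z = (w *m Jt c c' (cinv c z)) 0 j.
  move=> Oz; have cz : cdom c (cinv c z) by apply: cinv_dom => //; case: Oz.
  have c'z : cdom c' (cinv c z) by case: Oz.
  have zK : c (cinv c z) = z by apply: cinvK => //; case: Oz.
  have dt := diff_tr sc sc' cz c'z.
  rewrite (mul_Jt w sc sc' cz c'z) (derive_coord j (diff_derivable dt)) zK.
  by [].
have e : \forall z \near u, 'D_(delta_mx 0 i) f z = Jt c c' (cinv c z) i j.
  by apply: filterS (open_near oO Ou) => z Oz; rewrite (df _ _ Oz) -rowE mxE.
rewrite -(near_eq_derive _ e) (clairaut _ _ oO sf Ou).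
have e0 : \forall z \near u, (0 : R^o) = 'D_v f z.
  apply: filterS (open_near oO Ou) => z Oz; rewrite (df _ _ Oz).
  by rewrite (sub_pid_coord (HJ _ _ Oz vr)).
by rewrite -(near_eq_derive _ e0) derive_cst.
Qed.
End LeafJacobian.

(** * The leafwise flat coframe of a k-symplectic manifold *)

Section KSymplecticFrame.
Context {R : realType} (n k : nat) (k_gt0 : (0 < k)%N).
Local Notation m := (n * k.+1)%N.
Local Notation r := (n * k)%N.
Context {M : manifold R m}.
Local Notation V := 'rV[R]_m.
Local Notation Jt := (@transition_jacobian R m M).
Implicit Types (c : @chart R m M) (x y : M) (u v t : V).
Variables (omega : 'I_k -> dform M 2) (L Q : tdistribution M).
Hypothesis ksympl : k_symplectic n omega L.
Hypothesis Q_integrable : integrable_distr n Q.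
Hypothesis TM_eq : forall x, (L x + Q x == 1%:M)%MS.
Hypothesis LQ_direct : forall x, (L x :&: Q x)%MS = 0.

Let somega a : smooth_form (omega a). Proof. exact: (ksym_smooth ksympl). Qed.

Definition foliated c := smooth_chart c /\
  forall y, cdom c y -> (L y *m dchart c y == (pid_mx r : 'M[R]_m))%MS.

Definition proj_Q y : 'M[R]_m := proj_mx (Q y) (L y).

Lemma direct_QL y : (Q y :&: L y)%MS = 0. Proof. by rewrite capmxC. Qed.

Lemma proj_Q_L y v : (v - v *m proj_Q y <= L y)%MS.
Proof.
have vQL : (v <= Q y + L y)%MS by rewrite addsmxC (eqmxP (TM_eq y)) submx1.
rewrite -[X in X - _](add_proj_mx (direct_QL y) vQL) addrC addKr.
exact: proj_mx_sub.
Qed.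

Lemma proj_Q_L0 y v : (v <= L y)%MS -> v *m proj_Q y = 0.
Proof. by apply: proj_mx_0; exact: direct_QL. Qed.

Lemma proj_Q_id y v : (v <= Q y)%MS -> v *m proj_Q y = v.
Proof. by apply: proj_mx_id; exact: direct_QL. Qed.

#[local] Opaque proj_Q.

Lemma rank_Q y : (\rank (Q y) <= n)%N.
Proof.
have [c [sc cy /(_ _ cy)/eqmxP e]] := Q_integrable y.
have [u _] := mulmx1_unit (dchartK sc cy).
have -> : \rank (Q y) = \rank (Q y *m dchart c y).
  by rewrite mxrankMfree // row_free_unit.
by rewrite e rank_pid_mx // leq_pmulr.
Qed.

Lemma leaf_coord c y v : foliated c -> cdom c y ->
  (v <= (pid_mx r : 'M[R]_m))%MS = (v *m dchart_inv c y <= L y)%MS.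
Proof.
move=> [sc Lc] cy; rewrite -(eqmxP (Lc y cy)); apply/idP/idP => H.
  have := submxMr (dchart_inv c y) H.
  by rewrite -[X in (_ <= X)%MS]mulmxA dchartK // mulmx1.
by have := submxMr (dchart c y) H; rewrite -[X in (X <= _)%MS]mulmxA dchart_invK // mulmx1.
Qed.

Lemma sub_pid_delta (i : 'I_m) : (i < r)%N ->
  ((delta_mx 0 i : V) <= (pid_mx r : 'M[R]_m))%MS.
Proof. by move=> ir; have := row_sub i (pid_mx r : 'M[R]_m); rewrite row_pid ir. Qed.

Lemma row_dchart_inv_leaf c y (i : 'I_m) : foliated c -> cdom c y -> (i < r)%N ->
  (row i (dchart_inv c y) <= L y)%MS.
Proof. by move=> fc cy ir; rewrite rowE -leaf_coord // sub_pid_delta. Qed.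

(** Passes from global sections to vectors: a vector of L extends with constant coordinates in a
    foliated chart, and the cutoff only rescales the values, so the extension is a section of L. *)
Lemma isotropic a x v t : (v <= L x)%MS -> (t <= L x)%MS -> omega a x (rows2 v t) = 0.
Proof.
have [c [sc cx cL]] := ksym_foliation ksympl x; have fc : foliated c by [].
have [ic _] := sc; have cu := cimg_chart cx.
have [U [oU Uu Uc HU]] := extend_field sc (cimg_open ic) (@subset_refl _ _) cu.
have H s : (s <= L x)%MS -> exists2 X, section_of (fiber L) X & X x = s.
  move=> sL; have [X [sX eX X0]] := HU _ (smooth_cst (s *m dchart c x)).
  exists X; last by rewrite (fieldE X sc cx) eX // -mulmxA dchartK // mulmx1.
  split=> // y; rewrite /fiber /=; have [->|[cy [d ->]]] := X0 y; first exact: sub0mx.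
  rewrite -leaf_coord // scalemx_sub // (leaf_coord _ fc cx).
  by rewrite -mulmxA dchartK // mulmx1.
move=> /H[X sX <-] /H[X' sX' <-]; exact: (ksym_isotropic ksympl).
Qed.

Definition coord_proj c u : 'M[R]_m :=
  dchart_inv c (cinv c u) *m proj_Q (cinv c u) *m dchart c (cinv c u).

Lemma coord_projE c u v : smooth_chart c -> cimg c u ->
  v *m coord_proj c u *m dchart_inv c (cinv c u) = v *m dchart_inv c (cinv c u) *m proj_Q (cinv c u).
Proof.
move=> sc cu; have [ic _] := sc; have cy := cinv_dom ic cu.
move: (dchartK sc cy); rewrite /coord_proj.
move: (dchart_inv _ _) (proj_Q _) (dchart _ _) => A P B BA.
by rewrite !mulmxA -(mulmxA _ B A) BA mulmx1.
Qed.

(** The shift a - r: row a >= r of the frame T used next is the coordinate vector of this index in a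
    chart adapted to Q. *)
Definition low (i : 'I_m) : 'I_m := Ordinal (leq_ltn_trans (leq_subr r i) (ltn_ord i)).

(** Q is given by row spaces with no regularity of the matrices, so smoothness is extracted from a
    chart c2 adapted to Q. The rows of T are the leaf coordinate vectors of c, which span L, then
    the first n coordinate vectors of c2, which span Q. In this smooth frame the projection is the
    constant matrix D, hence it is T^-1 D T in the chart c. *)
Lemma coord_proj_smooth c : foliated c -> msmooth (cimg c) (coord_proj c).
Proof.
move=> fc i j; have [sc cL] := fc; have [ic _] := sc; apply: smooth_local => u0 cu0.
have [c2 [sc2 c2y c2Q]] := Q_integrable (cinv c u0); have [ic2 _] := sc2.
have oO := overlap_open ic ic2; exists (overlap c c2); first by split.
pose T u : 'M[R]_m := \matrix_a if (a < r)%N then delta_mx 0 a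
   else row (low a) (Jt c2 c (cinv c u)).
pose D : 'M[R]_m := \matrix_(a, b) ((a == b) && (r <= a)%N)%:R.
have rD (B : 'M[R]_m) a : row a (D *m B) = if (r <= a)%N then row a B else 0.
  apply/rowP => b; rewrite !mxE (bigD1 a) //= big1 => [|l la].
    by rewrite !mxE eqxx /= addr0; case: ifP => _; rewrite ?mul1r ?mul0r !mxE.
  by rewrite !mxE eq_sym (negbTE la) mul0r.
have sT : msmooth (overlap c c2) T.
  move=> a b; have [ar|ar] := ltnP a r.
    apply: (smooth_eq oO (f := fun=> (delta_mx 0 a : V) 0 b : R^o)); last exact: smooth_cst.
    by move=> u _; rewrite [RHS]mxE ar.
  apply: (smooth_eq oO (f := fun u => Jt c2 c (cinv c u) (low a) b : R^o)).
    by move=> u _; rewrite [RHS]mxE ltnNge ar [RHS]mxE.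
  exact: msmooth_Jt_inv.
have J2 y : cdom c y -> cdom c2 y -> Jt c2 c y *m dchart_inv c y = dchart_inv c2 y.
  by move=> cy c2y'; rewrite !dchart_invE; apply: Jt_mul => //;
    [exact: smooth_chart_at|exact: mem_chart_at].
have Tsub u a : cdom c (cinv c u) -> cdom c2 (cinv c u) ->
    row a (T u) *m dchart_inv c (cinv c u) = if (a < r)%N then row a (dchart_inv c (cinv c u))
      else row (low a) (dchart_inv c2 (cinv c u)).
  by move=> cy c2y'; rewrite rowK; case: ifP => _; rewrite -?rowE // -row_mul J2.
have Tunit u : overlap c c2 u -> T u \in unitmx.
  move=> Ou; have c2y' : cdom c2 (cinv c u) by case: Ou.
  have cy : cdom c (cinv c u) by apply: cinv_dom => //; case: Ou.
  set y := cinv c u in cy c2y'.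
  have : (1%:M <= T u *m dchart_inv c y)%MS.
    rewrite -(eqmxP (TM_eq y)) addsmx_sub; apply/andP; split.
      have : (L y <= (pid_mx r : 'M[R]_m) *m dchart_inv c y)%MS.
        have : (L y *m dchart c y <= (pid_mx r : 'M[R]_m))%MS by rewrite (eqmxP (cL _ cy)).
        by move/(submxMr (dchart_inv c y)); rewrite -mulmxA dchartK // mulmx1.
      move=> H; apply: submx_trans H _; apply/row_subP => a; rewrite row_mul row_pid.
      case: ifP => ar; last by rewrite mul0mx sub0mx.
      by have := Tsub u a cy c2y'; rewrite ar -/y -rowE => <-; rewrite -row_mul row_sub.
    have : (Q y <= (pid_mx n : 'M[R]_m) *m dchart_inv c2 y)%MS.
      have : (Q y *m dchart c2 y <= (pid_mx n : 'M[R]_m))%MS by rewrite (eqmxP (c2Q _ c2y')).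
      by move/(submxMr (dchart_inv c2 y)); rewrite -mulmxA dchartK // mulmx1.
    move=> H; apply: submx_trans H _; apply/row_subP => a; rewrite row_mul row_pid.
    case: ifP => an; last by rewrite mul0mx sub0mx.
    have bm : (r + a < m)%N by rewrite [X in (_ < X)%N]mulnS addnC ltn_add2r.
    have := Tsub u (Ordinal bm) cy c2y'; rewrite -/y ltnNge leq_addr /= -rowE.
    have -> : low (Ordinal bm) = a by apply: val_inj; rewrite /= addKn.
    by move=> <-; rewrite -row_mul row_sub.
  rewrite sub1mx row_full_unit unitmx_mul => /andP[] //.
have TP u : overlap c c2 u -> T u *m coord_proj c u = D *m T u.
  move=> Ou; have c2y' : cdom c2 (cinv c u) by case: Ou.
  have cy : cdom c (cinv c u) by apply: cinv_dom => //; case: Ou.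
  apply/row_matrixP => a; rewrite rD row_mul /coord_proj (mulmxA (row a (T u)) (_ *m proj_Q _)).
  rewrite (mulmxA (row a (T u)) (dchart_inv c (cinv c u)) (proj_Q (cinv c u))) (Tsub u a cy c2y').
  have [ar|ar] := ltnP a r.
    by rewrite proj_Q_L0 ?mul0mx //; exact: row_dchart_inv_leaf.
  rewrite proj_Q_id.
    by rewrite rowK ltnNge ar -(J2 _ cy c2y') -row_mul -mulmxA dchart_invK // mulmx1.
  have an : (low a < n)%N.
    by rewrite /= ltn_subLR // addnC -[X in (_ < X)%N]mulnS; exact: ltn_ord.
  have : ((delta_mx 0 (low a) : V) <= (pid_mx n : 'M[R]_m))%MS.
    by have := row_sub (low a) (pid_mx n : 'M[R]_m); rewrite row_pid an.
  rewrite -(eqmxP (c2Q _ c2y')) => /(submxMr (dchart_inv c2 (cinv c u))).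
  by rewrite -rowE -[X in (_ <= X)%MS]mulmxA dchartK // mulmx1.
have H : msmooth (overlap c c2) (coord_proj c); last exact: H.
apply: (msmooth_eq oO (B := fun u => invmx (T u) *m (D *m T u))).
  by move=> u Ou; rewrite -(TP u Ou) mulKmx // Tunit.
apply: (msmoothM oO); first exact: msmooth_inv.
by apply: (msmoothM oO) => //; exact: msmooth_cst.
Qed.

Lemma proj_Q_smooth (X : vfield M) : smooth_field X -> smooth_field (fun y => X y *m proj_Q y).
Proof.
move=> sX; apply: smooth_field_local => x.
have [c [sc cx cL]] := ksym_foliation ksympl x; have fc : foliated c by [].
have [ic _] := sc; have oc := cimg_open ic.
exists c, (cimg c); split=> //; first exact: cimg_chart.
apply: (smooth_eq oc (f := fun u => frep c X u *m coord_proj c u)) => [u cu|].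
  have cy := cinv_dom ic cu.
  have := coord_projE (frep c X u) sc cu; rewrite -(frep_fieldE X sc cu) => e.
  by rewrite [RHS]frepE -e -[RHS]mulmxA dchart_invK // mulmx1.
apply/(msmooth_row _ oc); apply: (msmoothM oc); last exact: coord_proj_smooth.
by apply/(msmooth_row _ oc); exact: smooth_frep.
Qed.

(** A leaf index l < n k is read as a n + j: a is the number of the form and j that of the
    transverse direction paired with it. For l >= n k the value is a mere default. *)
Definition block (l : 'I_m) : 'I_k := insubd (Ordinal k_gt0) (l %/ n)%N.

Lemma n_gt0 (l : 'I_m) : (0 < n)%N.
Proof. by case: n l => // -[]. Qed.

Lemma transverse_subproof (l : 'I_m) : (r + l %% n < m)%N.
Proof. by rewrite [X in (_ < X)%N]mulnS addnC ltn_add2r ltn_mod (n_gt0 l). Qed.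
Definition transverse (l : 'I_m) : 'I_m := Ordinal (transverse_subproof l).

Lemma transverse_lt (p : 'I_m) : (p - r < n)%N.
Proof.
have n0 := n_gt0 p; have : (p < n + n * k)%N by rewrite -mulnS.
by move: (n * k)%N (nat_of_ord p) => N q; lia.
Qed.

Lemma leaf_index_subproof (a : 'I_k) (p : 'I_m) : (a * n + (p - r) < m)%N.
Proof.
apply: (@leq_trans (n + n * k)%N); last by rewrite -mulnS.
have pn := transverse_lt p; have : (a.+1 * n <= k * n)%N by rewrite leq_mul2r ltn_ord orbT.
rewrite mulSn (mulnC k n); move: (p - r)%N (n * k)%N (a * n)%N pn => x y z; lia.
Qed.
Definition leaf_index a p : 'I_m := Ordinal (leaf_index_subproof a p).

Lemma transverse_leaf_index (a : 'I_k) (p : 'I_m) : (r <= p)%N -> transverse (leaf_index a p) = p.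
Proof.
move=> rp; apply: val_inj => /=; rewrite modnMDl modn_small ?subnKC //.
exact: transverse_lt.
Qed.

Lemma block_leaf_index (a : 'I_k) (p : 'I_m) : (r <= p)%N ->
  (leaf_index a p < r)%N /\ block (leaf_index a p) = a.
Proof.
move=> rp; have pn := transverse_lt p.
have n0 := n_gt0 p.
have e : ((a * n + (p - r)) %/ n = a)%N by rewrite divnMDl // divn_small ?addn0.
split.
  have : ((a * n + (p - r)) %/ n < k)%N by rewrite e.
  by rewrite ltn_divLR // (mulnC k n).
by apply: val_inj; rewrite /block val_insubd /= e ltn_ord.
Qed.

Lemma leaf_indexK (a : 'I_k) (l : 'I_m) :
  (leaf_index a (transverse l) == l) = (l < r)%N && (block l == a).
Proof.
have n0 := n_gt0 l; have -> : (l < r)%N = (l %/ n < k)%N by rewrite ltn_divLR // (mulnC k n).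
rewrite -val_eqE /= addKn {2}(divn_eq l n) eqn_add2r eqn_pmul2r //.
rewrite -val_eqE /block val_insubd eq_sym; case: ifP => //= lk.
by apply/negbTE; apply: contraFneq lk => ->.
Qed.

(** Right multiplication by this matrix turns chart coordinates into coframe coordinates. For l < r
    the entry is omega_a(v_L, q_j), where q_j is the Q-component of the coordinate vector of index
    [transverse l]; the other coordinates are kept. *)
Definition frame c u : 'M[R]_m := \matrix_(i, l)
  let y := cinv c u in let e := row i (dchart_inv c y) in
  if (l < r)%N then
    omega (block l) y (rows2 (e - e *m proj_Q y) (row (transverse l) (dchart_inv c y) *m proj_Q y))
  else (i == l)%:R.

Lemma frame_coord c u v l : let y := cinv c u in let t := v *m dchart_inv c y in
  (v *m frame c u) 0 l = if (l < r)%N then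
    omega (block l) y (rows2 (t - t *m proj_Q y) (row (transverse l) (dchart_inv c y) *m proj_Q y))
  else v 0 l.
Proof.
move=> y t; rewrite mxE; case: ifP => lr.
  have -> : t - t *m proj_Q y = \sum_i v 0 i *:
     (row i (dchart_inv c y) - row i (dchart_inv c y) *m proj_Q y).
    rewrite /t mulmx_sum_row mulmx_suml -sumrB; apply: eq_bigr => i _.
    by rewrite -scalemxAl -scalerBr.
  rewrite form2_suml //; apply: eq_bigr => i _; rewrite mxE lr //.
rewrite (bigD1 l) //= big1 => [|i il]; rewrite mxE lr ?eqxx ?mulr1 ?addr0 //.
by rewrite (negbTE il) mulr0.
Qed.

Lemma frame_smooth c : foliated c -> msmooth (cimg c) (frame c).
Proof.
move=> fc i l; have [sc cL] := fc; have [ic _] := sc; have oc := cimg_open ic.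
have [lr|lr] := ltnP l r; last first.
  apply: (smooth_eq oc (f := fun=> (i == l)%:R : R^o)); last exact: smooth_cst.
  by move=> u _; rewrite [RHS]mxE ltnNge lr.
have sP (a : 'I_m) : msmooth (cimg c) (fun u => (delta_mx 0 a : V) *m coord_proj c u).
  by apply: (msmoothM oc); [exact: msmooth_cst|exact: coord_proj_smooth].
have := @smooth_form2 _ _ _ (omega (block l)) (somega _) c
  (fun u => (delta_mx 0 i : V) + (-1) *: ((delta_mx 0 i : V) *m coord_proj c u))
  (fun u => (delta_mx 0 (transverse l) : V) *m coord_proj c u) sc.
move=> H; apply: (smooth_eq oc _ (H _ _)) => [u cu||].
- rewrite [RHS]mxE lr mulmxDl -scalemxAl scaleN1r !coord_projE // -!rowE //.
- apply: smoothD => //; first exact: smooth_cst.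
  by apply: smoothZ => //; apply/(msmooth_row _ oc).
- exact/(msmooth_row _ oc).
Qed.

(** A vector in the kernel has zero transverse coordinates, so it lies in L, and every omega_a pairs
    it to 0 with the q_j. These span Q, and L is isotropic, so the vector is in the common kernel of
    the omega_a, which is zero. *)
Lemma frame_unit c u : foliated c -> cimg c u -> frame c u \in unitmx.
Proof.
move=> fc cu; have [sc cL] := fc; have [ic _] := sc; have cy := cinv_dom ic cu.
rewrite -row_free_unit; apply/inj_row_free => v v0; set y := cinv c u in cy.
pose t := v *m dchart_inv c y.
have vr : (v <= (pid_mx r : 'M[R]_m))%MS.
  suff -> : v = v *m (pid_mx r : 'M[R]_m) by exact: submxMl.
  rewrite mulmx_sum_row {1}[v]row_sum_delta; apply: eq_bigr => i _; rewrite row_pid.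
  case: ltnP => // ri; have := frame_coord c u v i; rewrite v0 mxE ltnNge ri /= => <-.
  by rewrite !scale0r.
have tL : (t <= L y)%MS by rewrite -leaf_coord.
suff : t = 0.
  move=> t0; have : t *m dchart c y = 0 by rewrite t0 mul0mx.
  by rewrite /t -mulmxA dchart_invK // mulmx1.
have : [set 0] t; last by [].
rewrite -(ksym_nondeg ksympl y) => a _ w /=.
have e0 (p : 'I_m) : omega a y (rows2 t (row p (dchart_inv c y) *m proj_Q y)) = 0.
  have [pr|rp] := ltnP p r.
    by rewrite proj_Q_L0 ?form2_0r //; exact: row_dchart_inv_leaf.
  have [lr bl] := block_leaf_index a rp.
  have := frame_coord c u v (leaf_index a p).
  cbv zeta; rewrite lr.
  rewrite bl.
  rewrite (transverse_leaf_index a rp).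
  move: (proj_Q_L0 tL); rewrite /t => ->.
  rewrite subr0.
  rewrite (congr1 (fun B : V => B 0 (leaf_index a p)) v0) => <-.
  exact: mxE.
have ew : w = \sum_p (w *m dchart c y) 0 p *: (row p (dchart_inv c y) *m proj_Q y) +
    (w - w *m proj_Q y).
  have -> : \sum_p (w *m dchart c y) 0 p *: (row p (dchart_inv c y) *m proj_Q y) =
      w *m proj_Q y.
    exact: (sum_row_proj w (proj_Q y) (dchartK sc cy)).
  by rewrite addrC subrK.
rewrite ew -[X in rows2 _ (X + _)]scale1r form2_linr // form2_sumr // big1.
  by rewrite mulr0 add0r; apply: isotropic => //; exact: proj_Q_L.
by move=> p _; rewrite e0 mulr0.
Qed.

Lemma Jt_preserves_leaf c c' u v : foliated c -> foliated c' -> overlap c c' u ->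
  (v <= (pid_mx r : 'M[R]_m))%MS ->
  (v *m Jt c c' (cinv c u) <= (pid_mx r : 'M[R]_m))%MS.
Proof.
move=> fc fc' [cu c'y] vr; have [sc _] := fc; have [sc' _] := fc'; have [ic _] := sc.
have cy := cinv_dom ic cu; rewrite (leaf_coord _ fc' c'y).
have -> : v *m Jt c c' (cinv c u) *m dchart_inv c' (cinv c u) = v *m dchart_inv c (cinv c u).
  rewrite -mulmxA; congr (v *m _); rewrite !dchart_invE.
  by apply: Jt_mul => //; [exact: smooth_chart_at|exact: mem_chart_at].
by rewrite -(leaf_coord _ fc cy).
Qed.

(** Block diagonal: for each form the transpose of the transverse block of the inverse Jacobian,
    then the transverse block of the Jacobian itself. *)
Definition frame_transition c c' u : 'M[R]_m := \matrix_(l, l')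
  if [&& l < r, l' < r & block l == block l']%N
  then Jt c' c (cinv c u) (transverse l') (transverse l)
  else if ((r <= l) && (r <= l'))%N then Jt c c' (cinv c u) l l' else 0.

Lemma frame_transition_smooth c c' : foliated c -> foliated c' ->
  msmooth (overlap c c') (frame_transition c c').
Proof.
move=> [sc _] [sc' _] l l'; have [ic _] := sc; have [ic' _] := sc'.
have oO := overlap_open ic ic'.
case e1 : [&& l < r, l' < r & block l == block l']%N; last first.
  case e2 : ((r <= l) && (r <= l'))%N; last first.
    apply: (smooth_eq oO (f := fun=> 0 : R^o)); last exact: smooth_cst.
    by move=> u _; rewrite [RHS]mxE e1 e2.
  apply: (smooth_eq oO (f := fun u => Jt c c' (cinv c u) l l' : R^o)).
    by move=> u _; rewrite [RHS]mxE e1 e2.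
  exact: msmooth_Jt.
apply: (smooth_eq oO (f := fun u => Jt c' c (cinv c u) (transverse l') (transverse l) : R^o)).
  by move=> u _; rewrite [RHS]mxE e1.
exact: msmooth_Jt_inv.
Qed.

Lemma frame_transition_leaf c c' u v l l' : foliated c -> foliated c' -> overlap c c' u ->
  (v <= (pid_mx r : 'M[R]_m))%MS -> 'D_v (fun u => frame_transition c c' u l l' : R^o) u = 0.
Proof.
move=> fc fc' Ou vr; have [sc _] := fc; have [sc' _] := fc'.
have [ic _] := sc; have [ic' _] := sc'; have oO := overlap_open ic ic'.
have HJ d d' z (w : V) : foliated d -> foliated d' -> overlap d d' z ->
    (w <= (pid_mx r : 'M[R]_m))%MS -> (w *m Jt d d' (cinv d z) <= (pid_mx r : 'M[R]_m))%MS.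
  exact: Jt_preserves_leaf.
have near_entry (f : V -> R^o) : (forall z, overlap c c' z -> f z = frame_transition c c' z l l') ->
    'D_v f u = 0 -> 'D_v (fun u => frame_transition c c' u l l' : R^o) u = 0.
  move=> fE <-; apply: esym; apply: near_eq_derive.
  by apply: filterS (open_near oO Ou) => z; exact: fE.
case e1 : [&& l < r, l' < r & block l == block l']%N; last first.
  case e2 : ((r <= l) && (r <= l'))%N; last first.
    apply: (near_entry (fun=> 0)) => [z _|]; last exact: derive_cst.
    by rewrite [RHS]mxE e1 e2.
  apply: (near_entry (fun u => Jt c c' (cinv c u) l l')) => [z _|].
    by rewrite [RHS]mxE e1 e2.
  have /andP[_ rl'] := e2.
  by apply: (@Jt_leaf _ _ _ r c c') => // z w Oz; exact: HJ.
have [Ou' _] := overlap_tr ic ic' Ou.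
(* The inverse Jacobian is the Jacobian from c' to c at the image point; the chain rule replaces v
   by its image, which is again a leaf direction. *)
pose h : V -> R^o := fun u' => Jt c' c (cinv c' u') (transverse l') (transverse l).
apply: (near_entry (h \o tr c c')) => [z Oz|].
  by rewrite [RHS]mxE e1 /h /=; have [_ ->] := overlap_tr ic ic' Oz.
have [cu c'y] := Ou; have cy := cinv_dom ic cu; have uK := cinvK ic cu.
have dt := diff_tr sc sc' cy c'y; rewrite uK in dt.
have dh : differentiable h (tr c c' u).
  by apply: smooth_diff Ou'; exact: msmooth_Jt.
apply: (etrans (derive_comp v dt dh)).
apply: (@Jt_leaf _ _ _ r c' c) => //; first by move=> z w Oz; exact: HJ.
  have := mul_Jt v sc sc' cy c'y; rewrite uK => <-.
  exact: HJ.
by rewrite /= leq_addr.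
Qed.

(* In an adapted chart a tangent vector has coordinates x_(a,j) along the
   leaves and y_j across them; a change of chart with transverse Jacobian H acts
   by y' = y H and x_a = x'_a H^T. *)
Lemma frame_tr c c' u : foliated c -> foliated c' -> overlap c c' u ->
  Jt c c' (cinv c u) *m frame c' (tr c c' u) = frame c u *m frame_transition c c' u.
Proof.
move=> fc fc' Ou; have [sc _] := fc; have [sc' _] := fc'.
have [ic _] := sc; have [ic' _] := sc'; have [cu c'y] := Ou; have cy := cinv_dom ic cu.
have [_ yE] := overlap_tr ic ic' Ou.
have J1 : Jt c c' (cinv c u) *m dchart_inv c' (cinv c u) = dchart_inv c (cinv c u).
  rewrite !dchart_invE; apply: Jt_mul => //; [exact: smooth_chart_at|exact: mem_chart_at].
have J2 : Jt c' c (cinv c u) *m dchart_inv c (cinv c u) = dchart_inv c' (cinv c u).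
  rewrite !dchart_invE; apply: Jt_mul => //; [exact: smooth_chart_at|exact: mem_chart_at].
apply/matrixP => i l'.
have -> : (Jt c c' (cinv c u) *m frame c' (tr c c' u)) i l' =
    (row i (Jt c c' (cinv c u)) *m frame c' (tr c c' u)) 0 l'.
  by rewrite -row_mul [RHS]mxE.
rewrite frame_coord yE -row_mul J1 [RHS]mxE.
have [lr|rl] := ltnP l' r; last first.
  rewrite [LHS]mxE; have [ir|ri] := ltnP i r.
    have := @Jt_preserves_leaf c c' u _ fc fc' Ou (sub_pid_delta ir).
    rewrite -rowE => /sub_pid_coord/(_ rl); rewrite mxE => ->.
    apply: esym; apply: big1 => l _; rewrite /frame_transition /frame !mxE.
    rewrite [(l' < r)%N]ltnNge rl andbF /= andbT; case: leqP => [rl2|]; rewrite ?mulr0 //.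
    case: eqP => [e|]; rewrite ?mul0r //.
    by move: rl2; rewrite -e leqNgt ir.
  rewrite (bigD1 i) //= big1 => [|l li].
    by rewrite /frame_transition /frame !mxE !ltnNge ri rl /= eqxx mul1r addr0.
  rewrite /frame_transition /frame !mxE [(l' < r)%N]ltnNge rl andbF /= andbT.
  case: leqP => [rl2|]; rewrite ?mulr0 //.
  by rewrite /= eq_sym (negbTE li) mul0r.
set y := cinv c u; set e := row i (dchart_inv c y).
pose W p := omega (block l') y (rows2 (e - e *m proj_Q y) (row p (dchart_inv c y) *m proj_Q y)).
pose F p := Jt c' c y (transverse l') p * W p.
have e2 := row_proj (transverse l') (proj_Q y) J2.
apply: (etrans (congr1 (fun q => omega (block l') y (rows2 (e - e *m proj_Q y) q)) e2)).
apply: (etrans (form2_sumr (somega _) _ _ _ _ _ _)).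
(* Coordinate vectors of index p < r lie in L and have no component in Q. The remaining p correspond
   through [leaf_index] to the leaf columns of the block of l'. *)
transitivity (\sum_(p : 'I_m | (r <= p)%N) F p).
  rewrite [RHS]big_mkcond; apply: eq_bigr => p _; rewrite /F /W; case: leqP => // pr.
  by rewrite (proj_Q_L0 (row_dchart_inv_leaf fc cy pr)) form2_0r ?mulr0.
rewrite (reindex_onto transverse (leaf_index (block l'))) => [|p rp]; last first.
  exact: transverse_leaf_index.
rewrite big_mkcond; apply: eq_bigr => l _; rewrite leaf_indexK leq_addr /=.
rewrite /frame_transition /frame !mxE lr /=.
have [llr|rl] := ltnP l r; last by rewrite /= [(r <= l')%N]leqNgt lr mulr0.
rewrite /=; case: eqP => [bl|_]; last by rewrite mulr0.
by rewrite /F /W bl mulrC.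
Qed.

Lemma leafwise_flat_connection (nabla : vfield M -> vfield M -> vfield M) :
  is_connection nabla -> exists nabla' Omega',
  [/\ is_connection nabla', is_curvature nabla' Omega' &
   forall x v w, (v <= L x)%MS -> (w <= L x)%MS -> Omega' x (rows2 v w) = 0].
Proof.
move=> cn; have [fol folP] := choice (ksym_foliation ksympl).
have fP x : foliated (fol x) by have [sc _ cL] := folP x.
apply: (@flat_connection_exists _ _ _ r L proj_Q fol _ _ _ _ _ (fun x => frame (fol x))) => //.
- by move=> x; have [] := folP x.
- by move=> x; have [] := folP x.
- exact: proj_Q_smooth.
- exact: proj_Q_L.
- exact: proj_Q_L0.
- by move=> x; exact: frame_smooth.
- by move=> x u cu; exact: frame_unit.
move=> x x'; exists (frame_transition (fol x) (fol x')); split.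
  exact: frame_transition_smooth.
move=> u Ou; split; first exact: frame_tr.
by move=> v i j vr; exact: frame_transition_leaf.
exact: cn.
Qed.
End KSymplecticFrame.

(** * Trace forms *)

Section TransgressionMorphism.
Variables (B B' C C' : nzRingType) (phi : {rmorphism B -> B'}).
Variables (tau : B -> C) (tau' : B' -> C') (psi : C -> C').
Hypothesis psiD : forall x y, psi (x + y) = psi x + psi y.
Hypothesis tau_phi : forall x, tau' (phi x) = psi (tau x).

(** Naturality under ring morphisms serves both evaluation at a point and change of frame. *)
Lemma curvature_path_morph W0 W1 A :
  curvature_path (phi W0) (phi W1) (phi A) = map_poly phi (curvature_path W0 W1 A).
Proof.
apply/polyP => k; rewrite coef_map /= /curvature_path.
rewrite !(coefD, coefN, coefMX, coefMXn, coefC).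
case: k => [|[|[|k]]] /=;
  by rewrite ?(rmorphD, rmorphN, rmorphM, rmorph0) /= ?(rmorphD, rmorphN, rmorphM, rmorph0).
Qed.

Lemma transgression_morph W0 W1 A s j :
  transgression tau' (phi W0) (phi W1) (phi A) s j = psi (transgression tau W0 W1 A s j).
Proof.
rewrite /transgression (additiveMn psiD) -tau_phi curvature_path_morph.
by rewrite -map_polyC -rmorphXn -rmorphM coef_map.
Qed.

Lemma trace_path_morph W0 W1 A s j : tau' 0 = 0 -> tau 0 = 0 ->
  (map_poly tau' (curvature_path (phi W0) (phi W1) (phi A) ^+ s))`_j =
  psi (map_poly tau (curvature_path W0 W1 A ^+ s))`_j.
Proof.
move=> t0' t0; rewrite !coef_map_id0 // -tau_phi curvature_path_morph.
by rewrite -rmorphXn coef_map.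
Qed.

Lemma trace_pow_morph W s : tau' (phi W ^+ s) = psi (tau (W ^+ s)).
Proof. by rewrite -rmorphXn tau_phi. Qed.
End TransgressionMorphism.

Section TraceClosure.
Variables (V : Type) (K : comNzRingType) (P : shuffle V K -> Prop) (m : nat).
Hypothesis P0 : P 0.
Hypothesis P1 : P 1.
Hypothesis PD : forall a b, P a -> P b -> P (a + b).
Hypothesis PN : forall a, P a -> P (- a).
Hypothesis PM : forall a b, P a -> P b -> P (a * b).

Lemma closed_sum I (r : seq I) F : (forall i, P (F i)) -> P (\sum_(i <- r) F i).
Proof. by move=> HF; elim/big_ind: _. Qed.

Definition mxP (N : 'M[shuffle V K]_m.+1) := forall i j, P (N i j).

Lemma mxPD N N' : mxP N -> mxP N' -> mxP (N + N').
Proof. by move=> H H' i j; rewrite mxE; exact: PD. Qed.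
Lemma mxPN N : mxP N -> mxP (- N).
Proof. by move=> H i j; rewrite mxE; exact: PN. Qed.
Lemma mxPM N N' : mxP N -> mxP N' -> mxP (N * N').
Proof. by move=> H H' i j; rewrite mxE; apply: closed_sum => k; exact: PM. Qed.
Lemma mxP0 : mxP 0. Proof. by move=> i j; rewrite mxE. Qed.
Lemma mxP1 : mxP 1. Proof. by move=> i j; rewrite mxE; case: eqP. Qed.
Lemma mxPX N s : mxP N -> mxP (N ^+ s).
Proof. by move=> H; elim: s => [|s IH]; [exact: mxP1|rewrite exprS; exact: mxPM]. Qed.
Lemma mxP_trace N : mxP N -> P (\tr N).
Proof. by move=> H; apply: closed_sum. Qed.
Lemma mxP_sum I (r : seq I) F : (forall i, mxP (F i)) -> mxP (\sum_(i <- r) F i).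
Proof. by move=> HF; elim/big_ind: _ => //; [exact: mxP0|exact: mxPD]. Qed.

Definition pmxP (p : {poly 'M[shuffle V K]_m.+1}) := forall k, mxP p`_k.

Lemma pmxPM p q : pmxP p -> pmxP q -> pmxP (p * q).
Proof. by move=> Hp Hq k; rewrite coefM; apply: mxP_sum => i; exact: mxPM. Qed.
Lemma pmxPX p s : pmxP p -> pmxP (p ^+ s).
Proof.
move=> Hp; elim: s => [|s IH]; last by rewrite exprS; exact: pmxPM.
by move=> k; rewrite expr0 coef1; case: eqP => _ /=; [exact: mxP1|exact: mxP0].
Qed.
Lemma pmxPC N : mxP N -> pmxP N%:P.
Proof. by move=> H k; rewrite coefC; case: eqP => _ //; exact: mxP0. Qed.

Lemma pmxP_path W0 W1 A : mxP W0 -> mxP W1 -> mxP A -> pmxP (curvature_path W0 W1 A).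
Proof.
move=> H0 H1 HA k; rewrite /curvature_path !coefD coefN coefMX coefMXn !coefC.
apply: mxPD; last apply: mxPN.
  apply: mxPD; first by case: ifP => _ //; exact: mxP0.
  case: k => [|k] /=; first exact: mxP0.
  case: ifP => _; last exact: mxP0.
  by apply: mxPD; [apply: mxPD => //; exact: mxPN|exact: mxPM].
by case: ifP => _; [exact: mxP0|case: ifP => _; [exact: mxPM|exact: mxP0]].
Qed.

Lemma closedMn a n : P a -> P (a *+ n).
Proof. by move=> Pa; elim: n => [|n IH]; rewrite ?mulr0n // mulrS; exact: PD. Qed.

Lemma closed_transgression W0 W1 A s j : mxP W0 -> mxP W1 -> mxP A ->
  P (transgression (@mxtrace _ m.+1) W0 W1 A s j).
Proof.
move=> H0 H1 HA; apply: closedMn; apply: mxP_trace; apply: pmxPM.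
  by apply: pmxPX; exact: pmxP_path.
exact: pmxPC.
Qed.
End TraceClosure.

Section Even.
Context {V : Type} {K : comNzRingType}.

(** Minors need commuting entries. The even forms are a commutative subring, and it contains the
    entries of the curvature. *)
Definition even_pred : {pred shuffle V K} := fun a => `[< sbar a = a >].

Record even_form := EvenForm { even_val :> shuffle V K; even_valP : even_val \in even_pred }.
HB.instance Definition _ := [isSub for even_val].
HB.instance Definition _ := [Choice of even_form by <:].

Lemma sbar1 : sbar (1 : shuffle V K) = 1.
Proof. by apply/shufP => -[|v s]; rewrite /sbar /= ?mul1r ?mulr0. Qed.

Lemma even_subring : subring_closed even_pred.
Proof.
split; first by apply/asboolP; exact: sbar1.
- by move=> a b /asboolP ea /asboolP eb; apply/asboolP; rewrite sbarD sbarN ea eb.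
- by move=> a b /asboolP ea /asboolP eb; apply/asboolP; rewrite sbarM ea eb.
Qed.
HB.instance Definition _ := GRing.isSubringClosed.Build _ even_pred even_subring.
HB.instance Definition _ := [SubChoice_isSubNzRing of even_form by <:].

Lemma even_mulC : commutative (@GRing.mul even_form).
Proof.
move=> a b; apply: val_inj; rewrite !rmorphM /=.
by apply: even_comm; have /asboolP := even_valP a.
Qed.
HB.instance Definition _ := GRing.PzRing_hasCommutativeMul.Build even_form even_mulC.
End Even.

Section MinorsTrace.
Variables (C : comNzRingType) (m : nat).

Lemma minors0 (N : 'I_0 -> 'M[C]_m) : minors N = 1.
Proof.
rewrite /minors (big_pred1 (ffun0 (card_ord 0) : {ffun 'I_0 -> 'I_m})) => [|I]; last first.
  by apply/esym/eqP/ffunP => -[].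
rewrite (big_pred1 1%g) => [|t]; last by apply/esym/eqP/permP => -[].
by rewrite odd_perm1 big_ord0 mulr1.
Qed.

End MinorsTrace.

Section LowDegree.
Context {V : Type} {K : comNzRingType}.
Implicit Types (a b : shuffle V K) (s : seq V).

Definition scst (k : K) : shuffle V K := fun s => if s is [::] then k else 0.
Definition one_form (f : V -> K) : shuffle V K := fun s => if s is [:: v] then f v else 0.
Definition two_form (f : V -> V -> K) : shuffle V K :=
  fun s => if s is [:: v; w] then f v w else 0.

Lemma sbar_scst k : sbar (scst k) = scst k.
Proof. by apply/shufP => -[|w t]; rewrite /sbar /= ?mul1r ?mulr0. Qed.

Lemma sbar_one_form f : sbar (one_form f) = - one_form f.
Proof.
apply/shufP => -[|v [|w s]]; rewrite shuffleE /sbar /= ?mulr0 ?oppr0 //.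
by rewrite expr1 mulN1r.
Qed.

Lemma scstM k a s : (scst k * a) s = k * a s.
Proof.
elim: s a => [|v s IH] a; first by rewrite shuffle_nil.
rewrite shuffle_cons sbar_scst.
have -> : contract v (scst k) = 0 by [].
by rewrite mul0r shuffleE add0r IH.
Qed.

Lemma scst_is_additive : zmod_morphism scst.
Proof. by move=> k l; apply/shufP => -[|v s] /=; rewrite !shuffleE //= subrr. Qed.

Lemma scst_is_multiplicative : monoid_morphism scst.
Proof.
split; first by apply/shufP => -[].
by move=> k l; apply/shufP => -[|v s]; rewrite scstM //= mulr0.
Qed.
HB.instance Definition _ := GRing.isZmodMorphism.Build _ _ scst scst_is_additive.
HB.instance Definition _ := GRing.isMonoidMorphism.Build _ _ scst scst_is_multiplicative.

Lemma one_formM f g : one_form f * one_form g = two_form (fun v w => f v * g w - f w * g v).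
Proof.
apply/shufP => -[|v s]; first by rewrite shuffle_nil /= mul0r.
rewrite shuffle_cons.
have c h : contract v (one_form h) = scst (h v) by apply/shufP => -[].
rewrite !c scstM -[sbar _ * _]even_comm ?sbar_scst // scstM sbar_one_form shuffleE.
case: s => [|w [|t s]] /=; rewrite ?mulr0 ?oppr0 ?mulr0 ?addr0 //.
by rewrite mulrN [g v * _]mulrC.
Qed.

Lemma sdiff_one_form (D : V -> K -> K) f : (forall v x y, D v (x + y) = D v x + D v y) ->
  sdiff D (one_form f) = two_form (fun v w => D v (f w) - D w (f v)).
Proof.
move=> DD; have D0 v := additive0 (DD v).
apply/shufP => -[|v s] //.
rewrite -[LHS]/(contract v (sdiff D (one_form f)) s) contract_sdiff !shuffleE.
have -> : contract v (one_form f) = scst (f v) by apply/shufP => -[].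
case: s => [|w s] /=; first by rewrite /sder /= D0 subr0.
rewrite -[X in _ - X]/(contract w (sdiff D (scst (f v))) s) contract_sdiff.
have -> : contract w (scst (f v)) = 0 by [].
rewrite (sdiff0 DD) subr0 /sder.
by case: s => [|t s] /=; rewrite ?D0 ?subr0.
Qed.

Lemma altern_two_form f : (forall v, f v v = 0) -> altern (two_form f).
Proof. by move=> f0 [|v1 [|v2 [|v3 s1]]] v [|w s2] //=. Qed.

Lemma altern_one_form f : altern (one_form f).
Proof. by move=> [|v1 [|v2 s1]] v s2. Qed.
End LowDegree.

Section LowDegreeLinear.
Context {K : comNzRingType} {V : lmodType K}.

Lemma multilin_one_form (f : V -> K) :
  (forall c v w, f (c *: v + w) = c * f v + f w) -> multilin (one_form f).
Proof.
move=> lf [|v1 [|v2 s1]] c v w [|w1 s2] //=; by rewrite ?mulr0 ?addr0.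
Qed.

Lemma multilin_two_form (f : V -> V -> K) :
  (forall c v w t, f (c *: v + w) t = c * f v t + f w t) ->
  (forall c v w t, f t (c *: v + w) = c * f t v + f t w) -> multilin (two_form f).
Proof.
move=> l1 l2 [|v1 [|v2 [|v3 s1]]] c v w [|w1 [|w2 s2]] //=; by rewrite ?mulr0 ?addr0.
Qed.
End LowDegreeLinear.

Section Twist.
Context {V : Type} {K : comNzRingType} {m : nat}.
Local Notation S := (shuffle V K).

(** Change of frame on matrices of forms whose entries are transported by f. The inverse relations
    are parameters so that the map carries the structure of a ring morphism. *)
Definition twist (J1 J2 : 'M[K]_m.+1) (e1 : J1 *m J2 = 1%:M) (e2 : J2 *m J1 = 1%:M)
    (f : {rmorphism S -> S}) (X : 'M[S]_m.+1) : 'M[S]_m.+1 :=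
  map_mx (@scst V K) J2 * map_mx f X * map_mx (@scst V K) J1.

Variables (J1 J2 : 'M[K]_m.+1) (e1 : J1 *m J2 = 1%:M) (e2 : J2 *m J1 = 1%:M).
Variable f : {rmorphism S -> S}.

Lemma scst_mx1 (A B : 'M[K]_m.+1) : A *m B = 1%:M ->
  map_mx (@scst V K) A * map_mx (@scst V K) B = 1.
Proof. by move=> AB; rewrite -[LHS]map_mxM AB map_mx1. Qed.

Lemma twist_is_additive : zmod_morphism (twist e1 e2 f).
Proof. by move=> X Y; rewrite /twist map_mxB mulrBr mulrBl. Qed.

Lemma twist_is_multiplicative : monoid_morphism (twist e1 e2 f).
Proof.
split; first by rewrite /twist map_mx1 mulr1 scst_mx1.
move=> X Y; rewrite /twist map_mxM -!mulrA; congr (_ * (_ * _)).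
by rewrite !mulrA scst_mx1 // mul1r.
Qed.
HB.instance Definition _ := GRing.isZmodMorphism.Build _ _ (twist e1 e2 f) twist_is_additive.
HB.instance Definition _ := GRing.isMonoidMorphism.Build _ _ (twist e1 e2 f) twist_is_multiplicative.

Lemma twist_trace X : \tr (twist e1 e2 f X) = f (\tr X).
Proof.
(* The property wanted is the graded cyclicity of the trace, for which the zero differential
   serves. *)
have H : trace_dga (map_mx (@sbar V K) : 'M[_]_m.+1 -> 'M[_]_m.+1) (map_mx (sdiff (fun _ _ => 0)))
    (sdiff (fun _ _ => 0)) (@mxtrace _ m.+1).
  by apply: matrix_trace_dga => *; rewrite ?mulr0 ?mul0r ?addr0.
have ev (A : 'M[K]_m.+1) : map_mx (@sbar V K) (map_mx (@scst V K) A) = map_mx (@scst V K) A.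
  by apply/matrixP => i j; rewrite !mxE sbar_scst.
rewrite /twist -mulrA (dga_tau_even H _ (ev J2)) -mulrA scst_mx1 // mulr1.
by rewrite trace_map_mx.
Qed.

Lemma twistE X i j s : twist e1 e2 f X i j s =
  \sum_l (\sum_k J2 i k * f (X k l) s) * J1 l j.
Proof.
rewrite /twist mxE.
have sE I (r : seq I) (F : I -> S) t : (\sum_(i <- r) F i) t = \sum_(i <- r) F i t.
  by elim/big_rec2: _ => // k y1 y2 _ <-.
rewrite sE; apply: eq_bigr => l _; rewrite !mxE -even_comm ?sbar_scst // scstM mulrC.
by rewrite sE; congr (_ * _); apply: eq_bigr => k _; rewrite !mxE scstM.
Qed.
End Twist.

Lemma curvature_matrix_anti (R : realType) m (theta : 'rV[R]_m -> 'rV[R]_m -> 'M[R]_m) v w u :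
  curvature_matrix theta v w u = - curvature_matrix theta w v u.
Proof.
rewrite /curvature_matrix; move: (\matrix_(_, _) _) (\matrix_(_, _) _) => a b.
move: (_ *m _) (_ *m _) => c d; apply/matrixP => i j; rewrite !mxE; ring.
Qed.

Section LocalData.
Context {R : realType} {m' : nat}.
Local Notation m := m'.+1.
Context {M : manifold R m}.
Local Notation V := 'rV[R]_m.
Implicit Types (x y : M) (u v w : V).
Implicit Types (Omega : M -> 'M[R]_(2, m) -> 'M[R]_m) (A : M -> V -> 'M[R]_m).

Definition curv_mx Omega x : 'M[shuffle V R]_m :=
  \matrix_(i, j) lf (fun y z => Omega y z i j) x.
Definition conn_mx A x : 'M[shuffle V R]_m :=
  \matrix_(i, j) one_form (fun v => A x v i j).

Lemma curv_mxE Omega x i j : curv_mx Omega x i j =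
  two_form (fun v w => Omega x (rows2 v w) i j).
Proof.
rewrite mxE; apply/shufP => -[|v [|w [|t s]]] //; rewrite /lf /=.
congr (Omega x _ i j); apply/row_matrixP => k; rewrite row_mat /rows2.
case: (split_ordP (k : 'I_(1 + 1))) => k' ->; rewrite (ord1 k').
  by rewrite (@rowKu R 1 1 m 0 v w) row_id.
by rewrite (@rowKd R 1 1 m 0 v w) row_id.
Qed.

Section Hats.
Variables (U : set V) (oU : open U) (u0 : V) (Uu0 : U u0).
Local Notation K := (sfun oU Uu0).
Variable theta : V -> V -> 'M[R]_m.
Hypothesis st : forall v, msmooth U (theta v).

Definition theta_hat : 'M[shuffle V K]_m :=
  \matrix_(i, j) one_form (fun v => mk (st v i j)).

Lemma odd_theta_hat : map_mx (@sbar V K) theta_hat = - theta_hat.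
Proof. by apply/matrixP => i j; rewrite !mxE sbar_one_form. Qed.

Lemma eval_theta_hat u (Uu : U u) i j :
  evU Uu (theta_hat i j) = one_form (fun v => theta v u i j).
Proof.
rewrite mxE /evU; apply/shufP => s; rewrite /smap map_id.
by case: s => [|v [|w s]]; [exact: rmorph0|exact: (mkE (st v i j) Uu)|exact: rmorph0].
Qed.

(** On 1-forms [sdiff] is the antisymmetrised derivative and the product the antisymmetrised
    product, so the algebraic d theta - theta theta evaluates to the analytic curvature matrix. *)
Lemma eval_curvature_hat u (Uu : U u) i j :
  evU Uu (curvature_of (map_mx (sdiff (fun v => sf_der v))) theta_hat i j) =
  two_form (fun v w => curvature_matrix theta v w u i j).
Proof.
rewrite /curvature_of.
have sE I (r : seq I) (F : I -> shuffle V K) t : (\sum_(i <- r) F i) t = \sum_(i <- r) F i t.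
  by elim/big_rec2: _ => // k y1 y2 _ <-.
pose G v w : K := sf_der v (mk (st w i j)) - sf_der w (mk (st v i j)) -
     \sum_k (mk (st v i k) * mk (st w k j) - mk (st w i k) * mk (st v k j)).
have e : (map_mx (sdiff (fun v => sf_der v)) theta_hat - theta_hat * theta_hat) i j =
   two_form G :> shuffle V K.
  rewrite !mxE (sdiff_one_form _ (@sf_derD _ _ _ _ _ _)); apply/shufP => s.
  rewrite shuffleE [X in _ + X]shuffleE sE.
  under eq_bigr do rewrite !mxE one_formM.
  by case: s => [|v [|w [|t s]]]; [rewrite big1 ?subr0|rewrite big1 ?subr0|idtac|rewrite big1 ?subr0].
rewrite e /evU; apply/shufP => s; rewrite /smap map_id.
case: s => [|v [|w [|t s]]]; try exact: rmorph0.
rewrite -[LHS]/(eval_at oU Uu0 Uu (G v w)) -[RHS]/(curvature_matrix theta v w u i j).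
rewrite /G !rmorphB rmorph_sum /= /curvature_matrix !mxE.
have der v1 w1 : eval_at oU Uu0 Uu (sf_der v1 (mk (st w1 i j))) =
    'D_v1 (fun u => theta w1 u i j : R^o) u.
  apply: (etrans (sf_derE _ _ Uu)); apply: near_eq_derive.
  by apply: filterS (open_near oU Uu) => z Uz; exact: mkE.
rewrite !der -!sumrB -sumrN; congr (_ + _); apply: eq_bigr => k _.
rewrite rmorphB !rmorphM opprB /=; congr (_ * _ - _ * _); exact: mkE.
Qed.
End Hats.

Section AtPoint.
Variables (nabla nabla' : vfield M -> vfield M -> vfield M).
Hypotheses (cn : is_connection nabla) (cn' : is_connection nabla').
Variables (Omega Omega' : M -> 'M[R]_(2, m) -> 'M[R]_m).
Hypotheses (cO : is_curvature nabla Omega) (cO' : is_curvature nabla' Omega').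

Lemma two_connection_matrices (c : @chart R m M) a : smooth_chart c -> cimg c a ->
  exists U th th', [/\ U a, connection_matrix nabla c U th & connection_matrix nabla' c U th'].
Proof.
move=> sc ca.
have [U [th [Ux [oU Uc st lt e]]]] := connection_matrix_exists cn sc ca.
have [U' [th' [U'x [oU' U'c st' lt' e']]]] := connection_matrix_exists cn' sc ca.
exists (U `&` U'), th, th'; split=> //; split.
- exact: openI.
- by move=> u [/Uc].
- by move=> v; apply: msmooth_sub (st v) => u [].
- by move=> k v w u [Uu _]; exact: lt.
- by move=> X Z sX sZ u [Uu _]; exact: e.
- exact: openI.
- by move=> u [/Uc].
- by move=> v; apply: msmooth_sub (st' v) => u [].
- by move=> k v w u [_ Uu]; exact: lt'.
- by move=> X Z sX sZ u [_ Uu]; exact: e'.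
Qed.

Variable A : M -> V -> 'M[R]_m.
Hypothesis HA : forall c U theta theta' u v,
  smooth_chart c -> connection_matrix nabla c U theta ->
  connection_matrix nabla' c U theta' -> U u ->
  A (cinv c u) (v *m dchart_inv c (cinv c u)) =
  dchart c (cinv c u) *m (theta' v u - theta v u) *m dchart_inv c (cinv c u).

Lemma curvature_altern_lin x : [/\
  forall v w, Omega x (rows2 v w) = - Omega x (rows2 w v),
  forall (c : R) v w t, Omega x (rows2 (c *: v + w) t) =
    c *: Omega x (rows2 v t) + Omega x (rows2 w t) &
  forall (c : R) v w, A x (c *: v + w) = c *: A x v + A x w].
Proof.
have [U [th [th' [Ux H H']]]] := two_connection_matrices (smooth_chart_at x) (cimg_at x).
have [oU Uc st lt _] := H; have [_ _ _ lt' _] := H'.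
have iz := @chart_atP _ _ M x; have zx := @mem_chart_at _ _ M x.
have OE v w : Omega x (rows2 v w) = curvature_matrix th v w (chart_at x x).
  have := curvature_rep cn v w cO (smooth_chart_at x) H Ux.
  by rewrite (chartK iz zx) dchart_at dchart_inv_at !mulmx1 mul1mx.
have AE v : A x v = th' v (chart_at x x) - th v (chart_at x x).
  have := HA v (smooth_chart_at x) H H' Ux.
  by rewrite (chartK iz zx) dchart_at dchart_inv_at !mulmx1 mul1mx.
split=> [v w|c v w t|c v w].
- by rewrite !OE; exact: curvature_matrix_anti.
- rewrite !OE; apply/matrixP => i j; rewrite /curvature_matrix (lt _ _ _ _ Ux) !mxE.
  set u := chart_at x x in Ux *.
  have dt z : differentiable (fun u => th z u i j : R^o) u by exact: smooth_diff (st z i j) Ux.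
  have e1 : 'D_(c *: v + w) (fun u => th t u i j : R^o) u =
      c * 'D_v (fun u => th t u i j : R^o) u + 'D_w (fun u => th t u i j : R^o) u.
    by rewrite (deriveE _ (dt t)) linearP -(deriveE _ (dt t)) -(deriveE _ (dt t)).
  have e2 : 'D_t (fun u => th (c *: v + w) u i j : R^o) u =
      c * 'D_t (fun u => th v u i j : R^o) u + 'D_t (fun u => th w u i j : R^o) u.
    have e : \forall z \near u, c *: (th v z i j : R^o) + th w z i j = th (c *: v + w) z i j.
      by apply: filterS (open_near oU Ux) => z Uz; rewrite (lt _ _ _ _ Uz) !mxE.
    rewrite -(near_eq_derive _ e).
    have dc : differentiable (fun z => c *: (th v z i j : R^o)) u by exact: differentiableZ.
    rewrite (deriveD (diff_derivable dc) (diff_derivable (dt w))).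
    by rewrite (deriveZ _ (diff_derivable (dt v))).
  rewrite e1 e2 -!sumrB mulrDr; move: ('D_v _ _) ('D_w _ _) => d1 d2.
  move: ('D_t _ _) ('D_t _ _) => d3 d4; rewrite mulrBr mulr_sumr.
  have -> : \sum_i0 (th t u i i0 * (c *: th v u + th w u) i0 j
      - (c *: th v u + th w u) i i0 * th t u i0 j) =
     c * (\sum_i0 (th t u i i0 * th v u i0 j - th v u i i0 * th t u i0 j)) +
     \sum_i0 (th t u i i0 * th w u i0 j - th w u i i0 * th t u i0 j).
    by rewrite mulr_sumr -big_split; apply: eq_bigr => k _ /=; rewrite !mxE; ring.
  by rewrite mulr_sumr; ring.
- by rewrite !AE lt // lt' // scalerBr opprD addrACA.
Qed.
End AtPoint.
End LocalData.

Lemma twist_coef (V : Type) (K : comNzRingType) m (J1 J2 : 'M[K]_m.+1)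
  (e1 : J1 *m J2 = 1%:M) (e2 : J2 *m J1 = 1%:M)
  (f : {rmorphism shuffle V K -> shuffle V K}) X i j s :
  twist e1 e2 f X i j s = (J2 *m (\matrix_(k, l) f (X k l) s) *m J1) i j.
Proof.
rewrite twistE mxE; apply: eq_bigr => l _; congr (_ * _).
by rewrite mxE; apply: eq_bigr => k _; rewrite mxE.
Qed.

Lemma mulmx_conjK (R : realType) p (J1 J2 X : 'M[R]_p) :
  J1 *m J2 = 1%:M -> J2 *m J1 = 1%:M -> J2 *m (J1 *m X *m J2) *m J1 = X.
Proof. by move=> e1 e2; rewrite !mulmxA e2 mul1mx -mulmxA e2 mulmx1. Qed.

Lemma mulmx_conj0 (R : realType) p (J1 J2 X : 'M[R]_p) i j :
  X = 0 -> (J2 *m X *m J1) i j = 0.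
Proof. by move=> ->; rewrite mulmx0 mul0mx mxE. Qed.

Section Represent.
Context {R : realType} {m' : nat}.
Local Notation m := m'.+1.
Context {M : manifold R m}.
Local Notation V := 'rV[R]_m.
Implicit Types (x y : M) (u v w : V).
Variables (nabla nabla' : vfield M -> vfield M -> vfield M).
Hypotheses (cn : is_connection nabla) (cn' : is_connection nabla').
Variables (Omega Omega' : M -> 'M[R]_(2, m) -> 'M[R]_m).
Hypotheses (cO : is_curvature nabla Omega) (cO' : is_curvature nabla' Omega').
Variable A : M -> V -> 'M[R]_m.
Hypothesis HA : forall c U theta theta' u v,
  smooth_chart c -> connection_matrix nabla c U theta ->
  connection_matrix nabla' c U theta' -> U u ->
  A (cinv c u) (v *m dchart_inv c (cinv c u)) =
  dchart c (cinv c u) *m (theta' v u - theta v u) *m dchart_inv c (cinv c u).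

Lemma represent_curvature nb Om (cnb : is_connection nb) (cOm : is_curvature nb Om)
    (c : @chart R m M) U th u0 (oU : open U) (Uu0 : U u0)
    (st : forall v, msmooth U (th v)) u (Uu : U u)
    (e1 : dchart c (cinv c u) *m dchart_inv c (cinv c u) = 1%:M)
    (e2 : dchart_inv c (cinv c u) *m dchart c (cinv c u) = 1%:M) :
  smooth_chart c -> connection_matrix nb c U th ->
  map_mx (evU (oU:=oU) (Uu0:=Uu0) Uu) (curvature_of (map_mx (sdiff (fun v => sf_der v))) (theta_hat oU Uu0 st)) =
  twist e1 e2 (pull c u) (curv_mx Om (cinv c u)).
Proof.
move=> sc H; apply/matrixP => i j; apply/shufP => s; rewrite [LHS](congr1 (fun f : shuffle V R => f s) (mxE _ _ _ _)).
rewrite eval_curvature_hat twist_coef.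
case: s => [|v [|w [|t s]]].
- rewrite mulmx_conj0 //.
  by apply/matrixP => k l; rewrite !mxE.
- rewrite mulmx_conj0 //.
  by apply/matrixP => k l; rewrite !mxE.
- rewrite [X in _ *m X *m _](_ : _ = dchart c (cinv c u) *m curvature_matrix th v w u *m dchart_inv c (cinv c u)).
    by rewrite mulmx_conjK.
  rewrite -(curvature_rep cnb v w cOm sc H Uu).
  by apply/matrixP => k l; rewrite mxE curv_mxE.
- rewrite mulmx_conj0 //.
  by apply/matrixP => k l; rewrite !mxE.
Qed.

Lemma represent_data (c : @chart R m M) a : smooth_chart c -> cimg c a ->
  exists U (oU : open U) (Ua : U a) (th Ah : 'M[shuffle V (sfun oU Ua)]_m),
  [/\ map_mx (@sbar V _) th = - th, map_mx (@sbar V _) Ah = - Ah, U `<=` cimg c &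
   let D := map_mx (sdiff (fun v => sf_der v)) in
   forall u (Uu : U u), exists phi : {rmorphism 'M[shuffle V R]_m -> 'M[shuffle V R]_m},
   [/\ forall X, \tr (phi X) = pull c u (\tr X),
       map_mx (evU (oU:=oU) (Uu0:=Ua) Uu) (curvature_of D th) = phi (curv_mx Omega (cinv c u)),
       map_mx (evU (oU:=oU) (Uu0:=Ua) Uu) (curvature_of D (th + Ah)) = phi (curv_mx Omega' (cinv c u)) &
       map_mx (evU (oU:=oU) (Uu0:=Ua) Uu) Ah = phi (conn_mx A (cinv c u))]].
Proof.
move=> sc ca; have [U [th [th' [Ua H H']]]] := two_connection_matrices cn cn' sc ca.
have [oU Uc st lt _] := H; have [_ _ st' lt' _] := H'.
exists U, oU, Ua, (theta_hat oU Ua st), (theta_hat oU Ua st' - theta_hat oU Ua st).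
split=> //; first exact: odd_theta_hat.
  apply/matrixP => i j; rewrite !mxE sbarD sbarN !sbar_one_form.
  by rewrite opprB opprK addrC.
move=> D u Uu; have [ic _] := sc; have cy := cinv_dom ic (Uc _ Uu).
exists (twist (dchartK sc cy) (dchart_invK sc cy) (pull c u)); split.
- by move=> X; rewrite twist_trace.
- exact: (represent_curvature cn cO).
- rewrite [X in curvature_of D X]addrC subrK.
  exact: (represent_curvature cn' cO').
apply/matrixP => i j; apply/shufP => s; rewrite twist_coef.
have -> : map_mx (evU (oU:=oU) (Uu0:=Ua) Uu) (theta_hat oU Ua st' - theta_hat oU Ua st) i j =
    evU Uu (theta_hat oU Ua st' i j) - evU Uu (theta_hat oU Ua st i j).
  by rewrite 4!mxE -rmorphB.
rewrite !eval_theta_hat shuffleE [X in _ + X]shuffleE.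
case: s => [|v [|w s]].
- rewrite mulmx_conj0 /= ?subrr //.
  by apply/matrixP => k l; rewrite !mxE.
- rewrite [X in _ *m X *m _](_ : _ = dchart c (cinv c u) *m (th' v u - th v u) *m dchart_inv c (cinv c u)).
    by rewrite (mulmx_conjK _ (dchartK sc cy) (dchart_invK sc cy)) !mxE.
  rewrite -(HA v sc H H' Uu).
  by apply/matrixP => k l; rewrite !mxE.
- rewrite mulmx_conj0 /= ?subrr //.
  by apply/matrixP => k l; rewrite !mxE.
Qed.

Definition trace_form (Om : M -> 'M[R]_(2, m) -> 'M[R]_m) s : lform (M := M) :=
  fun x => \tr (curv_mx Om x ^+ s).
Definition transgression_form s j : lform (M := M) := fun x =>
  transgression (@mxtrace _ m) (curv_mx Omega x) (curv_mx Omega' x) (conn_mx A x) s j.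
Definition path_form s j : lform (M := M) := fun x =>
  (map_poly (@mxtrace _ m) (curvature_path (curv_mx Omega x) (curv_mx Omega' x) (conn_mx A x) ^+ s))`_j.

(** A change of frame conjugates the matrices, which traces do not see. So traces of powers,
    transgressions and path coefficients have coordinate expressions given by the same formulas in
    the connection matrices. *)
Lemma represent_forms (c : @chart R m M) a : smooth_chart c -> cimg c a ->
  exists U (oU : open U) (Ua : U a) (th Ah : 'M[shuffle V (sfun oU Ua)]_m),
  let D := map_mx (sdiff (fun v => sf_der v)) in
  let W0 := curvature_of D th in let W1 := curvature_of D (th + Ah) in
  [/\ map_mx (@sbar V _) th = - th, map_mx (@sbar V _) Ah = - Ah, U `<=` cimg c,
   forall s, represents (oU:=oU) (Uu0:=Ua) c (\tr (W0 ^+ s)) (trace_form Omega s) /\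
     represents (oU:=oU) (Uu0:=Ua) c (\tr (W1 ^+ s)) (trace_form Omega' s) &
   forall s j, represents (oU:=oU) (Uu0:=Ua) c (transgression (@mxtrace _ m) W0 W1 Ah s j) (transgression_form s j) /\
     represents (oU:=oU) (Uu0:=Ua) c (map_poly (@mxtrace _ m) (curvature_path W0 W1 Ah ^+ s))`_j (path_form s j)].
Proof.
move=> sc ca; have [U [oU [Ua [th [Ah [oth oA Uc H]]]]]] := represent_data sc ca.
exists U, oU, Ua, th, Ah; move: H => /=.
move: (curvature_of _ th) (curvature_of _ (th + Ah)) => W0 W1 H.
have te u (Uu : U u) (X : 'M[shuffle V (sfun oU Ua)]_m) :
    \tr (map_mx (evU (oU:=oU) (Uu0:=Ua) Uu) X) = evU (oU:=oU) (Uu0:=Ua) Uu (\tr X) by rewrite trace_map_mx.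
split=> // [s|s j]; split=> u Uu; have [phi [tp p0 p1 pA]] := H u Uu.
- rewrite -te rmorphXn /= p0.
  exact: (trace_pow_morph tp).
- rewrite -te rmorphXn /= p1.
  exact: (trace_pow_morph tp).
- have := transgression_morph (phi := map_mx (evU (oU:=oU) (Uu0:=Ua) Uu)) (rmorphD (evU (oU:=oU) (Uu0:=Ua) Uu)) (te u Uu) W0 W1 Ah s j.
  move=> <- /=; rewrite p0 p1 pA.
  exact: (transgression_morph (rmorphD (pull c u)) tp).
- have := trace_path_morph (phi := map_mx (evU (oU:=oU) (Uu0:=Ua) Uu)) (te u Uu) W0 W1 Ah s j (mxtrace0 _ _) (mxtrace0 _ _).
  move=> <- /=; rewrite p0 p1 pA.
  exact: (trace_path_morph tp _ _ _ _ _ (mxtrace0 _ _) (mxtrace0 _ _)).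
Qed.
End Represent.

(** * Forms filtered by transverse degree *)

Section Graded.
Context {V : Type} {K : comNzRingType} (wt : V -> nat).
Implicit Types (a b : shuffle V K) (s : seq V).

(** Comparing p with twice the weight makes the levels add up under products, with no rounding for
    odd p. *)
Definition filtered p a := forall s, (2 * sumn (map wt s) < p)%N -> a s = 0.

Lemma shuffleMn a n s : (a *+ n) s = a s *+ n.
Proof. by elim: n => [|n IH] //; rewrite !mulrS shuffleE IH. Qed.

Lemma homog0 p : homog p (0 : shuffle V K). Proof. by []. Qed.
Lemma filtered0 p : filtered p (0 : shuffle V K). Proof. by []. Qed.
Lemma homog1 : homog 0 (1 : shuffle V K). Proof. by case. Qed.
Lemma filtered1 : filtered 0 (1 : shuffle V K). Proof. by []. Qed.
Lemma homogD p a b : homog p a -> homog p b -> homog p (a + b).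
Proof. by move=> ha hb s sp; rewrite shuffleE ha // hb // addr0. Qed.
Lemma filteredD p a b : filtered p a -> filtered p b -> filtered p (a + b).
Proof. by move=> ha hb s sp; rewrite shuffleE ha // hb // addr0. Qed.

Lemma homogM p q a b : homog p a -> homog q b -> homog (p + q) (a * b).
Proof.
move=> ha hb s sp; apply: (shuffle_weight (f := fun=> 0%N)) => s1 s2 _ e.
have [e1|/ha] := eqVneq (size s1) p; last by left.
by right; apply: hb; apply: contra_neq sp => <-; rewrite -e e1.
Qed.

Lemma filteredM p q a b : filtered p a -> filtered q b -> filtered (p + q) (a * b).
Proof.
move=> ha hb s sp; apply: (shuffle_weight (f := wt)) => s1 s2 e _.
have [/ha|e1] := ltnP (2 * sumn (map wt s1)) p; first by left.
right; apply: hb; lia.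
Qed.

Lemma sbar_homog p a : homog p a -> sbar a = scst ((-1) ^+ p) * a.
Proof.
move=> ha; apply/shufP => s; rewrite scstM /sbar.
by have [->//|/ha->] := eqVneq (size s) p; rewrite !mulr0.
Qed.
End Graded.

(** Stated for a family of predicates to give both the degree of the trace forms and their
    filtration level. *)
Lemma graded_trace_pow (V : Type) (K : comNzRingType) (P : nat -> shuffle V K -> Prop) m
    (W : 'M[shuffle V K]_m.+1) p s :
  (forall p, P p 0) -> P 0%N 1 -> (forall p a b, P p a -> P p b -> P p (a + b)) ->
  (forall p q a b, P p a -> P q b -> P (p + q)%N (a * b)) ->
  (forall i j, P p (W i j)) -> P (s * p)%N (\tr (W ^+ s)).
Proof.
move=> P0 P1 PD PM PW.
have H i j : P (s * p)%N ((W ^+ s) i j).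
  elim: s i j => [|s IH] i j; first by rewrite mxE; case: eqP.
  rewrite exprS mxE mulSn; elim/big_ind: _ => // [|k _]; first exact: PD.
  exact: PM.
by rewrite /mxtrace; apply: (big_ind (P (s * p)%N)) => // *; exact: PD.
Qed.

Section TraceForms.
Context {R : realType} {m' : nat}.
Local Notation m := m'.+1.
Context {M : manifold R m}.
Local Notation V := 'rV[R]_m.
Implicit Types (x y : M) (u v w : V).
Variables (nabla nabla' : vfield M -> vfield M -> vfield M).
Hypotheses (cn : is_connection nabla) (cn' : is_connection nabla').
Variables (Omega Omega' : M -> 'M[R]_(2, m) -> 'M[R]_m).
Hypotheses (cO : is_curvature nabla Omega) (cO' : is_curvature nabla' Omega').
Variable A : M -> V -> 'M[R]_m.
Hypothesis HA : forall c U theta theta' u v,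
  smooth_chart c -> connection_matrix nabla c U theta ->
  connection_matrix nabla' c U theta' -> U u ->
  A (cinv c u) (v *m dchart_inv c (cinv c u)) =
  dchart c (cinv c u) *m (theta' v u - theta v u) *m dchart_inv c (cinv c u).

Definition multialt (a : shuffle V R) := multilin a /\ altern a.

Lemma multialt0 : multialt 0.
Proof. by split=> [s1 c v w s2|//]; rewrite !shuffleE mulr0 addr0. Qed.
Lemma multialt1 : multialt 1.
Proof.
rewrite -(rmorph1 (@scst V R)).
by split=> [[|z s1] c v w s2|[|z s1] v s2] //=; rewrite mulr0 addr0.
Qed.
Lemma multialtD a b : multialt a -> multialt b -> multialt (a + b).
Proof. by move=> [la aa] [lb ab]; split; [exact: multilin_shufD|exact: alternD]. Qed.
Lemma multialtM a b : multialt a -> multialt b -> multialt (a * b).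
Proof. by move=> [la aa] [lb ab]; split; [exact: multilinM|exact: alternM]. Qed.
Lemma multialtN a : multialt a -> multialt (- a).
Proof.
move=> [la aa]; split=> [s1 c v w s2|s1 v s2]; rewrite !shuffleE ?aa ?oppr0 //.
by rewrite la opprD mulrN.
Qed.

Lemma multialt_two_form (f : V -> V -> R) : (forall v w, f v w = - f w v) ->
  (forall c v w t, f (c *: v + w) t = c * f v t + f w t) -> multialt (two_form f).
Proof.
move=> fa fl; split; last first.
  apply: altern_two_form => v; have := fa v v; lra.
apply: multilin_two_form => // c v w t.
by rewrite fa fl fa [f w t]fa; lra.
Qed.

Lemma multialt_curv x : mxP multialt (curv_mx Omega x).
Proof.
have [Oa Ol _] := curvature_altern_lin cn cn' cO HA x.
move=> i j; rewrite curv_mxE; apply: multialt_two_form => [v w|c v w t].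
  by rewrite Oa mxE.
by rewrite Ol !mxE.
Qed.

Lemma multialt_conn x : mxP multialt (conn_mx A x).
Proof.
have [_ _ Al] := curvature_altern_lin cn cn' cO HA x.
move=> i j; rewrite mxE; split; last exact: altern_one_form.
by apply: multilin_one_form => c v w; rewrite Al !mxE.
Qed.
End TraceForms.

Section Transgression.
Context {R : realType} {m' : nat}.
Local Notation m := m'.+1.
Context {M : manifold R m}.
Local Notation V := 'rV[R]_m.
Implicit Types (x y : M) (u v w : V).
Variables (nabla nabla' : vfield M -> vfield M -> vfield M).
Hypotheses (cn : is_connection nabla) (cn' : is_connection nabla').
Variables (Omega Omega' : M -> 'M[R]_(2, m) -> 'M[R]_m).
Hypotheses (cO : is_curvature nabla Omega) (cO' : is_curvature nabla' Omega').

Lemma lsmooth_local (a : lform (M := M)) : (forall x, multialt (a x)) ->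
  (forall x u, cimg (chart_at x) u -> exists2 U : set V, U u &
     forall s, smooth_on U (fun u => lrep (chart_at x) a u s)) -> lsmooth a.
Proof.
move=> Ha H; split=> [x|x|x s]; [by have [] := Ha x|by have [] := Ha x|].
by apply: smooth_local => u cu; have [U Uu HU] := H x u cu; exists U.
Qed.

(** Each identity is proved on coordinate expressions near a point and read at the centre of the
    attached chart; the primitive is global because the difference tensor A is. *)
Lemma trace_transgression_form s :
  [/\ lsmooth (trace_form (M := M) Omega s), forall x, dl (trace_form (M := M) Omega s.+1) x = 0 &
   exists2 h : lform (M := M), lsmooth h &
    forall x, trace_form Omega' s x = trace_form Omega s x + dl h x].
Proof.
have [A HA] := connection_difference cn cn'.
have [A' HA'] := connection_difference cn' cn.
have maO x := multialt_curv cn cn' cO HA x.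
have maO' x := multialt_curv cn' cn cO' HA' x.
have maA x := multialt_conn cn cn' cO HA x.
have Hrep x u : cimg (chart_at x) u -> _ := @represent_forms _ _ _ _ _ cn cn' _ _ cO cO' _ HA (chart_at x) u (smooth_chart_at x).
have t0 := mxtrace0.
split.
- apply: lsmooth_local => [x|x u cu].
    by apply: mxP_trace; [exact: multialt0|exact: multialtD|apply: mxPX => //;
      [exact: multialt0|exact: multialt1|exact: multialtD|exact: multialtM]].
  have [U [oU [Uu [th [Ah [oth oA Uc Ht _]]]]]] := Hrep x u cu.
  by exists U => // s'; have [Hs _] := Ht s; exact: represents_smooth Hs.
- move=> x; have [U [oU [Ux [th [Ah [oth oA Uc Ht _]]]]]] := Hrep x _ (cimg_at x).
  have [Hs _] := Ht s.+1; rewrite (represents_dl Ux Hs).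
  rewrite (trace_curvature_closed (matrix_trace_dga _ (@sf_derD _ _ _ _ _ _)
    (@sf_derM _ _ _ _ _ _) (@sf_derC _ _ _ _ _ _)) _ oth).
  exact: rmorph0.
pose T j := transgression_form Omega Omega' A s j.
pose P j := path_form Omega Omega' A s j.
have sT j : lsmooth (T j).
  apply: lsmooth_local => [x|x u cu].
    apply: closed_transgression => //; [exact: multialt0|exact: multialt1|
      exact: multialtD|exact: multialtN|exact: multialtM].
  have [U [oU [Uu [th [Ah [oth oA Uc _ Ht]]]]]] := Hrep x u cu.
  by exists U => // s'; have [Hs _] := Ht s j; exact: represents_smooth Hs.
have main x : trace_form Omega' s x = trace_form Omega s x + \sum_(j < 2 * s) P j.+1 x /\
    forall j, P j.+1 x *+ j.+1 = dl (T j) x.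
  have [U [oU [Ux [th [Ah [oth oA Uc Ht HT]]]]]] := Hrep x _ (cimg_at x).
  have [iz zx] : is_chart (chart_at x) /\ cdom (chart_at x) x.
    by split; [exact: chart_atP|exact: mem_chart_at].
  have ev ah a : represents (oU:=oU) (Uu0:=Ux) (chart_at x) ah a -> a x = evU (oU:=oU) (Uu0:=Ux) Ux ah.
    by move=> /(_ _ Ux); rewrite pull_id chartK.
  have d0 : sdiff (fun v => sf_der v) (0 : shuffle V (sfun oU Ux)) = 0.
    by apply: sdiff0; exact: sf_derD.
  have := transgressionE (matrix_trace_dga _ (@sf_derD _ _ _ oU _ Ux)
    (@sf_derM _ _ _ _ _ _) (@sf_derC _ _ _ _ _ _)) d0 s oth oA.
  cbv zeta; move: Ht HT; cbv zeta.
  move: (curvature_of _ th) (curvature_of _ (th + Ah)) => W0 W1 Ht HT [e1 e2].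
  split.
    have [H0 H1] := Ht s; apply: (etrans (ev _ _ H1)).
    rewrite (ev _ _ H0); apply: (etrans (congr1 _ e1)); rewrite rmorphD.
    congr (_ + _).
    rewrite rmorph_sum; apply: eq_bigr => j _; have [_ Hj] := HT s j.+1.
    exact: esym (ev _ _ Hj).
  move=> j; have [Hj _] := HT s j; have [_ Pj] := HT s j.+1.
  rewrite (represents_dl Ux Hj); apply: esym; apply: (etrans (congr1 _ (esym (e2 j)))).
  by rewrite rmorphMn; congr (_ *+ _); exact: esym (ev _ _ Pj).
(* The sum of the T_j / (j + 1) is the integral over [0, 1] of the polynomial with coefficients
   T_j. *)
pose h n : lform (M := M) := fun x => \sum_(j < n) lmul (lcst (j.+1%:R^-1)) (T j) x.
have sh n : lsmooth (h n) /\ forall x, dl (h n) x = \sum_(j < n) P j.+1 x.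
  elim: n => [|n [IH1 IH2]].
    have -> : h 0%N = lcst 0.
      by apply/funext => x; rewrite /h big_ord0; apply/shufP => -[].
    by split=> [|x]; [exact: lsmooth_cst|rewrite dl_cst big_ord0].
  have -> : h n.+1 = ladd (h n) (lmul (lcst (n.+1%:R^-1)) (T n)).
    by apply/funext => x; rewrite /h big_ord_recr.
  have sl : lsmooth (lmul (lcst (n.+1%:R^-1)) (T n)).
    by apply: lsmoothM => //; exact: lsmooth_cst.
  split=> [|x]; first exact: lsmoothD.
  rewrite dlD // IH2 big_ord_recr; congr (_ + _).
  rewrite dlM //; last exact: lsmooth_cst.
  rewrite dl_cst mul0r add0r; have [_ <-] := main x.
  have -> : sbar (lcst n.+1%:R^-1 x) = lcst n.+1%:R^-1 x :> shuffle V R by exact: sbar_scst.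
  apply/shufP => z; rewrite lcstM.
  by rewrite shuffleMn -[P _ _ _ *+ _]mulr_natl mulrA mulVf ?mul1r // pnatr_eq0.
have [sh1 sh2] := sh (2 * s)%N.
by exists (h (2 * s)%N) => // x; rewrite sh2; have [] := main x.
Qed.
End Transgression.

(** * Closed forms cohomologous to filtered ones *)

Section Good.
Context {R : realType} {m : nat} {M : manifold R m}.
Local Notation V := 'rV[R]_m.
Variable wt : M -> V -> nat.
Implicit Types (x y : M) (a b h : lform (M := M)).

(** The degree is recorded because the sign in the primitive of a product depends on it. *)
Record closed_homog p a : Prop := ClosedHomog {
  ch_homog : forall x, homog p (a x);
  ch_smooth : lsmooth a;
  ch_closed : forall x, dl a x = 0 }.

Record good p a : Prop := Good {
  good_closed : closed_homog p a;
  good_rep : exists h a', [/\ lsmooth h, closed_homog p a',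
    forall x, filtered (wt x) p (a' x) & forall x, a x = dl h x + a' x] }.

Lemma dl_scale k a x : lsmooth a -> dl (lmul (lcst k) a) x = lcst k x * dl a x.
Proof.
move=> sa; rewrite dlM //; last exact: lsmooth_cst.
by rewrite dl_cst mul0r add0r; congr (_ * _); exact: sbar_scst.
Qed.

Lemma closed_homogD p a b : closed_homog p a -> closed_homog p b -> closed_homog p (ladd a b).
Proof.
move=> [ha sa da] [hb sb db]; split=> [x||x].
- exact: homogD.
- exact: lsmoothD.
- by rewrite dlD // da db addr0.
Qed.

Lemma closed_homogM p q a b :
  closed_homog p a -> closed_homog q b -> closed_homog (p + q) (lmul a b).
Proof.
move=> [ha sa da] [hb sb db]; split=> [x||x].
- exact: homogM.
- exact: lsmoothM.
- by rewrite dlM // da db mulr0 mul0r addr0.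
Qed.

Lemma closed_homog_cst k : closed_homog 0 (lcst k).
Proof.
by split=> [x [] //||x]; [exact: lsmooth_cst|exact: dl_cst].
Qed.

Lemma closed_homog0 p : closed_homog p (lcst 0).
Proof.
split=> [x [] //||x]; [exact: lsmooth_cst|exact: dl_cst].
Qed.

Lemma good_filtered p a : closed_homog p a -> (forall x, filtered (wt x) p (a x)) -> good p a.
Proof.
move=> ca fa; split=> //; exists (lcst 0), a; split=> // [|x]; first exact: lsmooth_cst.
by rewrite dl_cst add0r.
Qed.

Lemma good0 p : good p (lcst 0).
Proof. by apply: good_filtered => [|x [|v s]]; [exact: closed_homog0| |]. Qed.

Lemma good_cst k : good 0 (lcst k).
Proof. by apply: good_filtered => //; exact: closed_homog_cst. Qed.

Lemma goodD p a b : good p a -> good p b -> good p (ladd a b).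
Proof.
move=> [ca [h [a' [sh ca' fa ea]]]] [cb [g [b' [sg cb' fb eb]]]].
split; first exact: closed_homogD.
exists (ladd h g), (ladd a' b'); split=> [||x|x].
- exact: lsmoothD.
- exact: closed_homogD.
- exact: filteredD.
- by rewrite dlD // /ladd ea eb addrACA.
Qed.

(** With a = dh + a' and b = dg + b', closedness gives a b = d(h b) + a' dg + a' b' and a' dg =
    (-1)^p d(a' g). *)
Lemma goodM p q a b : good p a -> good q b -> good (p + q) (lmul a b).
Proof.
move=> [ca [h [a' [sh ca' fa ea]]]] [cb [g [b' [sg cb' fb eb]]]].
split; first exact: closed_homogM.
have [_ sb db] := cb; have [ha' sa' da'] := ca'.
pose e : lform := lmul (lcst ((-1) ^+ p)) (lmul a' g).
have se : lsmooth e by apply: lsmoothM; [exact: lsmooth_cst|exact: lsmoothM].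
exists (ladd (lmul h b) e), (lmul a' b'); split=> [||x|x].
- by apply: lsmoothD => //; exact: lsmoothM.
- exact: closed_homogM.
- exact: filteredM.
rewrite dlD //; last exact: lsmoothM.
rewrite dlM // db mulr0 addr0 dl_scale; last exact: lsmoothM.
rewrite dlM // da' mul0r add0r (sbar_homog (ha' x)).
rewrite -[lcst _ x]/(scst ((-1) ^+ p)) !mulrA -rmorphM -expr2 sqrr_sign rmorph1 mul1r.
by rewrite /lmul ea mulrDl -addrA; congr (_ + _); rewrite eb mulrDr.
Qed.

Lemma good_scale p k a : good p a -> good p (lmul (lcst k) a).
Proof. by move=> ga; rewrite -[p]add0n; exact: goodM (good_cst k) ga. Qed.

Lemma good_eq p a b : (forall x, a x = b x) -> good p a -> good p b.
Proof. by move=> ab; have -> : a = b by exact: funext. Qed.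

Lemma good_sum I (r : seq I) p (F : I -> lform) : (forall i, good p (F i)) ->
  good p (fun x => \sum_(i <- r) F i x).
Proof.
move=> GF; elim: r => [|i r IH].
  by apply: good_eq (good0 p) => x; rewrite big_nil; apply/shufP => -[].
by apply: good_eq (goodD (GF i) IH) => x; rewrite big_cons.
Qed.

Lemma good_multialt p a x : good p a -> multilin (a x) /\ altern (a x).
Proof. by move=> [[_ sa _] _]; split; [exact: lsmooth_lin|exact: lsmooth_alt]. Qed.
End Good.

Section GoodForms.
Context {R : realType} {m' : nat}.
Local Notation m := m'.+1.
Context {M : manifold R m}.
Local Notation V := 'rV[R]_m.
Variable wt : M -> V -> nat.
Implicit Types (x y : M) (a b h : lform (M := M)).
Variables (nabla nabla' : vfield M -> vfield M -> vfield M).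
Hypotheses (cn : is_connection nabla) (cn' : is_connection nabla').
Variables (Omega Omega' : M -> 'M[R]_(2, m) -> 'M[R]_m).
Hypotheses (cO : is_curvature nabla Omega) (cO' : is_curvature nabla' Omega').
Hypothesis wt_flat : forall x v w, wt x v = 0%N -> wt x w = 0%N -> Omega' x (rows2 v w) = 0.

Lemma homog_curv (Om : M -> 'M[R]_(2, m) -> 'M[R]_m) x i j : homog 2 (curv_mx Om x i j).
Proof. by rewrite mxE; exact: lf_homog. Qed.

Lemma trace_closed_homog nb Om s : is_connection nb -> is_curvature nb Om ->
  closed_homog (s.+1 * 2) (trace_form (M := M) Om s.+1).
Proof.
move=> cnb cOm; have [sa da _] := trace_transgression_form cnb cnb cOm cOm s.+1.
have [_ da' _] := trace_transgression_form cnb cnb cOm cOm s.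
split=> // x; apply: (@graded_trace_pow _ _ (@homog V R)) => [p||p a b|p q a b|i j].
- exact: homog0.
- exact: homog1.
- exact: homogD.
- exact: homogM.
- exact: homog_curv.
Qed.

Lemma good_trace s : good wt (s.+1 * 2) (trace_form (M := M) Omega s.+1).
Proof.
split; first exact: trace_closed_homog cn cO.
have [_ _ [h sh eh]] := trace_transgression_form cn' cn cO' cO s.+1.
exists h, (trace_form Omega' s.+1); split=> // [|x|x].
- exact: trace_closed_homog cn' cO'.
- apply: (@graded_trace_pow _ _ (@filtered V R (wt x))) => [p||p a b|p q a b|i j].
  + exact: filtered0.
  + exact: filtered1.
  + exact: filteredD.
  + exact: filteredM.
  (* In degree 2, being below level 2 means that both arguments have weight 0, where the curvature
     vanishes. *)
  move=> t wt0; rewrite curv_mxE; case: t wt0 => [|v [|w [|z t]]] //= wt0.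
  by rewrite wt_flat ?mxE //; lia.
- by rewrite eh addrC.
Qed.

Lemma even_curv x i j : curv_mx Omega x i j \in @even_pred V R.
Proof.
apply/asboolP; rewrite (sbar_homog (homog_curv _ x i j)) expr2 mulrNN mulr1.
by rewrite rmorph1 mul1r.
Qed.

Definition even_curv_mx x : 'M[@even_form V R]_m :=
  \matrix_(i, j) EvenForm (even_curv x i j).

Lemma even_curv_mxE x : map_mx (\val : @even_form V R -> _) (even_curv_mx x) = curv_mx Omega x.
Proof. by apply/matrixP => i j; rewrite !mxE. Qed.

(** The recursion of [minorsS] replaces two matrices by their product, so the statement is
    generalised from the curvature to powers of it with varying exponents. These start at 1, the
    range covered by [good_trace]. *)
Lemma good_minors s (e : 'I_s -> nat) :
  good wt (\sum_l (e l).+1 * 2)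
    (fun x => \val (minors (fun l => even_curv_mx x ^+ (e l).+1))).
Proof.
elim: s e => [|s IH] e.
  rewrite big_ord0; apply: good_eq (good_cst wt 1) => x.
  by rewrite minors0; apply/shufP => -[].
have e1 x : \tr (curv_mx Omega x ^+ (e ord0).+1) =
    \val (\tr (even_curv_mx x ^+ (e ord0).+1)).
  by rewrite -even_curv_mxE -rmorphXn; exact: trace_map_mx.
(* The product of the powers e_b + 1 and e_0 + 1 has exponent (e_b + e_0 + 1) + 1. *)
pose e' (b l : 'I_s) := if l == b then (e (lift ord0 b) + e ord0).+1 else e (lift ord0 l).
pose G : lform := fun x => trace_form Omega (e ord0).+1 x *
  \val (minors (fun l => even_curv_mx x ^+ (e (lift ord0 l)).+1)).
pose G' (b : 'I_s) : lform := fun x => lmul (lcst (-1))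
  (fun x => \val (minors (fun l => even_curv_mx x ^+ (e' b l).+1))) x.
have gG : good wt (\sum_l (e l).+1 * 2) G.
  by rewrite big_ord_recl; apply: goodM; [exact: good_trace|exact: IH].
have gG' (b : 'I_s) : good wt (\sum_l (e l).+1 * 2) (G' b).
  have -> : (\sum_l (e l).+1 * 2 = \sum_l (e' b l).+1 * 2)%N.
    rewrite big_ord_recl (bigD1 b) //= [RHS](bigD1 b) //= /e' eqxx addnA.
    congr (_ + _)%N; first lia.
    by apply: eq_bigr => l /negbTE->.
  exact/good_scale/IH.
apply: good_eq (goodD gG (good_sum (index_enum 'I_s) gG')) => x.
rewrite /ladd /G /G' /trace_form e1 minorsS rmorphB rmorphM; congr (_ + _).
rewrite raddf_sum -sumrN; apply: eq_bigr => b _.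
rewrite /lmul -[lcst _ _]/(scst (-1)) rmorphN1 mulN1r; congr (- \val (minors _)).
apply/funext => l; rewrite /e'; case: (l == b) => //.
by rewrite -[_ *m _]/(_ * _) -exprD; congr (_ ^+ _); lia.
Qed.
End GoodForms.

(** * Vanishing of filtered forms in degree above twice the rank of Q *)

Section AlternatingVanish.
Context {R : realType} {m : nat}.
Local Notation V := 'rV[R]_m.
Implicit Types (a : shuffle V R) (s : seq V).

Lemma altern_uniq a s : antisym a -> altern a -> ~~ uniq s -> a s = 0.
Proof.
move=> ya aa; suff H s1 : ~~ uniq s -> a (s1 ++ s) = 0 by exact: (H [::]).
elim: s s1 => //= v s IH s1; rewrite negb_and negbK; case/orP => [vs|nu].
  by case/splitPr: vs => p1 p2; exact: altern_far.
by rewrite -cat_rcons; exact: IH.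
Qed.

Lemma multilin_lincomb a s1 s2 I (r : seq I) (c : I -> R) (w : I -> V) u : multilin a ->
  (forall i, a (s1 ++ w i :: s2) = 0) -> a (s1 ++ u :: s2) = 0 ->
  a (s1 ++ (\sum_(i <- r) c i *: w i + u) :: s2) = 0.
Proof.
move=> la wz uz; elim: r => [|i r IH]; first by rewrite big_nil add0r.
by rewrite big_cons -addrA la wz IH mulr0 addr0.
Qed.

(** By multilinearity it is enough to test on vectors that lie in L or in a fixed basis of Q. If the
    filtration does not already give 0, more than rank Q arguments are basis vectors outside L, so
    one is repeated and alternation gives 0. *)
Lemma filtered_vanish a p (L Q : 'M[R]_m) : multilin a -> altern a ->
  filtered (fun v => ~~ (v <= L)%MS : nat) p a ->
  (2 * \rank Q < p)%N -> (1%:M <= L + Q)%MS -> a = 0.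
Proof.
move=> la aa fa pQ LQ; have ya := antisym_of la aa.
pose qs : seq V := [seq row i (row_base Q) | i : 'I_(\rank Q)].
pose special v := (v <= L)%MS || (v \in qs).
have base s : all special s -> a s = 0.
  move=> As; have [/fa//|ps] := ltnP (2 * sumn [seq (~~ (v <= L)%MS : nat) | v <- s]) p.
  apply: altern_uniq => //; apply/negP => us.
  pose T := [seq v <- s | ~~ (v <= L)%MS].
  have sT : size T = sumn [seq (~~ (v <= L)%MS : nat) | v <- s].
    by rewrite size_filter -sumn_count.
  have : (size T <= size qs)%N.
    apply: uniq_leq_size; first exact: filter_uniq.
    move=> v; rewrite mem_filter => /andP[nL vs].
    by have := allP As _ vs; rewrite /special (negbTE nL).
  by rewrite size_map size_enum_ord sT; lia.
(* Arguments are expanded from left to right: those of s1 have been replaced by vectors of L or of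
   the basis, those of s2 are arbitrary. *)
suff H s2 s1 : all special s1 -> a (s1 ++ s2) = 0 by apply/shufP => s; exact: (H s [::]).
elim: s2 s1 => [|v s2 IH] s1 As; first by rewrite cats0; exact: base.
have step w : special w -> a (s1 ++ w :: s2) = 0.
  by move=> sw; rewrite -cat_rcons; apply: IH; rewrite all_rcons sw.
have /sub_addsmxP[u ->] : (v <= L + Q)%MS by exact: submx_trans (submx1 _) LQ.
have : (u.2 *m Q <= row_base Q)%MS by rewrite eq_row_base submxMl.
case/submxP => D ->; rewrite addrC mulmx_sum_row.
apply: multilin_lincomb => // [i|].
  by apply: step; apply/orP; right; apply: map_f; rewrite mem_enum.
by apply: step; apply/orP; left; exact: submxMl.
Qed.
End AlternatingVanish.

(** * Exactness and the Pontryagin algebra *)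

Section Exact.
Context {R : realType} {m : nat} {M : manifold R m}.
Local Notation V := 'rV[R]_m.

Lemma lf_add p (a b : dform M p) : lf (form_add a b) = ladd (lf a) (lf b).
Proof.
apply/funext => x; apply/shufP => s; rewrite /ladd [RHS]shuffleE /lf /form_add.
by case: ifP => _; rewrite ?addr0.
Qed.

Lemma lf_scale p k (a : dform M p) : lf (form_scale k a) = lmul (lcst k) (lf a).
Proof.
apply/funext => x; apply/shufP => s; rewrite /lmul lcstM /lf /form_scale.
by case: ifP => _; rewrite ?mulr0.
Qed.

Lemma lf0 p : lf (form0 M p) = lcst 0.
Proof.
by apply/funext => x; apply/shufP => s; rewrite /lf /form0 /lcst if_same; case: s.
Qed.

Lemma lf1 : lf (@form1 R m M) = lcst 1.
Proof. by apply/funext => x; apply/shufP => -[]. Qed.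

(** The primitive h may have components in all degrees; the part of degree q, extracted by [fl], is
    the one that contributes to [dl h] in degree q + 1. *)
Lemma dl_exact q (h : lform (M := M)) (w : dform M q.+1) : lsmooth h -> lf w = dl h ->
  exact_form w.
Proof.
move=> sh wh; exists (fl q h); first exact: fl_smooth.
rewrite -[LHS]fl_lf -[RHS]fl_lf lf_ext_d wh; apply/funext => x; apply/funext => A.
rewrite /fl /dl; apply: eq_bigr => i _; congr (_ * _).
apply: (congr1 (fun f : V -> R^o => 'D_(nth 0 (rows A) i) f (chart_at x x))).
apply/funext => u; rewrite /lrep /pull /smap /lf.
have sz : size [seq v *m dchart_inv (chart_at x) (cinv (chart_at x) u) | v <- delete i (rows A)] == q.
  have iA := ltn_ord i; rewrite size_map size_cat size_takel ?size_drop; last exact: ltnW.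
  by move: (size_rows A) (nat_of_ord i) iA => -> k; lia.
by rewrite sz rowsK ?(eqP sz).
Qed.

Lemma exact_comb q (w w' : dform M q.+1) k : exact_form w -> exact_form w' ->
  exact_form (form_add w (form_scale k w')).
Proof.
move=> [h sh ->] [h' sh' ->]; have sl := lf_smooth sh; have sl' := lf_smooth sh'.
have sk : lsmooth (lmul (lcst k) (lf h')) by apply: lsmoothM => //; exact: lsmooth_cst.
apply: (@dl_exact _ (ladd (lf h) (lmul (lcst k) (lf h')))); first exact: lsmoothD.
apply/funext => x; rewrite lf_add lf_scale !lf_ext_d dlD //; congr (_ + _).
by rewrite dl_scale.
Qed.

Lemma Pont_exact q : (forall w : dform M q.+1, pont_form w -> exact_form w) ->
  Pont M q.+1 = [set cohomology_class (form0 M q.+1)].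
Proof.
move=> H; apply/seteqP; split=> [_ [w pw ->]|_ ->]; last first.
  by exists (form0 M q.+1) => //; exact: pont_zero.
apply/seteqP; split=> w' [sw' cw' ew']; split=> //.
  have -> : form_add w' (form_scale (-1) (form0 M q.+1)) =
      form_add (form_add w' (form_scale (-1) w)) (form_scale 1 w).
    by apply/funext => x; apply/funext => A; rewrite /form_add /form_scale /form0; ring.
  by apply: exact_comb => //; exact: H.
have -> : form_add w' (form_scale (-1) w) =
    form_add (form_add w' (form_scale (-1) (form0 M q.+1))) (form_scale (-1) w).
  by apply/funext => x; apply/funext => A; rewrite /form_add /form_scale /form0; ring.
by apply: exact_comb => //; exact: H.
Qed.
End Exact.

Section Pontryagin.
Context {R : realType} {m' : nat}.
Local Notation m := m'.+1.
Context {M : manifold R m}.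
Local Notation V := 'rV[R]_m.
Variable wt : M -> V -> nat.
Implicit Types (x y : M) (a b h : lform (M := M)).

Lemma lf_wedge_prod s (F : 'I_s -> dform M 2) x :
  (forall l, multialt (lf (F l) x)) ->
  multialt (lf (wedge_prod F) x) /\ lf (wedge_prod F) x = \prod_l lf (F l) x.
Proof.
elim: s F => [|s IH] F HF.
  by rewrite big_ord0 /= lf1; split; [split; [exact: lsmooth_lin (lsmooth_cst 1) x|
    exact: lsmooth_alt (lsmooth_cst 1) x]|apply/shufP => -[]].
have [m1 e1] := IH (fun l => F (lift ord0 l)) (fun l => HF (lift ord0 l)).
have e : lf (wedge_prod F) x = lf (F ord0) x * lf (wedge_prod (fun l => F (lift ord0 l))) x.
  have [l0 a0] := HF ord0; have [l1 a1] := m1.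
  exact: (@lf_wedge _ _ M 2 (s * 2) (F ord0) _ x (antisym_of l0 a0) (antisym_of l1 a1)).
split; first by rewrite e; exact: multialtM.
by rewrite e e1 big_ord_recl.
Qed.

Section Coefficients.
Variables (nabla nabla' : vfield M -> vfield M -> vfield M).
Hypotheses (cn : is_connection nabla) (cn' : is_connection nabla').
Variables (Omega Omega' : M -> 'M[R]_(2, m) -> 'M[R]_m).
Hypotheses (cO : is_curvature nabla Omega) (cO' : is_curvature nabla' Omega').
Hypothesis wt_flat : forall x v w, wt x v = 0%N -> wt x w = 0%N -> Omega' x (rows2 v w) = 0.

Lemma lf_det_coef s x : lf (@det_coef R m M Omega s) x =
  scst (s`!%:R)^-1 * \val (minors (fun _ : 'I_s => even_curv_mx Omega x)).
Proof.
have [A HA] := connection_difference cn cn.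
have mc i j : multialt (lf (fun y z => Omega y z i j) x).
  by have := multialt_curv cn cn cO HA x i j; rewrite mxE.
have sE I (r : seq I) (F : I -> shuffle V R) t : (\sum_(i <- r) F i) t = \sum_(i <- r) F i t.
  by elim/big_rec2: _ => // k y1 y2 _ <-.
have key (I : {ffun 'I_s -> 'I_m}) (u : 'S_s) t :
    \val ((-1) ^+ u * \prod_l even_curv_mx Omega x (I l) (I (u l))) t =
    (-1) ^+ u * lf (wedge_prod (fun l y z => Omega y z (I l) (I (u l)))) x t.
  have [_ ->] := lf_wedge_prod (fun l => mc (I l) (I (u l))).
  rewrite rmorphM rmorph_sign rmorph_prod !mulr_sign.
  have -> : \prod_l \val (even_curv_mx Omega x (I l) (I (u l))) =
      \prod_l lf (fun y z => Omega y z (I l) (I (u l))) x.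
    apply: eq_bigr => l _; rewrite mxE; exact: mxE.
  by case: ifP => _; rewrite ?shuffleE.
apply/shufP => t; rewrite scstM /minors raddf_sum sE.
transitivity ((s`!%:R)^-1 * \sum_(I : {ffun 'I_s -> 'I_m}) \sum_(u : 'S_s) (-1) ^+ u *
    lf (wedge_prod (fun l y z => Omega y z (I l) (I (u l)))) x t); last first.
  congr (_ * _); apply: eq_bigr => I _; rewrite raddf_sum sE.
  by apply: eq_bigr => u _; exact: esym (key I u t).
rewrite /lf; case: ifP => // st; rewrite big1 ?mulr0 // => I _.
by rewrite big1 // => u _; rewrite mulr0.
Qed.

Lemma good_det_coef s : good wt (s * 2) (lf (@det_coef R m M Omega s)).
Proof.
have := good_minors cn cn' cO cO' wt_flat (fun _ : 'I_s => 0%N).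
rewrite sum_nat_const card_ord => /(good_scale (s`!%:R)^-1).
by apply: good_eq => x; rewrite lf_det_coef.
Qed.
End Coefficients.

Hypothesis flat_connection : forall nabla : vfield M -> vfield M -> vfield M,
  is_connection nabla -> exists nabla' Omega',
  [/\ is_connection nabla', is_curvature nabla' Omega' &
    forall x v w, wt x v = 0%N -> wt x w = 0%N -> Omega' x (rows2 v w) = 0].

(** The generators in one expression may come from different connections, which is why
    [flat_connection] speaks of every connection. *)
Lemma good_pont p (w : dform M p) : pont_form w -> good wt p (lf w).
Proof.
elim=> {p w} [nabla Omega r cn cO|p| |p a b _ ga _ gb|p k a _ ga|p q a b _ ga _ gb].
- have [nabla' [ Omega' [cn' cO' fl']]] := flat_connection cn.
  by rewrite /pontryagin_form lf_scale; apply: good_scale; exact: (@good_det_coef nabla nabla' cn cn' Omega Omega' cO cO' fl').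
- by rewrite lf0; exact: good0.
- by rewrite lf1; exact: good_cst.
- by rewrite lf_add; exact: goodD.
- by rewrite lf_scale; exact: good_scale.
apply: good_eq (goodM ga gb) => x; rewrite lf_wedge //.
- by have [] := good_multialt x ga; exact: antisym_of.
- by have [] := good_multialt x gb; exact: antisym_of.
Qed.
End Pontryagin.

Lemma pont_exact (R : realType) m' (M : manifold R m'.+1) (L Q : tdistribution M) n q
    (w : dform M q.+1) :
  (forall x, \rank (Q x) <= n)%N -> (forall x, (1%:M <= L x + Q x)%MS) ->
  (2 * n < q.+1)%N ->
  (forall nabla : vfield M -> vfield M -> vfield M, is_connection nabla ->
    exists nabla' Omega', [/\ is_connection nabla', is_curvature nabla' Omega' &
    forall x v w, (v <= L x)%MS -> (w <= L x)%MS -> Omega' x (rows2 v w) = 0]) ->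
  pont_form w -> exact_form w.
Proof.
move=> rQ LQ nq fc pw; pose wt x (v : 'rV[R]_m'.+1) : nat := ~~ (v <= L x)%MS.
have [|_ [h [a' [sh [_ sa' _] fa' e]]]] := good_pont (wt := wt) _ pw.
  move=> nb cnb; have [nb' [ Om' [cnb' cOm' H]]] := fc nb cnb.
  exists nb', Om'; split=> // x v z /eqP; rewrite eqb0 negbK => vL /eqP.
  by rewrite eqb0 negbK; exact: H.
apply: (dl_exact sh); apply/funext => x; rewrite e.
have -> : a' x = 0; last by rewrite addr0.
apply: (filtered_vanish _ _ (fa' x) _ (LQ x)); [exact: lsmooth_lin|exact: lsmooth_alt|].
by apply: leq_ltn_trans nq; rewrite leq_mul2l rQ.
Qed.

Section DimensionZero.
Context {R : realType} {m : nat} {M : manifold R m} (m0 : m = 0%N).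

(** The Chern-Weil part uses matrix rings of nonzero size, so dimension 0 is treated apart; there
    the sum defining a coefficient of positive degree is empty. *)
Lemma det_coef_dim0 (Omega : M -> 'M[R]_(2, m) -> 'M[R]_m) s x A :
  (0 < s)%N -> @det_coef R m M Omega s x A = 0.
Proof.
move=> s0; rewrite /det_coef big1 ?mulr0 // => I _.
by have := ltn_ord (I (Ordinal s0)); rewrite [X in (_ < X)%N]m0.
Qed.

Lemma lf_dim0 p (w : dform M p) : pont_form w -> (0 < p)%N -> w = form0 M p.
Proof.
elim=> {p w} [nabla Omega r _ _|p| |p a b _ IHa _ IHb|p k a _ IHa|p q a b _ IHa _ IHb] p0.
- apply/funext => x; apply/funext => A; rewrite /pontryagin_form /form_scale det_coef_dim0 ?mulr0 //.
  by move: p0; rewrite !muln_gt0 andbT.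
- by [].
- by [].
- by rewrite IHa // IHb //; apply/funext => x; apply/funext => A; rewrite /form_add addr0.
- by rewrite IHa //; apply/funext => x; apply/funext => A; rewrite /form_scale mulr0.
apply/funext => x; apply/funext => A; rewrite /wedge big1 ?mulr0 // => s _.
case: (posnP p) => [pz|pp]; last by rewrite (IHa pp) mul0r mulr0.
have qq : (0 < q)%N by rewrite pz in p0.
by rewrite (IHb qq) mulr0 mulr0.
Qed.
End DimensionZero.

Lemma exact_form0 (R : realType) m (M : manifold R m) q : exact_form (form0 M q.+1).
Proof.
apply: (@dl_exact _ _ _ q (lcst 0)); first exact: lsmooth_cst.
by rewrite lf0; apply/funext => x; rewrite dl_cst; apply/shufP => -[].
Qed.

Theorem proposition4p1 (R : realType) (n k : nat) (k_gt0 : (0 < k)%N)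
  (M : manifold R (n * k.+1)%N) (omega : 'I_k -> dform M 2)
  (L : tdistribution M) (ksympl : k_symplectic n omega L)
  (Q : tdistribution M) (Q_integrable : integrable_distr n Q)
  (TM_eq : forall x, (L x + Q x == 1%:M)%MS)
  (LQ_direct : forall x, (L x :&: Q x)%MS = 0)
  (hi : forall (a : 'I_k) (Y Y' : vfield M),
    section_of (fiber Q) Y -> section_of (fiber Q) Y' ->
    forall x, omega a x (rows2 (Y x) (Y' x)) = 0)
  (hii : forall (a : 'I_k) (X Y : vfield M),
    section_of (L_ omega L a) X -> section_of (fiber Q) Y ->
    section_of (fiber_add (L_ omega L a) (fiber Q)) (bracket X Y))
  (hiii : forall (Y Y' : vfield M),
    section_of (fiber Q) Y -> section_of (fiber Q) Y' ->
    forall a b : 'I_k,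
      istar_inv (omega a) (L_ omega L a) Q (psi (omega a) Y Y')
      = istar_inv (omega b) (L_ omega L b) Q (psi (omega b) Y Y'))
  (j : nat) (hj : (2 * n < j)%N) :
  Pont M j = [set cohomology_class (form0 M j)].
Proof.
case: j hj => // q hq.
have fc := leafwise_flat_connection k_gt0 ksympl Q_integrable TM_eq LQ_direct.
have rQ := rank_Q Q_integrable.
have LQ x : (1%:M <= L x + Q x)%MS by rewrite (eqmxP (TM_eq x)).
apply: Pont_exact => w pw; clear hi hii hiii TM_eq LQ_direct Q_integrable ksympl omega.
(* The dimension is generalised in order to separate 0 from the successors that matrix rings
   require. *)
move: M L Q rQ LQ fc w pw; case e : (n * k.+1)%N => [|m'] M L Q rQ LQ fc w pw.
  by rewrite (lf_dim0 erefl pw) //; exact: exact_form0.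
exact: pont_exact rQ LQ hq fc pw.
Qed.
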